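(* Let $\mu$ be a nonatomic Borel measure on a compactum $X$. (i) Assume that $X\notin J_f(\mu)$ and that every Borel set $B\subseteq X$ with $B\notin J_f(\mu)$ contains a Borel set $C\notin J_f(\mu)$ with $\mu(C)<\infty$. Then the completion of the quotient Boolean algebra $Bor(X)/J_f(\mu)$ is homogeneous and isomorphic to the completion of the quotient Boolean algebra $Bor([0,1]^2)/J_f(\mathscr{H}^1)$. (ii) If $\mu$ is semifinite and $\mu(X)>0$, then the completion of the quotient Boolean algebra $Bor(X)/J_0(\mu)$ is homogeneous and isomorphic to the completion of the quotient Boolean algebra $Bor([0,1])/J_0(\lambda)$.
   Context: A compactum is a compact metrizable space; $Bor(X)$ is the $\sigma$-algebra of Borel sets in $X$. A Borel measure on $X$ is a countably additive measure $Bor(X)\to[0,\infty]$. It is nonatomic if every Borel set $A$ with $\mu(A)>0$ contains a Borel set $A'$ with $0<\mu(A')<\mu(A)$. It is semifinite if each Borel set of positive $\mu$-measure contains a Borel set of finite positive $\mu$-measure. $J_f(\mu)$ (respectively $J_0(\mu)$) is the $\sigma$-ideal of Borel sets in $X$ that can be covered by countably many compact subsets of $X$ of finite $\mu$-measure (respectively of $\mu$-measure zero). $\mathscr{H}^1$ is the 1-dimensional Hausdorff measure on (Borel sets of) the Euclidean square $[0,1]^2$, and $\lambda$ is the Lebesgue measure on $[0,1]$. A Boolean algebra $\mathbf{A}$ is homogeneous if for every non-zero $\mathbf{a}\in\mathbf{A}$ the relative algebra $\mathbf{A}\restriction\mathbf{a}=\{\mathbf{b}\in\mathbf{A}:\mathbf{b}\le\mathbf{a}\}$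 is isomorphic to $\mathbf{A}$. *)

(* Defs.v *)
From HB Require Import structures.
From mathcomp Require Import all_boot all_order all_algebra.
From mathcomp Require Import all_classical all_reals all_analysis.

Set Implicit Arguments.
Unset Strict Implicit.
Unset Printing Implicit Defensive.

Import Order.Theory GRing.Theory Num.Theory.
Import numFieldNormedType.Exports.

(* Boolean algebras are MathComp's [ctbDistrLatticeType]s (complemented
   distributive lattices with \bot and \top). *)

Section BooleanIsomorphism.
Local Open Scope order_scope.

Definition ba_morphism d (A : ctbDistrLatticeType d)
    d' (B : ctbDistrLatticeType d') (f : A -> B) : Prop :=
  [/\ {morph f : x y / x `&` y >-> x `&` y},
      {morph f : x y / x `|` y >-> x `|` y} &
      {morph f : x / ~` x >-> ~` x}].

Definition ba_isomorphic d (A : ctbDistrLatticeType d)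
    d' (B : ctbDistrLatticeType d') : Prop :=
  exists2 f : A -> B, ba_morphism f & bijective f.

End BooleanIsomorphism.

Section RelativeAlgebra.
Context d (A : ctbDistrLatticeType d) (a : A).
Local Open Scope order_scope.

Definition below : pred A := [pred b | b <= a].

Definition relative_algebra := {b : A | below b}.

HB.instance Definition _ := SubChoice.on relative_algebra.

Fact below_meet : meet_closed below.
Proof. by move=> x y; rewrite !inE => xa _; apply: leIxl. Qed.

Fact below_join : join_closed below.
Proof. by move=> x y; rewrite !inE leUx => -> ->. Qed.

Fact below_bot : \bot \in below.
Proof. by rewrite inE le0x. Qed.

HB.instance Definition _ := Order.SubChoice_isBSubLattice.Build
  d A below d relative_algebra below_meet below_join below_bot.

Fact relative_valI (x y : relative_algebra) :
  val (x `&` y) = val x `&` val y.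
Proof. by []. Qed.

Fact relative_valU (x y : relative_algebra) :
  val (x `|` y) = val x `|` val y.
Proof. by []. Qed.

Fact relative_meetUl : @left_distributive relative_algebra relative_algebra
  Order.meet Order.join.
Proof.
by move=> x y z; apply: val_inj; rewrite relative_valI !relative_valU !relative_valI meetUl.
Qed.

HB.instance Definition _ := Order.Lattice_Meet_isDistrLattice.Build
  d relative_algebra relative_meetUl.

Definition relative_top : relative_algebra := exist _ a (lexx a).

Fact relative_lex1 (x : relative_algebra) : x <= relative_top.
Proof. by rewrite leEsub /=; exact: valP x. Qed.

HB.instance Definition _ := Order.hasTop.Build d relative_algebra relative_lex1.

Fact relative_compl_subproof (x : relative_algebra) : below (a `\` val x).
Proof. exact: leBx. Qed.

Definition relative_compl (x : relative_algebra) : relative_algebra :=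
  exist _ (a `\` val x) (relative_compl_subproof x).

Fact relative_joinxC x : x `|` relative_compl x = \top.
Proof.
by apply: val_inj; rewrite relative_valU diffKU; apply/join_idPr/(valP x).
Qed.

Fact relative_meetxC x : x `&` relative_compl x = \bot.
Proof. by apply: val_inj; rewrite relative_valI diffKI. Qed.

HB.instance Definition _ := Order.TBDistrLattice_hasComplement.Build
  d relative_algebra relative_joinxC relative_meetxC.

End RelativeAlgebra.

Definition homogeneous d (A : ctbDistrLatticeType d) : Prop :=
  forall a : A, a != \bot%O -> ba_isomorphic (relative_algebra a) A.

Section Quotient.
Context d (A : ctbDistrLatticeType d).
Local Open Scope order_scope.
Local Open Scope quotient_scope.

Record ideal := Ideal {
  ideal_mem :> A -> Prop ;
  ideal0 : ideal_mem \bot ;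
  idealU : forall x y, ideal_mem x -> ideal_mem y -> ideal_mem (x `|` y) ;
  ideal_le : forall x y, x <= y -> ideal_mem y -> ideal_mem x
}.

Variable I : ideal.

Definition ideal_eq : rel A := fun x y => `[< I ((x `\` y) `|` (y `\` x)) >].

Lemma ideal_eqP x y : reflect (I (x `\` y) /\ I (y `\` x)) (ideal_eq x y).
Proof.
apply: (iffP (asboolP _)) => [h|[]]; last exact: idealU.
by split; apply: ideal_le h; [exact: leUl|exact: leUr].
Qed.

Lemma ideal_diff_trans y x z : I (x `\` y) -> I (y `\` z) -> I (x `\` z).
Proof.
move=> xy yz; apply: ideal_le (idealU xy yz).
by rewrite leBLR joinCA diffKU joinCA diffUK joinCA leUl.
Qed.

Fact ideal_eq_refl : reflexive ideal_eq.
Proof. by move=> x; apply/ideal_eqP; rewrite diffxx; split; exact: ideal0. Qed.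

Fact ideal_eq_sym : symmetric ideal_eq.
Proof. by move=> x y; apply/ideal_eqP/ideal_eqP => -[]. Qed.

Fact ideal_eq_trans : transitive ideal_eq.
Proof.
move=> y x z /ideal_eqP[xy yx] /ideal_eqP[yz zy]; apply/ideal_eqP.
by split; [exact: ideal_diff_trans xy yz|exact: ideal_diff_trans zy yx].
Qed.

Canonical ideal_eq_equiv :=
  EquivRel ideal_eq ideal_eq_refl ideal_eq_sym ideal_eq_trans.

Definition quotient_algebra := {eq_quot ideal_eq}.

HB.instance Definition _ := Choice.on quotient_algebra.
HB.instance Definition _ := EqQuotient.on quotient_algebra.

Definition quotient_meet := lift_op2 quotient_algebra (@Order.meet d A).
Definition quotient_join := lift_op2 quotient_algebra (@Order.join d A).
Definition quotient_compl := lift_op1 quotient_algebra (@Order.compl d A).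
Definition quotient_bot : quotient_algebra := lift_cst quotient_algebra \bot.
Definition quotient_top : quotient_algebra := lift_cst quotient_algebra \top.
Definition quotient_le (x y : quotient_algebra) := quotient_meet x y == x.
Definition quotient_lt (x y : quotient_algebra) :=
  (y != x) && quotient_le x y.

Lemma quotient_piP (x y : A) :
  reflect (\pi_quotient_algebra x = \pi_quotient_algebra y) (ideal_eq x y).
Proof. exact: eqmodP. Qed.

Fact pi_quotient_compl : {morph \pi : x / ~` x >-> quotient_compl x}.
Proof.
move=> x; unlock quotient_compl; apply/quotient_piP/ideal_eqP.
have /quotient_piP/ideal_eqP[] : \pi_quotient_algebra x =
  \pi_quotient_algebra (repr (\pi_quotient_algebra x)) by rewrite reprK.
by rewrite !diffE !complK => *; rewrite meetC [_ `&` x]meetC.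
Qed.

Fact pi_quotient_join : {morph \pi : x y / x `|` y >-> quotient_join x y}.
Proof.
move=> x y; unlock quotient_join; apply/quotient_piP/ideal_eqP.
set x' := repr _; set y' := repr _.
have /quotient_piP/ideal_eqP[xx' x'x] : \pi_quotient_algebra x =
  \pi_quotient_algebra x' by rewrite reprK.
have /quotient_piP/ideal_eqP[yy' y'y] : \pi_quotient_algebra y =
  \pi_quotient_algebra y' by rewrite reprK.
by split; [apply: ideal_le (idealU xx' yy')|apply: ideal_le (idealU x'x y'y)];
  rewrite diffUx leU2 ?leBr ?leUl ?leUr.
Qed.

Fact pi_quotient_meet : {morph \pi : x y / x `&` y >-> quotient_meet x y}.
Proof.
move=> x y; unlock quotient_meet; apply/quotient_piP/ideal_eqP.
set x' := repr _; set y' := repr _.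
have /quotient_piP/ideal_eqP[xx' x'x] : \pi_quotient_algebra x =
  \pi_quotient_algebra x' by rewrite reprK.
have /quotient_piP/ideal_eqP[yy' y'y] : \pi_quotient_algebra y =
  \pi_quotient_algebra y' by rewrite reprK.
by split; [apply: ideal_le (idealU xx' yy')|apply: ideal_le (idealU x'x y'y)];
  rewrite diffxI leU2 ?leBl ?leIl ?leIr.
Qed.

Canonical pi_quotient_compl_morph := PiMorph1 pi_quotient_compl.
Canonical pi_quotient_join_morph := PiMorph2 pi_quotient_join.
Canonical pi_quotient_meet_morph := PiMorph2 pi_quotient_meet.
Canonical pi_quotient_bot_morph := PiConst quotient_bot.
Canonical pi_quotient_top_morph := PiConst quotient_top.

Fact quotient_meetC : commutative quotient_meet.
Proof.
by move=> x y; rewrite -[x]reprK -[y]reprK !piE meetC.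
Qed.

Fact quotient_joinC : commutative quotient_join.
Proof. by move=> x y; rewrite -[x]reprK -[y]reprK !piE joinC. Qed.

Fact quotient_meetA : associative quotient_meet.
Proof.
by move=> x y z; rewrite -[x]reprK -[y]reprK -[z]reprK !piE meetA.
Qed.

Fact quotient_joinA : associative quotient_join.
Proof.
by move=> x y z; rewrite -[x]reprK -[y]reprK -[z]reprK !piE joinA.
Qed.

Fact quotient_joinKI y x : quotient_meet x (quotient_join x y) = x.
Proof. by rewrite -[x]reprK -[y]reprK !piE joinKI. Qed.

Fact quotient_meetKU y x : quotient_join x (quotient_meet x y) = x.
Proof. by rewrite -[x]reprK -[y]reprK !piE meetKU. Qed.

Fact quotient_meetUl : left_distributive quotient_meet quotient_join.
Proof.
by move=> x y z; rewrite -[x]reprK -[y]reprK -[z]reprK !piE meetUl.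
Qed.

Fact quotient_meetxx : idempotent_op quotient_meet.
Proof. by move=> x; rewrite -[x]reprK !piE meetxx. Qed.

HB.instance Definition _ := Order.isMeetJoinDistrLattice.Build
  d quotient_algebra (fun _ _ => erefl) (fun _ _ => erefl)
  quotient_meetC quotient_joinC quotient_meetA quotient_joinA
  quotient_joinKI quotient_meetKU quotient_meetUl quotient_meetxx.

Fact quotient_le0x x : quotient_bot <= x.
Proof.
by rewrite leEmeet; apply/eqP; rewrite -[x]reprK /Order.meet/= !piE meet0x.
Qed.

Fact quotient_lex1 x : x <= quotient_top.
Proof.
by rewrite leEmeet; apply/eqP; rewrite -[x]reprK /Order.meet/= !piE meetx1.
Qed.

HB.instance Definition _ :=
  Order.hasBottom.Build d quotient_algebra quotient_le0x.
HB.instance Definition _ :=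
  Order.hasTop.Build d quotient_algebra quotient_lex1.

Fact quotient_joinxC (x : quotient_algebra) : x `|` quotient_compl x = \top.
Proof.
rewrite -[x]reprK /Order.join/Order.top/=.
by rewrite !piE joinxC.
Qed.

Fact quotient_meetxC (x : quotient_algebra) : x `&` quotient_compl x = \bot.
Proof.
rewrite -[x]reprK /Order.meet/Order.bottom/=.
by rewrite !piE meetxC.
Qed.

HB.instance Definition _ := Order.TBDistrLattice_hasComplement.Build
  d quotient_algebra quotient_joinxC quotient_meetxC.

Lemma quotient_morphism : ba_morphism (\pi_quotient_algebra : A -> _).
Proof.
by split; [exact: pi_quotient_meet|exact: pi_quotient_join|
  exact: pi_quotient_compl].
Qed.

Lemma quotient_eq0 (x : A) : (\pi_quotient_algebra x = \bot) <-> I x.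
Proof.
rewrite {1}/Order.bottom/= !piE.
split=> [/quotient_piP/ideal_eqP[]|Ix]; first by rewrite diffx0.
by apply/quotient_piP/ideal_eqP; rewrite diffx0 diff0x; split=> //; exact: ideal0.
Qed.

End Quotient.

Section Completion.
Context d (A : ctbDistrLatticeType d).
Local Open Scope order_scope.
Local Open Scope classical_set_scope.

(* The completion is realized as the algebra of normal ideals of A, i.e., of
   the sets S with perp (perp S) = S; it is the Dedekind-MacNeille completion,
   as perp (perp S) is the set of lower bounds of the upper bounds of S.
   [completionP] below shows that it is a completion in the sense of
   [is_completion], which determines it up to isomorphism over A. *)
Definition perp (S : set A) : set A :=
  [set a | forall s, S s -> (a `&` s)%O = \bot].

Lemma perp_anti (S T : set A) : (S `<=` T)%classic -> (perp T `<=` perp S)%classic.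
Proof. by move=> ST a Ta s /ST /Ta. Qed.

Lemma sub_perp2 (S : set A) : (S `<=` perp (perp S))%classic.
Proof. by move=> s Ss t tS; rewrite meetC; exact: tS. Qed.

Lemma perp3 (S : set A) : perp (perp (perp S)) = perp S.
Proof.
by apply/seteqP; split; [exact/perp_anti/sub_perp2|exact: sub_perp2].
Qed.

Lemma perp_down (S : set A) (x y : A) : (x <= y)%O -> perp S y -> perp S x.
Proof.
by move=> xy Sy s /Sy ys0; apply/eqP; rewrite -lex0 -ys0 leI2.
Qed.

Definition normal : pred (set A) := fun S => `[< perp (perp S) = S >].

Lemma normalP (S : set A) : reflect (perp (perp S) = S) (normal S).
Proof. exact: asboolP. Qed.

Lemma normal_perp (S : set A) : normal (perp S).
Proof. by apply/normalP; exact: perp3. Qed.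

Definition completion := {S : set A | normal S}.

HB.instance Definition _ := SubChoice.on completion.

Implicit Types S T U : completion.

Lemma completionK S : perp (perp (val S)) = val S.
Proof. exact/normalP/(valP S). Qed.

Lemma completion_down S (x y : A) : (x <= y)%O -> val S y -> val S x.
Proof. by rewrite -completionK; exact: perp_down. Qed.

Fact completion_meet_subproof S T : normal (val S `&` val T)%classic.
Proof.
apply/normalP/seteqP; split; last exact: sub_perp2.
move=> a a2; split; rewrite -completionK; apply: perp_anti a2; apply: perp_anti.
  by move=> x [].
by move=> x [].
Qed.

Definition completion_meet S T : completion :=
  exist _ (val S `&` val T)%classic (completion_meet_subproof S T).

Definition completion_join S T : completion :=
  exist _ (perp (perp (val S `|` val T)%classic)) (normal_perp _).

Definition completion_compl S : completion :=
  exist _ (perp (val S)) (normal_perp _).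

Definition completion_top : completion := exist _ (perp set0) (normal_perp _).

Definition completion_bot : completion := exist _ (perp setT) (normal_perp _).

Definition completion_le S T : bool := `[< (val S `<=` val T)%classic >].

Definition completion_lt S T : bool := (T != S) && completion_le S T.

Fact completion_le_def S T : completion_le S T = (completion_meet S T == S).
Proof.
apply/asboolP/eqP => [ST|<- x []//]; apply: val_inj => /=.
by apply/seteqP; split=> [x []//|x Sx]; split => //; exact: ST.
Qed.

Fact completion_meetC : commutative completion_meet.
Proof. by move=> S T; apply: val_inj; rewrite /= setIC. Qed.

Fact completion_meetA : associative completion_meet.
Proof. by move=> S T U; apply: val_inj; rewrite /= setIA. Qed.

Fact completion_meetxx : idempotent_op completion_meet.
Proof. by move=> S; apply: val_inj; rewrite /= setIid. Qed.

Fact completion_joinC : commutative completion_join.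
Proof. by move=> S T; apply: val_inj; rewrite /= setUC. Qed.

Lemma perpU (S T : set A) : perp (S `|` T)%classic = (perp S `&` perp T)%classic.
Proof.
apply/seteqP; split=> [a h|a [aS aT] s [/aS|/aT]//].
by split=> s Ss; apply: h; [left|right].
Qed.

Fact completion_joinA : associative completion_join.
Proof.
move=> S T U; apply: val_inj => /=; congr perp.
by rewrite [LHS]perpU [RHS]perpU !perp3 !perpU setIA.
Qed.

Fact completion_joinKI T S : completion_meet S (completion_join S T) = S.
Proof.
apply: val_inj => /=; apply/seteqP; split=> [x []//|x Sx]; split => //.
by apply: sub_perp2; left.
Qed.

Fact completion_meetKU T S : completion_join S (completion_meet S T) = S.
Proof.
by apply: val_inj => /=; rewrite setIC setKI completionK.
Qed.

Fact completion_meetUl : left_distributive completion_meet completion_join.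
Proof.
move=> S T U; apply: val_inj => /=; apply/seteqP; split=> [b [b2 Ub] c|b bSU].
  rewrite perpU => -[cS cT].
  suff : perp (val S `|` val T)%classic (b `&` c)%O.
    by move=> /b2; rewrite meetA meetxx.
  rewrite perpU [(b `&` c)%O]meetC; split=> s Ss; rewrite -meetA;
    [apply: cS|apply: cT];
    by split; [apply: completion_down Ss; exact: leIr|
      apply: completion_down Ub; exact: leIl].
split.
  apply: perp_anti bSU; apply: perp_anti.
  by move=> x [[Sx _]|[Tx _]]; [left|right].
rewrite -completionK; apply: perp_anti bSU; apply: perp_anti.
by move=> x [[]|[]].
Qed.

HB.instance Definition _ := Order.isMeetJoinDistrLattice.Build
  d completion completion_le_def (fun _ _ => erefl)
  completion_meetC completion_joinC completion_meetA completion_joinA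
  completion_joinKI completion_meetKU completion_meetUl completion_meetxx.

Lemma completion_leP S T : reflect (val S `<=` val T)%classic (S <= T)%O.
Proof. exact: asboolP. Qed.

Fact completion_le0x S : (completion_bot <= S)%O.
Proof. by apply/completion_leP; rewrite -(completionK S); exact: perp_anti. Qed.

Fact completion_lex1 S : (S <= completion_top)%O.
Proof. by apply/completion_leP => x _ s. Qed.

HB.instance Definition _ := Order.hasBottom.Build d completion completion_le0x.
HB.instance Definition _ := Order.hasTop.Build d completion completion_lex1.

Fact completion_joinxC S : (S `|` completion_compl S)%O = \top%O.
Proof.
apply: val_inj => /=; apply/seteqP; split=> x _ s //.
by rewrite perpU completionK => -[sS /sS]; rewrite meetxx => ->; rewrite meetx0.
Qed.

Fact completion_meetxC S : (S `&` completion_compl S)%O = \bot%O.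
Proof.
apply: val_inj => /=; apply/seteqP; split=> [x [Sx /(_ x Sx)]|x xT].
  by rewrite meetxx => -> y _; rewrite meet0x.
by split; last (move=> y _; exact: xT); rewrite -completionK => y _; exact: xT.
Qed.

HB.instance Definition _ := Order.TBDistrLattice_hasComplement.Build
  d completion completion_joinxC completion_meetxC.

Lemma val_completionI S T : val (S `&` T)%O = (val S `&` val T)%classic.
Proof. by []. Qed.

Lemma val_completionU S T :
  val (S `|` T)%O = perp (perp (val S `|` val T)%classic).
Proof. by []. Qed.

Lemma val_completionC S : val (~` S)%O = perp (val S).
Proof. by []. Qed.

Lemma val_completion0 : val (\bot%O : completion) = perp setT.
Proof. by []. Qed.

Definition completion_embed (a : A) : completion :=
  exist _ (perp (perp [set a])) (normal_perp _).

Lemma val_completion_embed (a : A) :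
  val (completion_embed a) = [set b | (b <= a)%O].
Proof.
apply/seteqP; split=> [b /= h|b /= ba].
  rewrite -[a]complK -disj_leC; apply/eqP/h => _ ->.
  by rewrite meetCx.
by move=> c /(_ a erefl) ca; apply/eqP; rewrite -lex0 -ca meetC leI2.
Qed.

End Completion.

Section IsCompletion.
Local Open Scope order_scope.

Definition complete d (A : ctbDistrLatticeType d) : Prop :=
  forall S : set A, exists2 s : A, (forall x, S x -> x <= s) &
    forall u, (forall x, S x -> x <= u) -> s <= u.

Definition is_completion d (A : ctbDistrLatticeType d)
    d' (B : ctbDistrLatticeType d') (e : A -> B) : Prop :=
  [/\ complete B, ba_morphism e, injective e &
      forall b : B, b != \bot -> exists2 a : A, a != \bot & e a <= b].

Lemma completionP d (A : ctbDistrLatticeType d) :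
  is_completion (@completion_embed d A).
Proof.
have eP a x : val (completion_embed a) x <-> x <= a.
  by rewrite val_completion_embed.
split.
- move=> S; pose U := (\bigcup_(T in S) val T)%classic.
  exists (exist _ (perp (perp U)) (normal_perp _)) => [T ST|T hT];
    apply/completion_leP => /=.
    by move=> x Tx; apply: sub_perp2; exists T.
  rewrite -(completionK T); apply: perp_anti; apply: perp_anti => x [V SV Vx].
  by have /completion_leP := hT _ SV; exact.
- split=> [x y|x y|x].
  + apply: val_inj; rewrite val_completionI; apply/seteqP.
    by split=> [z /eP|z [/eP zx /eP zy]];
      [rewrite lexI => /andP[/eP zx /eP zy]|apply/eP; rewrite lexI zx].
  + apply: le_anti; apply/andP; split; last first.
      by rewrite leUx; apply/andP; split; apply/completion_leP => z /eP zx;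
        apply/eP; rewrite (le_trans zx) ?leUl ?leUr.
    apply/completion_leP => z /eP zxy; rewrite val_completionU => c.
    rewrite perpU => -[cx cy].
    have cx0 : c `&` x = \bot by apply: cx; exact/eP.
    have cy0 : c `&` y = \bot by apply: cy; exact/eP.
    apply/eqP; rewrite -lex0 meetC (le_trans (leI2 (lexx c) zxy))//.
    by rewrite meetUr cx0 cy0 joinxx.
  + apply: val_inj; rewrite val_completionC.
    apply/seteqP; split=> [z /eP zx t /eP tx|z zx].
      by apply/eqP; rewrite -lex0 -(meetCx x) leI2.
    by apply/eP; rewrite -disj_leC; apply/eqP/zx/eP.
- move=> x y xy; apply: le_anti; apply/andP; split; apply/eP.
    by rewrite -xy; apply/eP.
  by rewrite xy; apply/eP.
- move=> S S0; have [a Sa a0] : exists2 a, val S a & a != \bot.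
    apply: contrapT => h; move/eqP: S0; apply; apply: val_inj; rewrite val_completion0.
    apply/seteqP; split=> [x Sx y _|x xT].
      have [->|x0] := eqVneq x \bot; first by rewrite meet0x.
      by exfalso; apply: h; exists x.
    by rewrite -completionK => y _; exact: xT.
  exists a => //; apply/completion_leP => x /eP xa.
  exact: completion_down xa Sa.
Qed.

End IsCompletion.

Section Borel.
Context (X : topologicalType).
Local Open Scope classical_set_scope.

Definition borel : set (set X) := <<s @open X >>.

Definition is_borel : pred (set X) := fun B => B \in borel.

Lemma is_borelP (B : set X) : reflect (borel B) (is_borel B).
Proof. by apply: (iffP idP); rewrite /is_borel inE. Qed.

Lemma borelC (B : set X) : borel B -> borel (~` B).
Proof. by move=> bB; rewrite -setTD; exact: (@sigma_algebraCD _ setT). Qed.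

Lemma borelU (B C : set X) : borel B -> borel C -> borel (B `|` C).
Proof.
move=> bB bC; rewrite -bigcup2E; apply: sigma_algebra_bigcup => -[//|[//|i]].
exact: sigma_algebra0.
Qed.

Lemma borelI (B C : set X) : borel B -> borel C -> borel (B `&` C).
Proof.
move=> bB bC; rewrite -[_ `&` _]setCK setCI.
by apply: borelC; apply: borelU; exact: borelC.
Qed.

Fact is_borel_meet : meet_closed is_borel.
Proof.
by move=> B C /is_borelP bB /is_borelP bC; apply/is_borelP; exact: borelI.
Qed.

Fact is_borel_join : join_closed is_borel.
Proof.
by move=> B C /is_borelP bB /is_borelP bC; apply/is_borelP; exact: borelU.
Qed.

Fact is_borel_bot : \bot%O \in is_borel.
Proof. by apply/is_borelP; exact: sigma_algebra0. Qed.

Fact is_borel_top : \top%O \in is_borel.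
Proof. by apply/is_borelP; rewrite -[\top%O](@setC0 X); apply: borelC; exact: sigma_algebra0. Qed.

Definition borel_algebra := {B : set X | is_borel B}.

HB.instance Definition _ := SubChoice.on borel_algebra.
HB.instance Definition _ := Order.SubChoice_isTBSubLattice.Build
  set_display (set X) is_borel set_display borel_algebra
  is_borel_meet is_borel_join is_borel_bot is_borel_top.

Fact borel_meetUl : @left_distributive borel_algebra borel_algebra
  Order.meet Order.join.
Proof. by move=> A B C; apply: val_inj; exact: setIUl. Qed.

HB.instance Definition _ := Order.Lattice_Meet_isDistrLattice.Build
  set_display borel_algebra borel_meetUl.

Fact borel_compl_subproof (B : borel_algebra) : is_borel (~` val B).
Proof. by apply/is_borelP; apply: borelC; apply/is_borelP; exact: valP. Qed.

Definition borel_compl (B : borel_algebra) : borel_algebra :=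
  exist _ (~` val B) (borel_compl_subproof B).

Fact borel_joinxC (B : borel_algebra) : (B `|` borel_compl B)%O = \top%O.
Proof. by apply: val_inj; exact: setUv. Qed.

Fact borel_meetxC (B : borel_algebra) : (B `&` borel_compl B)%O = \bot%O.
Proof. by apply: val_inj; exact: setICr. Qed.

HB.instance Definition _ := Order.TBDistrLattice_hasComplement.Build
  set_display borel_algebra borel_joinxC borel_meetxC.

(* The covering family may be finite or empty, so that the sets below are
   ideals whatever the set function is. *)
Definition countably_covered (P : set (set X)) : set (set X) :=
  [set B | exists F : set (set X),
    [/\ countable F, F `<=` P & B `<=` \bigcup_(K in F) K]].

Section CoveringIdeal.
Variable P : set (set X).

Let J (B : borel_algebra) : Prop := countably_covered P (val B).

Fact covering_ideal0 : J \bot%O.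
Proof. by exists set0; split=> //; exact: countable0. Qed.

Fact covering_idealU (B C : borel_algebra) : J B -> J C -> J (B `|` C)%O.
Proof.
move=> [F [cF FP BF]] [G [cG GP CG]]; exists (F `|` G); split.
- rewrite -bigcup2E; apply: bigcup_countable => // i _.
  by case: i => [//|[//|i]]; exact: countable0.
- by move=> K [/FP|/GP].
- by rewrite bigcup_setU; exact: setUSS BF CG.
Qed.

Fact covering_ideal_le (B C : borel_algebra) : (B <= C)%O -> J C -> J B.
Proof.
rewrite leEsub => /subsetPset BC [F [cF FP CF]]; exists F; split=> //.
exact: subset_trans CF.
Qed.

Definition covering_ideal : ideal borel_algebra :=
  Ideal covering_ideal0 covering_idealU covering_ideal_le.

End CoveringIdeal.

Section MeasureIdeals.
Context (R : realType) (mu : set X -> \bar R).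
Local Open Scope ereal_scope.

Definition compact_fin : set (set X) := [set K | compact K /\ mu K < +oo].

Definition compact_null : set (set X) := [set K | compact K /\ mu K = 0].

Definition Jf : set (set X) := borel `&` countably_covered compact_fin.

Definition J0 : set (set X) := borel `&` countably_covered compact_null.

Definition Bor_mod_Jf := quotient_algebra (covering_ideal compact_fin).

Definition Bor_mod_J0 := quotient_algebra (covering_ideal compact_null).

HB.instance Definition _ := Order.CTBDistrLattice.on Bor_mod_Jf.
HB.instance Definition _ := Order.CTBDistrLattice.on Bor_mod_J0.

Lemma Bor_mod_JfP (B : borel_algebra) :
  (\pi_Bor_mod_Jf B = \bot%O)%qT <-> Jf (val B).
Proof.
rewrite quotient_eq0; split=> [|[]//]; split=> //.
exact/is_borelP/(valP B).
Qed.

Lemma Bor_mod_J0P (B : borel_algebra) :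
  (\pi_Bor_mod_J0 B = \bot%O)%qT <-> J0 (val B).
Proof.
rewrite quotient_eq0; split=> [|[]//]; split=> //.
exact/is_borelP/(valP B).
Qed.

End MeasureIdeals.
End Borel.

Section Metrizable.
Context (R : realType).
Local Open Scope ring_scope.
Local Open Scope classical_set_scope.

Definition is_metric (X : Type) (dist : X -> X -> R) : Prop :=
  [/\ forall x y, dist x y = 0 <-> x = y,
      forall x y, dist x y = dist y x &
      forall x y z, dist x z <= dist x y + dist y z].

Definition metrizable (X : topologicalType) : Prop :=
  exists2 dist : X -> X -> R, is_metric dist &
    forall x : X, nbhs x =
      filter_from [set e : R | 0 < e] (fun e => [set y | dist x y < e]).

End Metrizable.

Section BorelMeasure.
Context d (X : measurableType d) (R : realType).
Local Open Scope ring_scope.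
Variable mu : {measure set X -> \bar R}.
Local Open Scope ereal_scope.
Local Open Scope classical_set_scope.

Definition nonatomic : Prop := forall A, measurable A -> 0 < mu A ->
  exists A', [/\ measurable A', A' `<=` A, 0 < mu A' & mu A' < mu A].

Definition semifinite : Prop := forall A, measurable A -> 0 < mu A ->
  exists A', [/\ measurable A', A' `<=` A, 0 < mu A' & mu A' < +oo].

End BorelMeasure.

Section Hausdorff.
Context (R : realType) (T : Type) (dist : T -> T -> R).
Local Open Scope ereal_scope.
Local Open Scope classical_set_scope.

(* [0] is added so that the diameter of the empty set is 0 rather than -oo. *)
Definition diam (U : set T) : \bar R :=
  ereal_sup ([set 0] `|` [set (dist p q)%:E | p in U & q in U]).

Definition hausdorff_pre1 (delta : R) (A : set T) : \bar R :=
  ereal_inf [set \sum_(0 <= i <oo) diam (U i) | U in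
    [set U : (set T)^nat | A `<=` \bigcup_i U i /\
                           forall i, diam (U i) <= delta%:E]].

Definition hausdorff1 (A : set T) : \bar R :=
  ereal_sup [set hausdorff_pre1 delta A | delta in [set e : R | (0 < e)%R]].

End Hausdorff.

Section UnitIntervalAndSquare.
Context (R : realType).
Local Open Scope ring_scope.
Local Open Scope classical_set_scope.

Definition unit_interval : set R := `[0, 1].

Definition unit_square : set (R * R) := unit_interval `*` unit_interval.

(* [0, 1] and [0, 1]^2 are viewed as spaces in their own right, with the
   subspace topology carried by [set_type]. *)
Definition lambda (B : set unit_interval) : \bar R :=
  lebesgue_measure [set val x | x in B].

Definition euclidean_dist (p q : unit_square) : R :=
  Num.sqrt (((val p).1 - (val q).1) ^+ 2 + ((val p).2 - (val q).2) ^+ 2).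

Definition H1 : set unit_square -> \bar R := hausdorff1 euclidean_dist.

End UnitIntervalAndSquare.

(* Main.v *)
(** A Borel set outside one of the two ideals is a Souslin set, and a tree of
    closed sets inside it yields an injective Borel copy of the Baire space.
    Each node [s] of the tree carries a Cantor scheme, whose compact sets of
    level [n] have measure about [a_s / 2 ^ n], and the children of [s]
    accumulate exactly at the branches of that scheme. The part of the scheme of [s] met by the
    closure of a set of branches is therefore measured combinatorially, by the
    proportion of addresses near which infinitely many children of [s] are
    used. Summing these proportions over the nodes, a set of branches lands in
    the ideal iff it is a countable union of sets of small total weight, where
    "small" means finite for [Jf] and zero for [J0]. This criterion mentions
    neither the space nor the measure, so all these copies have isomorphic
    algebras. They are dense, there are only continuum many of them up to
    equality, and each contains continuum many disjoint ones, so maximal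
    antichains below any two nonzero elements have the same cardinality and
    can be matched, which identifies the completions.

    For [H1] on the square the construction needs large compact subsets of
    finite measure. Interleaving binary digits compares [H1] with a net measure
    on the Cantor space, for which these exist by Besicovitch's argument. *)
Require Import Defs.
From HB Require Import structures.
From mathcomp Require Import all_boot all_order all_algebra.
From mathcomp Require Import all_classical all_reals all_analysis.
From mathcomp Require Import ring lra zify.

Set Implicit Arguments.
Unset Strict Implicit.
Unset Printing Implicit Defensive.

Import Order.Theory GRing.Theory Num.Theory.
Import numFieldNormedType.Exports.

Local Open Scope classical_set_scope.
Local Open Scope ring_scope.

(** * Matching dense families of isomorphic segments *)

(** The ideals are generated by compact sets, so what matters about a set of branches is the measure
    of the closure of its image. That closure leaves the copy of the Baire space, and the tree is
    built so that the points gained are known: each lies in a trace, whose measure is combinatorial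
    up to a factor 2. The copy itself must not disturb the count: its range has finite measure for
    [Jf], which is where the hypothesis of (i) enters, and measure zero for [J0]. For [Jf] the
    schemes of all nodes must also be of comparable size, hence [a s = 1] throughout; this is
    possible because a closed set outside the ideal has infinite measure and, by semifiniteness,
    subsets of arbitrarily large finite measure. For [J0] only vanishing counts and [a s] may vary
    with the node. Nonatomicity acts through two consequences, null points and semifiniteness. On
    the square, the ideal depends only on which compact sets have finite [H1], so a comparison with
    the net measure up to constants is enough. *)

Section OrderIsomorphism.
Local Open Scope order_scope.

(** Meets, joins, bounds and complements are determined by the order, so the maps built later are
    only checked to be monotone and mutually inverse. *)
Lemma order_iso_ba d (A : ctbDistrLatticeType d) d' (B : ctbDistrLatticeType d')
    (f : A -> B) (g : B -> A) :
  cancel f g -> cancel g f ->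
  {homo f : x y / x <= y} -> {homo g : x y / x <= y} -> ba_isomorphic A B.
Proof.
move=> fK gK fm gm.
have fE x y : (f x <= y) = (x <= g y).
  by apply/idP/idP => [/gm|/fm]; rewrite ?fK ?gK.
have gE x y : (y <= f x) = (g y <= x).
  by apply/idP/idP => [/gm|/fm]; rewrite ?fK ?gK.
have fI x y : f (x `&` y) = f x `&` f y.
  apply: le_anti; apply/andP; split.
    by rewrite lexI; apply/andP; split; apply: fm; rewrite ?leIl ?leIr.
  by rewrite gE lexI -!gE leIl leIr.
have fU x y : f (x `|` y) = f x `|` f y.
  apply: le_anti; apply/andP; split; last first.
    by rewrite leUx; apply/andP; split; apply: fm; rewrite ?leUl ?leUr.
  by rewrite fE leUx -!fE leUl leUr.
have f0 : f \bot = \bot.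
  by apply/eqP; rewrite -lex0 fE le0x.
have f1 : f \top = \top.
  by apply/eqP; rewrite -le1x gE lex1.
exists f; last by exists g.
split=> // x; apply: le_anti; apply/andP; split.
  by rewrite -disj_leC -fI meetCx f0.
by rewrite -[leRHS]complK -disj_leC -complU -fU joinxC f1 compl1.
Qed.

(* The two maps matter only on the segments; this avoids subtypes. *)
Definition seg_iso d (A : porderType d) d' (B : porderType d')
    (a : A) (b : B) (f : A -> B) (g : B -> A) : Prop :=
  [/\ forall x, x <= a -> f x <= b /\ g (f x) = x,
      forall y, y <= b -> g y <= a /\ f (g y) = y,
      forall x x', x' <= a -> x <= x' -> f x <= f x' &
      forall y y', y' <= b -> y <= y' -> g y <= g y'].

Lemma seg_iso_sym d (A : porderType d) d' (B : porderType d')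
    (a : A) (b : B) f g : seg_iso a b f g -> seg_iso b a g f.
Proof. by case. Qed.

Lemma seg_iso0 d (A : tbDistrLatticeType d) d' (B : tbDistrLatticeType d')
    (a : A) (b : B) f g : seg_iso a b f g -> f \bot = \bot.
Proof.
move=> [fa gb fm gm]; apply/eqP; rewrite -lex0.
have [g0a fg0] := gb \bot (le0x _).
by rewrite -[leRHS]fg0 fm// le0x.
Qed.

Lemma seg_iso_neq0 d (A : tbDistrLatticeType d) d' (B : tbDistrLatticeType d')
    (a : A) (b : B) f g x : seg_iso a b f g -> x <= a -> x != \bot ->
  f x != \bot.
Proof.
move=> fg xa; apply: contra_neq => fx0.
have [fa _ _ _] := fg; have [_ <-] := fa _ xa.
by rewrite fx0 (seg_iso0 (seg_iso_sym fg)).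
Qed.

Lemma relative_iso d (A : ctbDistrLatticeType d) d' (B : ctbDistrLatticeType d')
    (a : A) f g : seg_iso a (\top : B) f g -> ba_isomorphic (relative_algebra a) B.
Proof.
move=> [fa gb fm gm].
pose g' (y : B) : relative_algebra a := exist _ (g y) (gb y (lex1 y)).1.
apply: (@order_iso_ba _ _ _ _ (fun x : relative_algebra a => f (val x)) g').
- by move=> x; apply: val_inj => /=; have [] := fa _ (valP x).
- by move=> y /=; have [] := gb y (lex1 y).
- by move=> x y xy; apply: fm => //; exact: (valP y).
- by move=> x y xy; rewrite leEsub /=; apply: gm => //; exact: lex1.
Qed.

Lemma top_iso d (A : ctbDistrLatticeType d) d' (B : ctbDistrLatticeType d') f g :
  seg_iso (\top : A) (\top : B) f g -> ba_isomorphic A B.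
Proof.
move=> [fa gb fm gm]; apply: (@order_iso_ba _ _ _ _ f g).
- by move=> x; have [] := fa x (lex1 x).
- by move=> x; have [] := gb x (lex1 x).
- by move=> x y; apply: fm; exact: lex1.
- by move=> x y; apply: gm; exact: lex1.
Qed.

End OrderIsomorphism.

Section NormalIdeals.
Context d (A : ctbDistrLatticeType d).
Local Open Scope order_scope.

(** For a down-closed [U], [perp (perp U)] consists of the elements below which [U] is dense. Normal
    ideals are thus the regular open sets of the order, and membership can be tested densely. *)
Lemma normal_char (U : set A) : normal U <->
  (forall a b, a <= b -> U b -> U a) /\
  (forall a, (forall b, b != \bot -> b <= a ->
     exists c, [/\ c != \bot, c <= b & U c]) -> U a).
Proof.
split=> [/Defs.normalP UE|[Ud Ur]].
  split=> [a b ab|a h]; rewrite -UE; first exact: perp_down.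
  move=> b bU; apply/eqP; apply: contrapT => /negP ab.
  have [c [c0 cab Uc]] := h _ ab (leIl _ _).
  have cb : c <= b by rewrite (le_trans cab)// leIr.
  move: (bU _ Uc); rewrite meetC (meet_l cb) => c00.
  by rewrite c00 eqxx in c0.
apply/Defs.normalP/seteqP; split; last exact: sub_perp2.
move=> a aU; apply: Ur => b b0 ba; apply: contrapT => nb.
have /aU : perp U b.
  move=> u Uu; apply/eqP; apply: contrapT => /negP bu.
  by apply: nb; exists (b `&` u); split; rewrite ?leIl//; apply: Ud Uu; rewrite leIr.
by rewrite meetC (meet_l ba) => b00; rewrite b00 eqxx in b0.
Qed.

End NormalIdeals.

Section Glue.
Context d (A : ctbDistrLatticeType d) d' (B : ctbDistrLatticeType d').
Context (I : Type).
Local Open Scope order_scope.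

Lemma completion_char0 (S : completion A) : S != \bot ->
  exists2 a, a != \bot & val S a.
Proof.
move=> S0; apply: contrapT => h; move/eqP: S0; apply.
apply: le_anti; rewrite le0x andbT; apply/completion_leP => a Sa b _.
have [->|a0] := eqVneq a \bot; first by rewrite meet0x.
by exfalso; apply: h; exists a.
Qed.

(* The part of [S] whose trace on each piece [e t] is sent into [U]. *)
Definition pull (S : completion B) (e : I -> B) (g : I -> B -> A)
    (U : completion A) : set B :=
  [set b | val S b /\ forall t, val U (g t (b `&` e t))].

(** Density is tested one piece at a time: an element below the [g t] image of a trace of [b] is
    carried by [f t] under [b], refined there, and carried back by [g t]. *)
Lemma normal_pull (S : completion B) (c : I -> A) (e : I -> B) f g U :
  (forall t, seg_iso (c t) (e t) (f t) (g t)) -> normal (pull S e g U).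
Proof.
move=> fg; have [Sd Sr] := (normal_char (val S)).1 (valP S).
have [Ud Ur] := (normal_char (val U)).1 (valP U).
apply/normal_char; split=> [x y xy [Sy yU]|b h].
  split=> [|t]; first exact: Sd Sy.
  have [_ _ _ gm] := fg t.
  by apply: Ud (yU t); apply: gm; [exact: leIr|exact: leI2].
split=> [|t].
  apply: Sr => x x0 xb; have [y [y0 yx [Sy _]]] := h _ x0 xb.
  by exists y.
apply: Ur => x x0 xb.
have [fc ge fm gm] := fg t.
have [gbc fgb] := ge _ (leIr (e t) b).
have xc : x <= c t by exact: le_trans xb gbc.
have fx0 := seg_iso_neq0 (fg t) xc x0.
have fxb : f t x <= b `&` e t by rewrite -fgb; exact: fm.
have [y [y0 yfx [Sy yU]]] := h _ fx0 (le_trans fxb (leIl _ _)).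
have ye : y <= e t by rewrite (le_trans yfx)// (fc _ xc).1.
exists (g t y); split.
- exact: seg_iso_neq0 (seg_iso_sym (fg t)) ye y0.
- by rewrite -[leRHS](fc _ xc).2; apply: gm => //; exact: (fc _ xc).1.
- by have := yU t; rewrite (meet_l ye).
Qed.

End Glue.

Section GlueIso.
Context d (A : ctbDistrLatticeType d) d' (B : ctbDistrLatticeType d').
Context (I : Type) (S : completion A) (T : completion B).
Context (c : I -> A) (e : I -> B) (f : I -> A -> B) (g : I -> B -> A).
Hypothesis fg : forall t, seg_iso (c t) (e t) (f t) (g t).
Hypothesis gf : forall t, seg_iso (e t) (c t) (g t) (f t).
Local Open Scope order_scope.

Let F (U : completion A) : completion B :=
  exist _ (pull T e g U) (normal_pull T U fg).
Let G (V : completion B) : completion A :=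
  exist _ (pull S c f V) (normal_pull S V gf).

(** Every nonzero element of [S] meets some [c t], so an element of [S] belongs to [U] as soon as
    its traces on the pieces do. On one piece [f t] and [g t] are inverse, and disjointness of the
    [e t] keeps the other pieces from interfering. *)
Lemma pullK : (forall t, val T (e t)) ->
  (forall t u, t <> u -> e t `&` e u = \bot) ->
  (forall b, val S b -> b != \bot -> exists t, b `&` c t != \bot) ->
  forall U, U <= S -> F U <= T /\ G (F U) = U.
Proof.
move=> Te ee cS U /completion_leP US; split.
  by apply/completion_leP => x [].
have [Ud Ur] := (normal_char (val U)).1 (valP U).
have [Td _] := (normal_char (val T)).1 (valP T).
have U0 : val U \bot.
  by apply: Ur => b /negP b0; rewrite lex0 => /b0.
apply: val_inj => /=; apply/seteqP; split=> [a [Sa /= aFU]|a Ua].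
  apply: Ur => b b0 ba.
  have [Sd _] := (normal_char (val S)).1 (valP S).
  have [t bt] := cS b (Sd _ _ ba Sa) b0.
  exists (b `&` c t); split=> //; first exact: leIl.
  apply: (Ud _ (a `&` c t)); first exact: leI2.
  have [fc _ _ _] := fg t.
  have [fae gfa] := fc _ (leIr (c t) a).
  have [_ /(_ t)] := aFU t.
  by rewrite (meet_l fae) gfa.
split=> [|t]; first exact: US.
have [fc _ _ _] := fg t.
have [fae gfa] := fc _ (leIr (c t) a).
split=> [|u]; first by apply: Td (Te t).
have [<-|tu] := pselect (t = u).
  by rewrite (meet_l fae) gfa; apply: Ud Ua; exact: leIl.
suff -> : f t (a `&` c t) `&` e u = \bot.
  by rewrite (seg_iso0 (gf u)).
by apply/eqP; rewrite -lex0 -(ee _ _ tu) leI2.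
Qed.

Lemma pull_homo : {homo F : x y / x <= y}.
Proof.
move=> U V /completion_leP UV; apply/completion_leP => b [Tb bU].
by split=> // t; exact/UV/bU.
Qed.

End GlueIso.

(** The algebras need not have suprema of antichains; in the completions an element is determined by
    its traces on a maximal antichain, so isomorphisms of the pieces glue. *)
Lemma completion_seg_iso d (A : ctbDistrLatticeType d)
    d' (B : ctbDistrLatticeType d') (I : Type)
    (S : completion A) (T : completion B) (c : I -> A) (e : I -> B) f g :
  (forall t, seg_iso (c t) (e t) (f t) (g t)) ->
  (forall t, val S (c t)) -> (forall t, val T (e t)) ->
  (forall t u, t <> u -> c t `&` c u = \bot)%O ->
  (forall t u, t <> u -> e t `&` e u = \bot)%O ->
  (forall a, val S a -> a != \bot -> exists t, a `&` c t != \bot)%O ->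
  (forall b, val T b -> b != \bot -> exists t, b `&` e t != \bot)%O ->
  exists F G, seg_iso S T F G.
Proof.
move=> fg Sc Te cc ee cS eT; have gf t := seg_iso_sym (fg t).
eexists; eexists; split.
- exact: (pullK fg gf Te ee cS).
- exact: (pullK gf fg Sc cc eT).
- by move=> U V _; exact: pull_homo.
- by move=> U V _; exact: pull_homo.
Qed.

Section Rich.
Local Open Scope order_scope.
Local Notation reals := (nat -> bool).

Definition disjoint_family d (A : ctbDistrLatticeType d) I (r : I -> A) :=
  forall t u, t <> u -> r t `&` r u = \bot.

(** The code bounds antichains inside [D] by the continuum from above, the families [r] bound
    suitable ones from below. Together they fix the size of the maximal antichains to be matched,
    whatever the algebra. *)
Definition rich d (A : ctbDistrLatticeType d) (D : set A) : Prop :=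
  [/\ forall x, D x -> x != \bot,
      forall a, a != \bot -> exists2 x, D x & x <= a,
      exists code : reals -> A, (D `<=` range code)%classic &
      forall a, a != \bot -> exists r : reals -> A,
        (forall t, r t != \bot /\ r t <= a) /\ disjoint_family r].

(** A continuum of disjoint elements of [D] below [S] is extended to a maximal disjoint family by
    Zorn; its size is then exactly the continuum, so it can be indexed by [reals]. *)
Lemma rich_antichain d (A : ctbDistrLatticeType d) (D : set A)
    (S : completion A) : rich D -> S != \bot ->
  exists c : reals -> A, [/\ forall t, D (c t) /\ val S (c t),
    disjoint_family c &
    forall a, val S a -> a != \bot -> exists t, a `&` c t != \bot].
Proof.
move=> [D0 Dd [code Dcode] Dr] S0.
have [Sd _] := (normal_char (val S)).1 (valP S).
have [a a0 Sa] := completion_char0 S0.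
have [r [ra rr]] := Dr _ a0.
have /choice[c0 c0P] : forall t, exists x, D x /\ x <= r t.
  by move=> t; have [x Dx xr] := Dd _ (ra t).1; exists x.
have c0c0 : disjoint_family c0.
  move=> t u /rr ru; apply/eqP; rewrite -lex0 -ru leI2//; [exact: (c0P t).2|exact: (c0P u).2].
(* Zorn's lemma tests the empty chain too, so [M] cannot be required to contain [range c0]. It is
   only required to be compatible with it; maximality yields the inclusion [c0M] afterwards. *)
pose P M := ((M `<=` D `&` val S) /\ forall x y, (M `|` range c0) x ->
  (M `|` range c0) y -> x <> y -> (x `&` y)%O = \bot)%classic.
have [M [[MDS MM] Mmax]] : exists M, P M /\ forall N, (M `<` N)%classic -> ~ P N.
  apply: Zorn_bigcup => F FP Ftot; split=> [x [M /FP[MD _] /MD]//|x y].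
  have c0F z : range c0 z -> forall w M, F M -> (M `|` range c0)%classic w ->
      z <> w -> (z `&` w)%O = \bot.
    by move=> zc w M /FP[_ +] Mw; apply=> //; right.
  move=> [[M FM Mx]|cx] [[N FN Ny]|cy] xy.
  - by have [MN|NM] := Ftot _ _ FM FN;
      [have [_] := FP _ FN|have [_] := FP _ FM]; apply=> //; left; auto.
  - by rewrite meetC; apply: (c0F _ cy _ M) => //; [left|exact: nesym].
  - by apply: (c0F _ cx _ N) => //; left.
  - move: cx cy xy => [t _ <-] [u _ <-] tu.
    by apply: c0c0 => tu'; rewrite tu' in tu.
have c0DS : (range c0 `<=` D `&` val S)%classic.
  move=> _ [t _ <-]; have [Dc cr] := c0P t.
  by split=> //; apply: Sd Sa; exact: le_trans cr (ra t).2.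
have addM x : D x -> val S x ->
    (forall y, (M `|` range c0)%classic y -> x <> y -> x `&` y = \bot) -> M x.
  move=> Dx Sx xM; apply: contrapT => Mx.
  apply: (Mmax (M `|` [set x])%classic).
    by split=> [z Mz|/(_ x)]; [left|move=> /(_ (or_intror erefl))].
  split=> [z [/MDS//|->//]|y z].
  move=> [[My|->]|cy] [[Mz|->]|cz] yz.
  - by apply: MM => //; left.
  - by rewrite meetC; apply: xM; [left|exact: nesym].
  - by apply: MM => //; [left|right].
  - by apply: xM => //; left.
  - by [].
  - by apply: xM => //; right.
  - by apply: MM => //; [right|left].
  - by rewrite meetC; apply: xM; [right|exact: nesym].
  - by apply: MM => //; right.
have c0M : (range c0 `<=` M)%classic.
  move=> x cx; have [Dx Sx] := c0DS _ cx; apply: addM => // y My xy.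
  by apply: MM => //; right.
(* Cantor-Bernstein: [M] lies in the range of [code] and contains the range of [c0], which is
   injective because its values are nonzero and disjoint. *)
have cardM : (M #= [set: reals])%card.
  apply/card_eqPle; split.
    apply: (card_le_trans (B := range code)); last exact: card_image_le.
    by apply: subset_card_le => x /MDS[/Dcode].
  apply: (card_le_trans (B := range c0)); last exact: subset_card_le.
  have /card_esym/card_eqPle[] // : (range c0 #= [set: reals])%card.
  apply: inj_card_eq => t u _ _ tu; apply: contrapT => /c0c0.
  by rewrite tu meetxx => cu; have := D0 _ (c0P u).1; rewrite cu eqxx.
have /card_set_bijP[h [_ hinj hsurj]] := cardM.
have /choice[c cP] : forall t, exists x, M x /\ h x = t.
  by move=> t; have [x Mx <-] := hsurj t I; exists x.
exists c; split=> [t|t u tu|b Sb b0].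
- by have [/MDS] := cP t.
- apply: MM; [by left; case: (cP t)|by left; case: (cP u)|] => ctu.
  by apply: tu; rewrite -(cP t).2 -(cP u).2 ctu.
have [x Dx xb] := Dd _ b0.
have [Mx|Mx] := pselect (M x).
  exists (h x); suff -> : c (h x) = x.
    by rewrite meetC (meet_l xb); exact: D0.
  have [Mc hc] := cP (h x).
  by apply: hinj => //; exact/mem_set.
apply: contrapT => nt; apply: Mx; apply: addM => // [|y yM xy].
  exact: Sd Sb.
have My : M y by case: yM => // /c0M.
apply/eqP; apply: contrapT => /negP xy0; apply: nt; exists (h y).
have -> : c (h y) = y.
  by have [Mc hc] := cP (h y); apply: hinj => //; exact/mem_set.
apply: contra_neq xy0 => by0.
by apply/eqP; rewrite -lex0 -by0 leI2.
Qed.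

Lemma rich_iso d (A : ctbDistrLatticeType d) d' (B : ctbDistrLatticeType d')
    (D : set A) (E : set B) : rich D -> rich E ->
  (forall a b, D a -> E b -> exists f g, seg_iso a b f g) ->
  forall (S : completion A) (T : completion B), S != \bot -> T != \bot ->
  exists F G, seg_iso S T F G.
Proof.
move=> rD rE DE S T S0 T0.
have [c [cD cc cS]] := rich_antichain rD S0.
have [e [eE ee eT]] := rich_antichain rE T0.
have /choice[f /choice[g fg]] :
    forall t, exists f g, seg_iso (c t) (e t) f g.
  by move=> t; apply: DE; [exact: (cD t).1|exact: (eE t).1].
apply: (completion_seg_iso fg) => // t; [exact: (cD t).2|exact: (eE t).2].
Qed.

Lemma rich_homogeneous d (A : ctbDistrLatticeType d) (D : set A) : rich D ->
  (forall a b, D a -> D b -> exists f g, seg_iso a b f g) ->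
  homogeneous (completion A).
Proof.
move=> rD DD S S0.
have [T0|T0] := eqVneq (\top : completion A) \bot.
  by exfalso; move: S0; rewrite -lex0 -T0 lex1.
have [F [G FG]] := rich_iso rD rD DD S0 T0.
exact: relative_iso FG.
Qed.

Lemma rich_isomorphic d (A : ctbDistrLatticeType d)
    d' (B : ctbDistrLatticeType d') (D : set A) (E : set B) :
  rich D -> rich E ->
  (forall a b, D a -> E b -> exists f g, seg_iso a b f g) ->
  (\top : A) != \bot -> (\top : B) != \bot ->
  ba_isomorphic (completion A) (completion B).
Proof.
have top_neq0 d0 (C : ctbDistrLatticeType d0) : (\top : C) != \bot ->
    (\top : completion C) != \bot.
  apply: contra_neq => /(congr1 val) C0.
  have : val (\top : completion C) \top by move=> x [].
  by rewrite C0 => /(_ \top I); rewrite meetxx.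
move=> rD rE DE A0 B0.
have [F [G]] := rich_iso rD rE DE (top_neq0 _ _ A0) (top_neq0 _ _ B0).
exact: top_iso.
Qed.

End Rich.

(** * The combinatorial ideal on the Baire space *)

Section SigmaAlgebras.
Context (T : Type) (G : set (set T)).

Lemma g_sigma_bigcup (I : countType) (D : set I) (F : I -> set T) :
  (forall i, D i -> <<s G >> (F i)) -> <<s G >> (\bigcup_(i in D) F i).
Proof.
move=> GF.
have -> : \bigcup_(i in D) F i = \bigcup_n
    (if unpickle n is Some i then if `[< D i >] then F i else set0 else set0).
  apply/seteqP; split=> [x [i Di Fx]|x [n _]].
    by exists (pickle i); rewrite // pickleK asboolT.
  by case: unpickle => // i; case: asboolP => // Di Fx; exists i.
apply: sigma_algebra_bigcup => n.
case: unpickle => [i|]; last exact: sigma_algebra0.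
by case: asboolP => [/GF//|_]; exact: sigma_algebra0.
Qed.

Lemma g_sigmaC (A : set T) : <<s G >> A -> <<s G >> (~` A).
Proof. by move=> GA; rewrite -setTD; exact: sigma_algebraCD. Qed.

Lemma g_sigma_bigcap (I : countType) (D : set I) (F : I -> set T) :
  (forall i, D i -> <<s G >> (F i)) -> <<s G >> (\bigcap_(i in D) F i).
Proof.
move=> GF; rewrite -[X in <<s G >> X]setCK setC_bigcap.
apply: g_sigmaC; apply: g_sigma_bigcup => i Di; apply: g_sigmaC; exact: GF.
Qed.

Lemma g_sigmaT : <<s G >> setT.
Proof. by have := g_sigmaC (@sigma_algebra0 _ setT G); rewrite setC0. Qed.

Lemma g_sigmaU A B : <<s G >> A -> <<s G >> B -> <<s G >> (A `|` B).
Proof.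
by move=> GA GB; rewrite -bigcup2E; apply: g_sigma_bigcup => -[//|[//|i _]];
  exact: sigma_algebra0.
Qed.

Lemma g_sigmaI A B : <<s G >> A -> <<s G >> B -> <<s G >> (A `&` B).
Proof.
by move=> GA GB; rewrite -[A `&` B]setCK setCI; apply: g_sigmaC; apply: g_sigmaU;
  exact: g_sigmaC.
Qed.

Lemma g_sigmaD A B : <<s G >> A -> <<s G >> B -> <<s G >> (A `\` B).
Proof. by move=> GA GB; apply: g_sigmaI => //; exact: g_sigmaC. Qed.

Lemma g_sigma_ind (P : set T -> Prop) :
  (forall A, G A -> P A) -> P set0 -> (forall A, P A -> P (~` A)) ->
  (forall F : nat -> set T, (forall n, P (F n)) -> P (\bigcup_n F n)) ->
  forall A, <<s G >> A -> P A.
Proof.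
move=> PG P0 PC PU; suff : <<s G >> `<=` P by [].
apply: smallest_sub => //; split=> //.
by move=> A PA; rewrite setTD; exact: PC.
Qed.

End SigmaAlgebras.

Section PrefixChains.
Context (T : eqType).

Lemma chain_limit (x0 : T) (s : nat -> seq T) :
  (forall n, prefix (s n) (s n.+1)) -> (forall n, n <= size (s n))%N ->
  exists x : nat -> T, forall n, mkseq x (size (s n)) = s n.
Proof.
move=> ss sz; have pre n k : prefix (s n) (s (n + k)%N).
  elim: k => [|k IH]; first by rewrite addn0 prefix_refl.
  by rewrite addnS; exact: prefix_trans IH (ss _).
have nthE n m i : (i < size (s n))%N -> (i < size (s m))%N ->
    nth x0 (s n) i = nth x0 (s m) i.
  wlog nm : n m / (n <= m)%N => [h|] il im.
    by have [/h->//|/ltnW/h->] := leqP n m.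
  by have := pre n (m - n)%N; rewrite subnKC// => /prefixP[t ->]; rewrite nth_cat il.
exists (fun i => nth x0 (s i.+1) i) => n.
apply: (@eq_from_nth _ x0) => [|i]; rewrite size_mkseq// => il.
by rewrite nth_mkseq//; exact: nthE.
Qed.

End PrefixChains.

Section Sequences.
Context (T : eqType).
Implicit Types (s t : seq T) (x : nat -> T).

Definition cyl s : set (nat -> T) := [set x | mkseq x (size s) = s].

Lemma mkseqS_rcons x n : mkseq x n.+1 = rcons (mkseq x n) (x n).
Proof. exact: mkseqS. Qed.

Lemma cyl_mkseq x n : cyl (mkseq x n) x.
Proof. by rewrite /cyl /= size_mkseq. Qed.

Lemma cyl_nil : cyl [::] = setT.
Proof. by apply/seteqP; split. Qed.

Lemma cyl_rcons s i x : cyl (rcons s i) x <-> cyl s x /\ x (size s) = i.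
Proof.
rewrite /cyl /= size_rcons mkseqS; split=> [/rcons_inj[]//|[-> ->]//].
Qed.

Lemma cyl_eqP s x y : cyl s x -> cyl s y -> mkseq x (size s) = mkseq y (size s).
Proof. by move=> -> ->. Qed.

Lemma mkseq_eq_le x y n k : (k <= n)%N -> mkseq x n = mkseq y n ->
  mkseq x k = mkseq y k.
Proof.
move=> kn /(congr1 (take k)).
by rewrite -!map_take take_iota (minn_idPl kn).
Qed.

Lemma mkseq_funext x y : (forall n, mkseq x n = mkseq y n) -> x = y.
Proof. by move=> h; apply/funext => n; have := h n.+1; rewrite !mkseqS => /rcons_inj[]. Qed.

End Sequences.

Section Addresses.

(* [nat] enumerates the dyadic rationals of [0, 1[; every dyadic interval
   receives infinitely many even and infinitely many odd indices. *)
Definition dyadic (i : nat) : nat * nat := odflt (0, 0)%N (unpickle i./2).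

(* The dyadic interval of length 2^-n of the [i]-th dyadic rational. *)
Definition addr (n i : nat) : nat :=
  let: (M, e) := dyadic i in (((e %% 2 ^ M) * 2 ^ n) %/ 2 ^ M)%N.

Lemma addr_lt n i : (addr n i < 2 ^ n)%N.
Proof.
rewrite /addr; case: (dyadic i) => M e.
by rewrite ltn_divLR ?expn_gt0// mulnC ltn_pmul2l ?expn_gt0// ltn_mod expn_gt0.
Qed.

Lemma addrS n i : (addr n.+1 i %/ 2 = addr n i)%N.
Proof.
rewrite /addr; case: (dyadic i) => M e.
by rewrite divnAC expnSr mulnA mulnK.
Qed.

Lemma addr_ge n i k : (n <= k)%N -> (addr k i %/ 2 ^ (k - n) = addr n i)%N.
Proof.
move=> /subnKC <-; rewrite addKn; elim: (k - n)%N => [|j IH].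
  by rewrite addn0 expn0 divn1.
by rewrite addnS expnS divnMA addrS.
Qed.

(** The pairs [(n + k, e * 2 ^ k)] all represent the same rational [e / 2 ^ n], so their codes give
    arbitrarily large indices; the lowest bit of the index is free and is set to [b]. *)
Lemma addr_exists n e N b : (e < 2 ^ n)%N ->
  exists i, [/\ (N <= i)%N, odd i = b & addr n i = e].
Proof.
move=> en; pose f k := pickle ((n + k)%N, (e * 2 ^ k)%N).
have finj : injective f.
  by move=> k l; rewrite /f => /(pcan_inj pickleK)/(congr1 fst)/= /addnI.
have [k Nk] : exists k, (N <= f k)%N.
  apply: contrapT => h; have fN k : (f k < N)%N by rewrite ltnNge; apply/negP => Nk; apply: h; exists k.
  have /leq_card : injective (fun k : 'I_N.+1 => Ordinal (fN k)).
    by move=> i j /(congr1 val) /finj /val_inj.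
  by rewrite !card_ord ltnn.
exists (b + (f k).*2)%N; split.
- by rewrite (leq_trans Nk)// -addnn addnA leq_addl.
- by rewrite oddD odd_double addbF; case: b.
- rewrite /addr /dyadic half_bit_double pickleK /=.
  rewrite modn_small; last by rewrite expnD ltn_pmul2r ?expn_gt0.
  by rewrite -mulnA -expnD addnC mulnK// expn_gt0.
Qed.

End Addresses.

Section Weight.
Context (R : realType).
Implicit Types (I : set nat) (A : set (nat -> nat)) (s : seq nat).
Local Open Scope ereal_scope.

Definition hits I n : set nat :=
  [set e | forall N, exists i, [/\ (N <= i)%N, I i & addr n i = e]].

Definition nhits I n : nat := (\sum_(e < 2 ^ n) `[< hits I n e >])%N.

(* The Lebesgue measure of the cluster set in [0, 1] of the dyadic rationals
   with index in [I]. *)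
Definition weight I : \bar R :=
  ereal_inf [set ((nhits I n)%:R / 2 ^+ n)%:E | n in setT].

Definition branch A s : set nat := [set i | exists2 x, A x & cyl (rcons s i) x].

(** The nodes are summed through their codes; naturals that code no sequence contribute the default
    0. *)
Definition total_weight A : \bar R :=
  \sum_(0 <= j <oo) oapp (fun s => weight (branch A s)) 0 (pickle_inv j).

Definition scattered (small : \bar R -> Prop) A : Prop :=
  exists A_ : nat -> set (nat -> nat),
    A `<=` \bigcup_n A_ n /\ forall n, small (total_weight (A_ n)).

Lemma hits_lt I n e : hits I n e -> (e < 2 ^ n)%N.
Proof. by move=> /(_ 0%N)[i [_ _ <-]]; exact: addr_lt. Qed.

Lemma weight_ge0 I : 0 <= weight I.
Proof. by apply: le_ereal_inf_tmp => _ [n _ <-]; rewrite lee_fin divr_ge0// exprn_ge0. Qed.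

Lemma term_ge0 A j :
  0 <= oapp (fun s => weight (branch A s)) 0 (pickle_inv j : option (seq nat)).
Proof. by case: pickle_inv => //= s; exact: weight_ge0. Qed.

Lemma weight_full I b : (forall i, odd i = b -> I i) -> 1 <= weight I.
Proof.
move=> bI; apply: le_ereal_inf_tmp => _ [n _ <-].
rewrite lee_fin ler_pdivlMr ?exprn_gt0// mul1r -natrX ler_nat.
rewrite /nhits -[leqLHS]card_ord -sum1_card; apply: leq_sum => e _.
case: asboolP => // -[] N; have [i [Ni ib ie]] := addr_exists N b (ltn_ord e).
by exists i; split=> //; exact: bI.
Qed.

Lemma nneseries_oo (f : nat -> \bar R) : (forall n, 0 <= f n) ->
  (forall N, exists2 n, (N <= n)%N & 1 <= f n) -> \sum_(0 <= i <oo) f i = +oo.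
Proof.
move=> f0 f1; apply/eqyP => M M0.
have [k Mk] : exists k : nat, (M <= k%:R)%R.
  by exists (Num.trunc M).+1; rewrite ltW// truncnS_gt.
suff [N Nk] : exists N, (k%:R)%:E <= \sum_(0 <= i < N) f i.
  apply: (@le_trans _ _ (k%:R)%:E); first by rewrite lee_fin.
  by apply: le_trans Nk _; apply: nneseries_lim_ge => i _ _.
elim: k {Mk} => [|k [N Nk]]; first by exists 0%N; rewrite big_geq.
have [n Nn fn] := f1 N; exists n.+1.
rewrite big_nat_recr//= -natr1 EFinD leeD// (le_trans Nk)//.
by apply: lee_sum_nneg_natr => // i _ _; exact: f0.
Qed.

(** These classes provide the continuum of disjoint positive elements inside one model: each parity
    alone already gives every dyadic interval infinitely many indices. *)
Definition parity_class (a : nat -> bool) : set (nat -> nat) :=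
  [set x | forall n, odd (x n) = a n].

(** A Baire category argument. If [A n] met every cylinder of an admissible extension of [s], all
    nodes of the class above [s] would have weight at least 1 and the total weight of [A n] would be
    infinite. So [A n] can be avoided by lengthening [s], and the limit branch avoids all of
    them. *)
Lemma parity_class_not_scattered (small : \bar R -> Prop) a : ~ small +oo ->
  ~ scattered small (parity_class a).
Proof.
move=> small_oo [A [aA As]].
pose adm s := forall i, (i < size s)%N -> odd (nth 0%N s i) = a i.
have admS s i : adm s -> odd i = a (size s) -> adm (rcons s i).
  move=> sa ia k; rewrite size_rcons ltnS nth_rcons leq_eqVlt.
  by case: ltngtP => //= [ks _|-> _]; [exact: sa|].
have step n s : adm s -> exists t, [/\ adm t, prefix s t, (size s < size t)%N &
    forall x, cyl t x -> ~ A n x].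
  move=> sa; apply: contrapT => h; apply: small_oo.
  suff <- : total_weight (A n) = +oo by [].
  apply: nneseries_oo => [j|N]; first exact: term_ge0.
  have w t : adm t -> prefix s t -> 1 <= weight (branch (A n) t).
    move=> ta st; apply: (@weight_full _ (a (size t))) => i ia.
    apply: contrapT => nb; apply: h; exists (rcons t i); split.
    - exact: admS.
    - by rewrite -cats1; exact: prefix_catl.
    - by rewrite size_rcons ltnS; exact: size_prefix.
    - by move=> x xt Ax; apply: nb; exists x.
  (* Infinitely many distinct one-step extensions of the right parity, hence nodes of weight at
     least 1 with arbitrarily large codes. *)
  pose t k := rcons s (a (size s) + k.*2)%N.
  have tP k : 1 <= weight (branch (A n) (t k)).
    apply: w; first by apply: admS; rewrite // oddD odd_double addbF oddb.
    exact: prefix_rcons.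
  have [k Nk] : exists k, (N <= pickle (t k))%N.
    apply: contrapT => hk; have tN k : (pickle (t k) < N)%N.
      by rewrite ltnNge; apply/negP => Nk; apply: hk; exists k.
    have /leq_card : injective (fun k : 'I_N.+1 => Ordinal (tN k)).
      move=> i j /(congr1 val) /(pcan_inj pickleK) /rcons_inj[] /addnI.
      by move=> /double_inj /val_inj.
    by rewrite !card_ord ltnn.
  by exists (pickle (t k)); rewrite ?pickleK_inv /=; [exact: Nk|exact: tP].
have /choice[f fP] : forall ns : nat * seq nat, exists t, adm ns.2 ->
    [/\ adm t, prefix ns.2 t, (size ns.2 < size t)%N & forall x, cyl t x -> ~ A ns.1 x].
  move=> [n s] /=; have [sa|sa] := pselect (adm s); last by exists s.
  by have [t tP] := step n s sa; exists t.
pose s := fix s n := if n is m.+1 then f (m, s m) else [::].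
have sa n : adm (s n) by elim: n => //= n sn; have [] := fP (n, s n) sn.
have sS n := fP (n, s n) (sa n).
have [x xs] : exists x, forall n, mkseq x (size (s n)) = s n.
  apply: (chain_limit 0%N) => [n|]; first by have [] := sS n.
  by elim=> // n IH; have [_ _ /(leq_ltn_trans IH)] := sS n.
have xa : parity_class a x.
  move=> n; have nsz : (n < size (s n.+1))%N.
    elim: n => [|n IH]; first by have [_ _ /(leq_ltn_trans (leq0n _))] := sS 0%N.
    by have [_ _ /(leq_ltn_trans IH)] := sS n.+1.
  by have := sa n.+1 _ nsz; rewrite -{1}(xs n.+1) nth_mkseq.
have [n _ An] := aA _ xa.
by have [_ _ _ h] := sS n; exact: h x (xs n.+1) An.
Qed.

Lemma parity_class_disjoint a b x :
  parity_class a x -> parity_class b x -> a = b.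
Proof. by move=> xa xb; apply/funext => n; rewrite -xa xb. Qed.

Definition sigma_cyl : set (set (nat -> nat)) := <<s range (@cyl nat) >>.

Lemma sigma_cyl_cyl s : sigma_cyl (cyl s).
Proof. by apply: sub_sigma_algebra; exists s. Qed.

End Weight.

Lemma sigma_cylT : sigma_cyl setT.
Proof. exact: (@g_sigmaT _ (range (@cyl nat))). Qed.

Lemma borelD (X : topologicalType) (A B : set X) :
  borel A -> borel B -> borel (A `\` B).
Proof. exact: g_sigmaD. Qed.

(** * Classes of Borel sets modulo a covering ideal *)

Section QuotientByCovers.
Context (X : topologicalType) (P : set (set X)).
Local Notation cc := (countably_covered P).
Local Notation Q := (quotient_algebra (covering_ideal P)).
Local Open Scope quotient_scope.

Lemma covered_sub A B : A `<=` B -> cc B -> cc A.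
Proof. by move=> AB [F [cF FP BF]]; exists F; split=> // x /AB /BF. Qed.

Lemma covered_bigcup (F : nat -> set X) : (forall n, cc (F n)) ->
  cc (\bigcup_n F n).
Proof.
move=> /choice[H HP]; exists (\bigcup_n H n); split.
- by apply: bigcup_countable => // n _; case: (HP n).
- by move=> K [n _]; have [_ HnP _] := HP n; exact: HnP.
- move=> x [n _ Fx]; have [_ _ /(_ _ Fx)[K HK Kx]] := HP n.
  by exists K => //; exists n.
Qed.

Lemma coveredU A B : cc A -> cc B -> cc (A `|` B).
Proof.
move=> cA cB; apply: (@covered_sub _ (\bigcup_n (if n is 0 then A else B))).
  by move=> x [Ax|Bx]; [exists 0%N|exists 1%N].
by apply: covered_bigcup => -[].
Qed.

Lemma covered0 : cc set0.
Proof. by exists set0; split=> //; exact: countable0. Qed.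

Lemma covered_in A : P A -> cc A.
Proof.
move=> PA; exists [set A]; split=> [|_ -> //|x Ax]; first exact: countable1.
by exists A.
Qed.

Lemma coveredP A : P set0 -> cc A <->
  exists2 F : nat -> set X, forall n, P (F n) & A `<=` \bigcup_n F n.
Proof.
move=> P0; split=> [[F [cF FP AF]]|[F FP AF]]; last first.
  exists (range F); split.
  - exact: card_image_le.
  - by move=> _ [n _ <-].
  - by move=> x /AF[n _ Fx]; exists (F n).
have [F0|[f]] := pfcard_geP cF.
  by exists (fun=> set0) => // x /AF[K]; rewrite F0.
exists f => [n|x /AF[K FK Kx]]; first by apply: FP; exact: funS.
by have [n _ fn] := 'surj_f FK; exists n; rewrite // fn.
Qed.

Lemma covered_cond A : ~ cc A -> A !=set0.
Proof.
by move=> nA; apply/set0P/eqP => A0; apply: nA; rewrite A0; exact: covered0.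
Qed.

Lemma class_exists (A : set X) : exists B : borel_algebra X, borel A -> val B = A.
Proof.
have [bA|nA] := pselect (borel A); last by exists \bot%O.
by exists (exist (@is_borel X) A (introT (is_borelP A) bA)).
Qed.

(** Made total on all sets, so that no proof of Borelness has to be carried along; the value at a
    set that is not Borel is unspecified. *)
Definition cls (A : set X) : Q := \pi_Q (projT1 (cid (class_exists A))).

Definition rep (x : Q) : set X := val (repr x).

Lemma borel_rep x : borel (rep x).
Proof. exact/is_borelP/valP. Qed.

Lemma pi_eq0 (B : borel_algebra X) : \pi_Q B = \bot%O <-> cc (val B).
Proof. exact: quotient_eq0. Qed.

Lemma pi_le (B C : borel_algebra X) :
  (\pi_Q B <= \pi_Q C)%O <-> cc (val B `\` val C).
Proof.
have -> : val B `\` val C = val (B `&` ~` C)%O by [].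
have [mI _ mC] := quotient_morphism (covering_ideal P).
rewrite -diff_eq0 diffE -mC -mI.
have <- : (\pi_Q (B `&` ~` C)%O = \bot%O) <-> cc (val (B `&` ~` C)%O).
  exact: pi_eq0.
by split=> [/eqP|->].
Qed.

Lemma le_rep x y : (x <= y)%O <-> cc (rep x `\` rep y).
Proof. by rewrite -[x in (x <= _)%O]reprK -[y in (_ <= y)%O]reprK; exact: pi_le. Qed.

Lemma le_clsl A y : borel A -> (cls A <= y)%O <-> cc (A `\` rep y).
Proof.
move=> bA; rewrite -[y in (_ <= y)%O]reprK /cls; case: cid => B /= /(_ bA) BA.
by rewrite -[A in A `\` _]BA; exact: pi_le.
Qed.

Lemma le_clsr x A : borel A -> (x <= cls A)%O <-> cc (rep x `\` A).
Proof.
move=> bA; rewrite -[x in (x <= _)%O]reprK /cls; case: cid => B /= /(_ bA) BA.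
by rewrite -[A in _ `\` A]BA; exact: pi_le.
Qed.

Lemma le_cls A B : borel A -> borel B ->
  (cls A <= cls B)%O <-> cc (A `\` B).
Proof.
rewrite /cls => bA bB; case: cid => C /= /(_ bA) CA; case: cid => D /= /(_ bB) DB.
by rewrite -CA -DB; exact: pi_le.
Qed.

Lemma rep_cls A : borel A -> cc (rep (cls A) `\` A) /\ cc (A `\` rep (cls A)).
Proof. by move=> bA; split; [apply/le_clsr|apply/le_clsl]. Qed.

Lemma cls_neq0 A : borel A -> cls A != \bot%O <-> ~ cc A.
Proof.
move=> bA; rewrite /cls; case: cid => B /= /(_ bA) BA.
have -> : cc A <-> (\pi_Q B = \bot%O).
  by rewrite -[A in cc A]BA; split=> /pi_eq0.
by split=> [/eqP|/eqP].
Qed.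

Lemma cls_disjoint A B : borel A -> borel B -> A `&` B = set0 ->
  (cls A `&` cls B)%O = \bot%O.
Proof.
have [mI _ _] := quotient_morphism (covering_ideal P).
rewrite /cls => bA bB AB; case: cid => C /= /(_ bA) CA; case: cid => D /= /(_ bB) DB.
rewrite -mI; apply/pi_eq0.
rewrite (_ : val (C `&` D)%O = set0); first exact: covered0.
by rewrite -AB -CA -DB.
Qed.

Lemma rep_neq0 x : x != \bot%O <-> ~ cc (rep x).
Proof.
have -> : cc (rep x) <-> x = \bot%O.
  by rewrite -{2}[x]reprK; split=> /pi_eq0.
by split=> [/eqP|/eqP].
Qed.

End QuotientByCovers.
Arguments rep {X} P x.

(** Borelness of direct images is a clause of the definition, which replaces an appeal to the
    Lusin-Souslin theorem. The last clause is the only one about the ideal, and its right side does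
    not involve the space. *)
Definition models (X : topologicalType) (P : set (set X)) (R : realType)
    (small : \bar R -> Prop) (g : (nat -> nat) -> X) : Prop :=
  [/\ injective g,
      forall A, sigma_cyl A -> borel (g @` A),
      forall B, borel B -> sigma_cyl (g @^-1` B) &
      forall A, sigma_cyl A ->
        countably_covered P (g @` A) <-> scattered small A].

Lemma image_injD T U (f : T -> U) (A B : set T) : injective f ->
  f @` (A `\` B) = f @` A `\` f @` B.
Proof.
move=> fI; apply/seteqP; split=> [_ [x [Ax nB] <-]|_ [[x Ax <-] nB]].
  by split; [exists x|move=> [y By /fI yx]; apply: nB; rewrite -yx].
by exists x => //; split=> // Bx; apply: nB; exists x.
Qed.

Section ModelIso.
Context (X Y : topologicalType) (P : set (set X)) (P' : set (set Y)).
Context (R : realType) (small : \bar R -> Prop).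
Context (g : (nat -> nat) -> X) (h : (nat -> nat) -> Y).
Hypotheses (gm : models P small g) (hm : models P' small h).

Definition transfer (x : quotient_algebra (covering_ideal P)) :
    quotient_algebra (covering_ideal P') := cls P' (h @` (g @^-1` (rep P x))).

Lemma borel_transfer x : borel (h @` (g @^-1` (rep P x))).
Proof.
have [_ _ gp _] := gm; have [_ hi _ _] := hm.
by apply: hi; apply: gp; exact: borel_rep.
Qed.

Lemma transfer_le x : (transfer x <= cls P' (range h))%O.
Proof.
have [_ hi _ _] := hm; apply/le_cls; first exact: borel_transfer.
  by apply: hi; exact: sigma_cylT.
suff -> : h @` (g @^-1` rep P x) `\` range h = set0 by exact: covered0.
by apply/seteqP; split=> // _ [[z _ <-] []]; exists z.
Qed.

Lemma transfer_covered A : borel A -> countably_covered P A ->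
  countably_covered P' (h @` (g @^-1` A)).
Proof.
have [gI gi gp gs] := gm; have [hI hi hp hs] := hm => bA cA.
apply/hs; first exact: gp.
by apply/gs; [exact: gp|apply: covered_sub cA => _ [x + <-]].
Qed.

Lemma transfer_homo x y : (x <= y)%O -> (transfer x <= transfer y)%O.
Proof.
have [hI _ _ _] := hm.
move=> /le_rep xy; apply/le_cls; [exact: borel_transfer..|].
rewrite -image_injD//; apply: (@transfer_covered (rep P x `\` rep P y)) => //.
by apply: borelD; exact: borel_rep.
Qed.

End ModelIso.

Arguments transfer {X Y} P P' g h x.

Section ModelSegIso.
Context (X Y : topologicalType) (P : set (set X)) (P' : set (set Y)).
Context (R : realType) (small : \bar R -> Prop).
Context (g : (nat -> nat) -> X) (h : (nat -> nat) -> Y).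
Hypotheses (gm : models P small g) (hm : models P' small h).

(** The hypothesis puts the part of [x] outside [range g] into the ideal. The other errors come from
    the choice of representatives; they are covered sets, and [transfer_covered] keeps them
    covered. *)
Lemma transferK x : (x <= cls P (range g))%O ->
  transfer P' P h g (transfer P P' g h x) = x.
Proof.
have [gI gi gp gs] := gm; have [hI hi hp hs] := hm.
have bg : borel (range g) by apply: gi; exact: sigma_cylT.
move=> /(le_clsr _ bg) xg; set y := transfer P P' g h x.
have [yS Sy] := rep_cls P' (borel_transfer gm hm x).
have bx := borel_rep x; have bt := borel_transfer gm hm x.
apply: le_anti; apply/andP; split.
  apply/le_clsl; first exact: borel_transfer hm gm y.
  have := transfer_covered hm gm _ yS.
  move=> /(_ (borelD (borel_rep _) bt)).
  apply: covered_sub => _ [[z yz <-] nx]; exists z => //.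
  by split=> // -[w xw /hI wz]; apply: nx; rewrite -wz.
apply/le_clsr; first exact: borel_transfer hm gm y.
have cS := transfer_covered hm gm (borelD bt (borel_rep _)) Sy.
apply: covered_sub (coveredU xg cS) => z [xz nz].
have [[w _ wz]|zg] := pselect (range g z); last by left.
right; exists w => //; split; first by exists w => //=; rewrite wz.
by move=> yw; apply: nz; exists w.
Qed.

End ModelSegIso.

Lemma models_seg_iso (X Y : topologicalType) (P : set (set X)) (P' : set (set Y))
    (R : realType) (small : \bar R -> Prop) g h :
  models P small g -> models P' small h ->
  seg_iso (cls P (range g)) (cls P' (range h))
    (transfer P P' g h) (transfer P' P h g).
Proof.
move=> gm hm; split=> [x xg|y yh|x y _|x y _].
- by split; [exact: transfer_le gm hm x|exact: (transferK gm hm xg)].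
- by split; [exact: transfer_le hm gm y|exact: (transferK hm gm yh)].
- exact: (transfer_homo gm hm).
- exact: (transfer_homo hm gm).
Qed.

(* The bound on the number of models makes up for the fact that the antichains
   of the quotient must have the cardinality of the continuum. *)
Definition densely_modelled (X : topologicalType) (P : set (set X))
    (R : realType) (small : \bar R -> Prop) : Prop :=
  exists code : (nat -> bool) -> set X,
  forall B, borel B -> ~ countably_covered P B -> exists g,
    [/\ models P small g, range g `<=` B & exists c, range g = code c].

Section DenselyModelled.
Context (R : realType) (small : \bar R -> Prop).
Hypothesis small_oo : ~ small +oo%E.

Lemma sigma_cyl_parity a : sigma_cyl (parity_class a).
Proof.
have -> : parity_class a = \bigcap_n \bigcup_(s in [set s | size s = n /\
    forall i, (i < n)%N -> odd (nth 0%N s i) = a i]) cyl s.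
  apply/seteqP; split=> [x xa n _|x h n].
    exists (mkseq x n); last exact: cyl_mkseq.
    by split=> [|i i_n]; rewrite ?size_mkseq// nth_mkseq// xa.
  have [s [sn /(_ n (ltnSn n)) <-] sx] := h n.+1 Logic.I.
  by move: sx => /= <-; rewrite sn nth_mkseq.
apply: g_sigma_bigcap => n _; apply: g_sigma_bigcup => s _.
exact: sigma_cyl_cyl.
Qed.

Section Rich.
Context (X : topologicalType) (P : set (set X)).
Hypothesis PX : densely_modelled P small.
Local Notation cc := (countably_covered P).
Local Notation Q := (quotient_algebra (covering_ideal P)).

Definition model_classes : set Q :=
  [set cls P (range g) | g in [set g | models P small g /\
     exists c, range g = projT1 (cid PX) c]].

(** The parity classes of one model do double duty: they show that its class is nonzero, and their
    images form the disjoint family of size continuum. *)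
Lemma densely_modelled_rich : rich model_classes.
Proof.
rewrite /model_classes; case: cid => code dm /=.
have bg g : models P small g -> borel (range g).
  by case=> _ gi _ _; apply: gi; exact: sigma_cylT.
have dense (x : Q) : x != \bot%O -> exists g, [/\ models P small g,
    range g `<=` rep P x & exists c, range g = code c].
  by move=> /rep_neq0 /(dm _ (borel_rep x)).
have parity_neq0 g a : models P small g ->
    cls P (g @` parity_class a) != \bot%O.
  move=> gm; have [_ gi _ gs] := gm; have sa := sigma_cyl_parity a.
  apply/cls_neq0; first exact: gi.
  by move=> /(gs _ sa); exact: parity_class_not_scattered.
have sub0 A B : A `<=` B -> cc (A `\` B).
  by move=> AB; rewrite (_ : A `\` B = set0); [exact: covered0|rewrite setD_eq0].
have model_neq0 g : models P small g -> cls P (range g) != \bot%O.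
  move=> gm; have := parity_neq0 g xpredT gm; apply: contra_neq => g0.
  apply/eqP; rewrite -lex0 -g0; have [_ gi _ gs] := gm.
  apply/le_cls; [by apply: gi; exact: sigma_cyl_parity|exact: bg|].
  by apply: sub0 => _ [x _ <-]; exists x.
split.
- by move=> _ [g [gm _] <-]; exact: model_neq0.
- move=> x /dense[g [gm gx gc]]; exists (cls P (range g)); first by exists g.
  by apply/le_clsl; [exact: bg|exact: sub0].
- by exists (fun c => cls P (code c)) => _ [g [_ [c ->]] <-]; exists c.
- move=> x /dense[g [gm gx _]]; have [gI gi _ _] := gm.
  exists (fun a => cls P (g @` parity_class a)); split=> [a|a b ab].
    split; first exact: parity_neq0.
    apply/le_clsl; first by apply: gi; exact: sigma_cyl_parity.
    by apply: sub0 => _ [y _ <-]; apply: gx; exists y.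
  apply: cls_disjoint; [by apply: gi; exact: sigma_cyl_parity|by apply: gi; exact: sigma_cyl_parity|].
  apply/seteqP; split=> // _ [[y ya <-] [z zb /gI zy]]; apply: ab.
  by apply: (parity_class_disjoint ya); rewrite -zy.
Qed.

Lemma model_classes_sub : model_classes `<=` [set cls P (range g) | g in models P small].
Proof. by move=> _ [g [gm _] <-]; exists g. Qed.

End Rich.

Lemma densely_modelled_homogeneous (X : topologicalType) (P : set (set X)) :
  densely_modelled P small ->
  homogeneous (completion (quotient_algebra (covering_ideal P))).
Proof.
move=> PX; apply: (rich_homogeneous (densely_modelled_rich PX)).
move=> _ _ /model_classes_sub[g gm <-] /model_classes_sub[h hm <-].
by do 2!eexists; exact: models_seg_iso gm hm.
Qed.

Lemma densely_modelled_isomorphic (X Y : topologicalType)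
    (P : set (set X)) (P' : set (set Y)) :
  densely_modelled P small -> densely_modelled P' small ->
  ~ countably_covered P setT -> ~ countably_covered P' setT ->
  ba_isomorphic (completion (quotient_algebra (covering_ideal P)))
                (completion (quotient_algebra (covering_ideal P'))).
Proof.
have top_neq0 (Z : topologicalType) (S : set (set Z)) :
    ~ countably_covered S setT ->
    (\top : quotient_algebra (covering_ideal S))%O != \bot%O.
  move=> nS; apply/eqP => t0; apply: nS.
  have /pi_eq0 : (\pi_(quotient_algebra (covering_ideal S)) \top%O)%qT = \bot%O.
    apply/eqP; rewrite -lex0 -t0 lex1//.
  by [].
move=> PX PY nX nY.
apply: (rich_isomorphic (densely_modelled_rich PX) (densely_modelled_rich PY)).
- move=> _ _ /model_classes_sub[g gm <-] /model_classes_sub[h hm <-].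
  by do 2!eexists; exact: models_seg_iso gm hm.
- exact: top_neq0.
- exact: top_neq0.
Qed.

End DenselyModelled.

(** * Compact metrizable spaces *)

Section MetricCompactum.
Context (R : realType) (X : ptopologicalType) (dist : X -> X -> R).

Definition metrizes : Prop := is_metric dist /\
  forall x : X, nbhs x =
    filter_from [set e : R | 0 < e] (fun e => [set y | dist x y < e]).

Hypothesis dX : metrizes.

Lemma distxx x : dist x x = 0.
Proof. by have [[d0 _ _] _] := dX; apply/d0. Qed.

Lemma distC x y : dist x y = dist y x.
Proof. by have [[_ dC _] _] := dX; exact: dC. Qed.

Lemma dist_triangle y x z : dist x z <= dist x y + dist y z.
Proof. by have [[_ _ dD] _] := dX; exact: dD. Qed.

Lemma dist_ge0 x y : 0 <= dist x y.
Proof.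
have := dist_triangle y x x; rewrite distxx (distC y x) -mulr2n.
by rewrite pmulrn_lge0.
Qed.

Lemma dist_eq0 x y : dist x y <= 0 -> x = y.
Proof.
have [[d0 _ _] _] := dX => xy; apply/d0; apply/eqP.
by rewrite eq_le xy dist_ge0.
Qed.

Definition dball x (e : R) : set X := [set y | dist x y < e].

Definition cball x (e : R) : set X := [set y | dist x y <= e].

Lemma nbhs_distP x A : nbhs x A <-> exists2 e : R, 0 < e & dball x e `<=` A.
Proof. by have [_ ->] := dX. Qed.

Lemma open_distP (A : set X) : open A <-> forall x, A x -> exists2 e : R, 0 < e & dball x e `<=` A.
Proof.
rewrite openE; split=> [oA x /oA /nbhs_distP//|h x /h ?].
exact/nbhs_distP.
Qed.

Lemma open_dball x e : open (dball x e).
Proof.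
apply/open_distP => y xy; exists (e - dist x y); rewrite ?subr_gt0//.
move=> z /= yz; apply: le_lt_trans (dist_triangle y x z) _.
by rewrite -ltrBrDl.
Qed.

Lemma closed_cball x e : closed (cball x e).
Proof.
rewrite -openC; apply/open_distP => y /negP; rewrite -ltNge => xy.
exists (dist x y - e); rewrite ?subr_gt0// => z /= yz; apply/negP; rewrite -ltNge.
have := dist_triangle z x y; rewrite (distC z y); move: yz; rewrite /dball/=; lra.
Qed.

Lemma closure_distP (A : set X) x : closure A x <->
  forall e : R, 0 < e -> exists2 y, A y & dist x y < e.
Proof.
split=> [Ax e e0|h B /nbhs_distP[e e0 eB]].
  have [|y [Ay xy]] := Ax (dball x e); last by exists y.
  by apply/nbhs_distP; exists e.
by have [y Ay xy] := h e e0; exists y; split=> //; exact: eB.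
Qed.

Lemma closed_distP (A : set X) : closed A <->
  forall x, (forall e : R, 0 < e -> exists2 y, A y & dist x y < e) -> A x.
Proof.
by split=> [cA x /closure_distP/cA//|h x /closure_distP/h].
Qed.

Lemma closed_sing (x : X) : closed [set x].
Proof.
apply/closed_distP => y h; apply/esym/dist_eq0.
rewrite leNgt; apply/negP => xy; have [_ ->] := h _ xy.
by rewrite (distC y) ltxx.
Qed.

Lemma open_cball_sub (U : set X) x : open U -> U x -> exists2 e : R, 0 < e & cball x e `<=` U.
Proof.
move=> /open_distP oU /oU[e e0 eU]; exists (e / 2); first lra.
by move=> y; rewrite /cball/= => xy; apply: eU; rewrite /dball/=; lra.
Qed.

Hypothesis cX : compact [set: X].

Lemma closed_compactX (A : set X) : closed A -> compact A.
Proof. by move=> cA; apply: (subclosed_compact cA cX). Qed.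

Lemma hausdorffX : hausdorff_space X.
Proof.
move=> x y xy; apply: dist_eq0; rewrite leNgt; apply/negP => d0.
have d2 : 0 < dist x y / 2 by lra.
have [||z [xz yz]] := xy (dball x (dist x y / 2)) (dball y (dist x y / 2)).
- by apply/nbhs_distP; exists (dist x y / 2).
- by apply/nbhs_distP; exists (dist x y / 2).
have := dist_triangle z x y; rewrite (distC z y).
by move: xz yz; rewrite /dball/=; lra.
Qed.

Lemma compact_closedX (A : set X) : compact A -> closed A.
Proof. by apply: compact_closed; exact: hausdorffX. Qed.

Lemma nested_closed (F : nat -> set X) U : (forall n, closed (F n)) ->
  (forall n, F n.+1 `<=` F n) -> open U -> \bigcap_n F n `<=` U ->
  exists n, F n `<=` U.
Proof.
move=> cF Fs oU FU; move: cX; rewrite compact_cover.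
move=> /(_ nat setT (fun n => ~` F n `|` U)) [||D _ DX].
- by move=> n _; apply: openU => //; exact: closed_openC.
- move=> x _; have [Ux|nU] := pselect (U x); first by exists 0%N => //; right.
  have [n Fn] : exists n, ~ F n x.
    by apply: contrapT => h; apply/nU/FU => n _; apply: contrapT => ?; apply: h; exists n.
  by exists n => //; left.
have Fle m n : (m <= n)%N -> F n `<=` F m.
  move=> /subnKC <-; elim: (n - m)%N => [|k IH]; first by rewrite addn0.
  by rewrite addnS; exact: subset_trans (Fs _) IH.
exists (\max_(i <- finmap.enum_fset D) i)%N => x Fx.
have [n /= nD [nF|//]] := DX x Logic.I.
by exfalso; apply: nF; apply: Fle Fx; exact: leq_bigmax_seq.
Qed.

Lemma nested_nonempty (F : nat -> set X) : (forall n, closed (F n)) ->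
  (forall n, F n.+1 `<=` F n) -> (forall n, F n !=set0) -> \bigcap_n F n !=set0.
Proof.
move=> cF Fs F0; apply/set0P/eqP => FE.
have [||n Fn] := @nested_closed F set0 cF Fs; [exact: open0|by rewrite FE|].
by have [x /Fn] := F0 n.
Qed.

Lemma finite_net (e : R) : 0 < e ->
  exists s : seq X, forall x, exists2 y, y \in s & dist y x < e.
Proof.
move=> e0; move: cX; rewrite compact_cover.
move=> /(_ X setT (fun y => dball y e)) [||D _ DX].
- by move=> y _; exact: open_dball.
- by move=> x _; exists x => //=; rewrite /dball/= distxx.
by exists (finmap.enum_fset D) => x; have [y] := DX x Logic.I; exists y.
Qed.

Lemma countable_basis : exists U : nat -> set X, (forall n, open (U n)) /\
  forall V x, open V -> V x -> exists2 n, U n x & U n `<=` V.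
Proof.
have /choice[s sP] : forall k : nat, exists s : seq X, forall x,
    exists2 y, y \in s & dist y x < k.+1%:R^-1.
  by move=> k; apply: finite_net; rewrite invr_gt0.
exists (fun n => let: (k, i) := odflt (0, 0)%N (unpickle n) in
  dball (nth point (s k) i) k.+1%:R^-1); split=> [n|V x oV Vx].
  by case: (odflt _ _) => k i; exact: open_dball.
have /open_distP/(_ _ Vx)[e e0 eV] := oV.
have [k ke] : exists k : nat, k.+1%:R^-1 < e / 2.
  exists (Num.trunc (e / 2)^-1); rewrite -[ltRHS]invrK ltf_pV2 ?posrE//; last first.
  - by rewrite invr_gt0; lra.
  - exact: truncnS_gt.
have [y ys yx] := sP k x; exists (pickle (k, index y (s k))).
  by rewrite pickleK /= nth_index.
rewrite pickleK /= nth_index// => z; rewrite /dball/= => yz; apply: eV.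
have := dist_triangle y x z; rewrite (distC x y) /dball/=.
by move: ke yx yz; set r := _^-1; lra.
Qed.

End MetricCompactum.

(** * Souslin sets *)

Section Souslin.
Context (X : topologicalType).

Definition souslin (B : set X) : Prop := exists F : seq nat -> set X,
  (forall s, closed (F s)) /\
  forall x, B x <-> exists z : nat -> nat, forall n, F (mkseq z n) x.

Lemma souslin_closed B : closed B -> souslin B.
Proof.
by move=> cB; exists (fun=> B); split=> // x; split=> [Bx|[z /(_ 0%N)]];
  first exists id.
Qed.

Lemma map_iota1 (z : nat -> nat) n :
  [seq z i | i <- iota 1 n] = mkseq (z \o succn) n.
Proof. by rewrite -[1%N]addn0 iotaDl -map_comp. Qed.

(** For a union the first entry of the branch selects the set and the rest is its own branch; the
    empty sequence has selected nothing yet and gets the whole space. *)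
Definition tail_family (F : nat -> seq nat -> set X) (s : seq nat) : set X :=
  if s is i :: t then F i t else setT.

Lemma tail_familyE F (z : nat -> nat) n :
  tail_family F (mkseq z n.+1) = F (z 0%N) (mkseq (z \o succn) n).
Proof. by rewrite -map_iota1. Qed.

Lemma souslin_bigcup (B : nat -> set X) : (forall n, souslin (B n)) ->
  souslin (\bigcup_n B n).
Proof.
move=> /choice[F FP]; exists (tail_family F); split=> [[|i t]|x].
- exact: closedT.
- by have [cF _] := FP i; exact: cF.
- split=> [[i _ Bx]|[z h]].
    have [_ /(_ x)[/(_ Bx)[z h] _]] := FP i.
    exists (fun n => if n is m.+1 then z m else i) => -[//|n].
    by rewrite tail_familyE.
  exists (z 0%N) => //; have [_ BF] := FP (z 0%N).
  by apply/BF; exists (z \o succn) => n; rewrite -tail_familyE.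
Qed.

(* The witness [z] of the intersection codes the witnesses [z (pickle (n, _))]
   of its terms; a finite prefix of it determines prefixes of these. *)
Lemma souslin_bigcap (B : nat -> set X) : (forall n, souslin (B n)) ->
  souslin (\bigcap_n B n).
Proof.
move=> /choice[F FP].
pose row (s : seq nat) (n k : nat) := mkseq (fun j => nth 0%N s (pickle (n, j))) k.
exists (fun s => \bigcap_(nk in [set nk : nat * nat | forall j, (j < nk.2)%N ->
  (pickle (nk.1, j) < size s)%N]) F nk.1 (row s nk.1 nk.2)); split=> [s|x].
  by apply: closed_bigI => -[n k] _; have [cF _] := FP n; exact: cF.
split=> [Bx|[z h] n _].
  have /choice[z zP] : forall n, exists z, forall k, F n (mkseq z k) x.
    by move=> n; have [_ /(_ x)[/(_ (Bx n Logic.I))[z h] _]] := FP n; exists z.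
  pose Z i := let: (n, j) := odflt (0, 0)%N (unpickle i) in z n j; exists Z.
  move=> N [n k] /= nkN.
  suff -> : row (mkseq Z N) n k = mkseq (z n) k by exact: zP.
  apply/eq_in_map => j; rewrite mem_iota add0n => /= jk.
  rewrite nth_mkseq /Z ?pickleK//.
  by have := nkN j jk; rewrite size_mkseq.
have [_ BF] := FP n; apply/BF; exists (fun j => z (pickle (n, j))) => k.
have [N jN] : exists N, forall j, (j < k)%N -> (pickle (n, j) < N)%N.
  elim: k => [|k [N jN]]; first by exists 0%N.
  exists (N + (pickle (n, k)).+1)%N => j; rewrite ltnS leq_eqVlt => /predU1P[->|/jN jk].
    by rewrite addnS ltnS leq_addl.
  exact: leq_trans jk (leq_addr _ _).
have := h N (n, k); rewrite /= size_mkseq => /(_ jN).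
suff -> : row (mkseq z N) n k = mkseq (fun j => z (pickle (n, j))) k by [].
apply/eq_in_map => j; rewrite mem_iota add0n => /= jk.
by rewrite nth_mkseq// jN.
Qed.

End Souslin.

Section BorelSouslin.
Context (R : realType) (X : ptopologicalType) (dist : X -> X -> R).
Hypothesis dX : metrizes dist.

Lemma open_Fsigma (U : set X) : open U -> exists F : nat -> set X,
  (forall n, closed (F n)) /\ U = \bigcup_n F n.
Proof.
move=> oU.
exists (fun n => [set x | forall y, ~ U y -> n.+1%:R^-1 <= dist x y]); split.
  move=> n; apply/(closed_distP dX) => x h y nUy; rewrite leNgt; apply/negP => xy.
  have [x' /(_ y nUy) x'y xx'] := h _ (etrans (subr_gt0 _ _) xy).
  have := dist_triangle dX x x' y; rewrite (distC dX x' x).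
  by move: x'y xx'; set r := _^-1; lra.
apply/seteqP; split=> [x Ux|x [n _ h]].
  have [e e0 eU] := (open_distP dX U).1 oU _ Ux.
  exists (Num.trunc e^-1) => // y nUy.
  rewrite leNgt; apply/negP => xy; apply/nUy/eU; rewrite /dball/= (lt_trans xy)//.
  by rewrite -[ltRHS]invrK ltf_pV2 ?posrE ?invr_gt0// truncnS_gt.
apply: contrapT => /h; rewrite (distxx dX).
by rewrite leNgt invr_gt0 ltr0Sn.
Qed.

(** Souslin sets are not closed under complement, so the induction carries [B] and its complement
    together; open sets enter through [open_Fsigma]. *)
Lemma borel_souslin (B : set X) : borel B -> souslin B.
Proof.
move=> bB; suff [] : souslin B /\ souslin (~` B) by [].
move: B bB; apply: g_sigma_ind.
- move=> U oU; split; last exact/souslin_closed/open_closedC.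
  have [F [cF ->]] := open_Fsigma oU.
  by apply: souslin_bigcup => n; exact: souslin_closed.
- split; first by apply: souslin_closed; exact: closed0.
  by rewrite setC0; apply: souslin_closed; exact: closedT.
- by move=> A [sA sC]; rewrite setCK.
- move=> F FP; split; first by apply: souslin_bigcup => n; case: (FP n).
  by rewrite setC_bigcup; apply: souslin_bigcap => n; case: (FP n).
Qed.

End BorelSouslin.

(** * The tree of closed sets *)

Section Kernel.
Context (R : realType) (X : ptopologicalType) (dist : X -> X -> R).
Hypotheses (dX : metrizes dist) (cX : compact [set: X]).
Context (P : set (set X)).
Local Notation cc := (countably_covered P).

(** The analogue of the perfect kernel of Cantor-Bendixson, with the sets of the ideal in place of
    countable sets. *)
Definition kernel_of (A : set X) : set X :=
  [set x | A x /\ forall U, open U -> U x -> ~ cc (A `&` U)].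

(** The points removed are covered by the countably many basic open sets whose trace on [A] is in
    the ideal, and the ideal is closed under countable unions. *)
Lemma kernel_of_large A : ~ cc A -> ~ cc (kernel_of A).
Proof.
move=> nA cK; apply: nA; have [U [oU UV]] := countable_basis dX cX.
apply: (@covered_sub _ P _ (kernel_of A `|`
    \bigcup_n (if `[< cc (A `&` U n) >] then A `&` U n else set0))); last first.
  apply: coveredU => //; apply: covered_bigcup => n.
  by case: asboolP => // _; exact: covered0.
move=> x Ax; have [Kx|nK] := pselect (kernel_of A x); [by left|right].
have [V [oV Vx cAV]] : exists V, [/\ open V, V x & cc (A `&` V)].
  apply: contrapT => h; apply: nK; split=> // V oV Vx cAV.
  by apply: h; exists V.
have [n Ux UnV] := UV _ _ oV Vx; exists n => //.
rewrite asboolT//; apply: covered_sub cAV => y [Ay /UnV Vy]; split=> //.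
Qed.

End Kernel.

Section Construction.
Context (R : realType) (X : ptopologicalType) (dist : X -> X -> R).
Hypotheses (dX : metrizes dist) (cX : compact [set: X]).
Context (P : set (set X)).
Local Notation cc := (countably_covered P).
(* [fine s U] means that [U] is small enough to be the piece of index [s]. *)
Context (fine : seq nat -> set X -> Prop).
Hypothesis fineP : forall s x, exists2 r : R, 0 < r &
  forall U, U `<=` dball dist x r -> fine s U.
Context (good : (nat -> nat -> set X) -> Prop).
(** The set [K 0 0] is the root of the scheme. By the last clause it is nowhere dense in [Y], which
    leaves room for children next to each of its points. *)
Hypothesis goodP : forall Y, closed Y -> ~ cc Y -> exists K : nat -> nat -> set X,
  [/\ good K, closed (K 0 0)%N, K 0%N 0%N `<=` Y,
      forall n e, (e < 2 ^ n)%N -> K n e !=set0 /\ K n e `<=` K 0%N 0%N &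
      forall U, open U -> U `&` Y !=set0 -> (U `&` Y) `\` K 0%N 0%N !=set0].
Context (F : seq nat -> set X).
Hypothesis cF : forall s, closed (F s).

Definition sift s : set X :=
  [set x | exists2 z, cyl s z & forall n, F (mkseq z n) x].

Lemma siftE s : sift s = \bigcup_i sift (rcons s i).
Proof.
apply/seteqP; split=> [x [z zs h]|x [i _ [z /cyl_rcons[zs _] h]]]; last by exists z.
by exists (z (size s)) => //; exists z => //; apply/cyl_rcons.
Qed.

(** A node carries a Souslin address besides its closed set. The address must grow along every
    branch, as this is what will put the limit point into the given Borel set. *)
Definition large (N : seq nat * set X) : Prop :=
  closed N.2 /\ ~ cc (sift N.1 `&` N.2).

(** Near a kernel point the node stays outside the ideal, and [siftE] splits it into countably many
    parts, one of which must therefore be outside the ideal as well. *)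
Lemma child_exists (N : seq nat * set X) U y : large N -> open U ->
  kernel_of P (sift N.1 `&` N.2) y -> U y ->
  exists j C, large (rcons N.1 j, C) /\ C `<=` U `&` N.2.
Proof.
case: N => s C /= [/= cC _] oU [_ ky] Uy.
have [e e0 eU] := open_cball_sub dX oU Uy.
have nc : ~ cc (sift s `&` (cball dist y e `&` C)).
  move=> h; apply: (ky (dball dist y e)); first exact: open_dball.
    by rewrite /dball/= (distxx dX).
  by apply: covered_sub h => x [[sx Cx] /ltW yx].
have [j nj] : exists j, ~ cc (sift (rcons s j) `&` (cball dist y e `&` C)).
  apply: contrapT => h; apply: nc; rewrite siftE setI_bigcupl.
  by apply: covered_bigcup => j; apply: contrapT => nj; apply: h; exists j.
exists j, (cball dist y e `&` C); split; first split=> //=.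
  by apply: closedI => //; exact: closed_cball.
by move=> x [/eU].
Qed.

Let inv (n : nat) : R := n.+1%:R^-1.

Let inv_gt0 n : 0 < inv n. Proof. by rewrite invr_gt0. Qed.

(** Child [i] is tied to the level [i] piece with index [addr i i], at distance at most
    [1 / (i + 1)]. Since addresses are coherent, children whose address at level [n] is [e] can
    accumulate on the scheme only in [K n e]. *)
Definition child_spec (s : seq nat) (N : seq nat * set X)
    (K : nat -> nat -> set X) i (M : seq nat * set X) : Prop :=
  [/\ large M, (exists j, M.1 = rcons N.1 j), M.2 `<=` N.2 `\` K 0%N 0%N,
      fine (rcons s i) M.2 &
      (forall y y', M.2 y -> M.2 y' -> dist y y' <= inv (size s)) /\
      forall y, M.2 y -> exists2 z, K i (addr i i) z & dist y z <= inv i].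

(** The scheme is placed in the closure of the kernel, so that points of the kernel, where children
    can be grown, lie near every point of the scheme. The children are then chosen one after
    another. *)
Lemma children_exist s N : large N -> exists (K : nat -> nat -> set X) ch,
  [/\ good K, K 0%N 0%N `<=` N.2, forall i, child_spec s N K i (ch i) &
      forall i j, i <> j -> (ch i).2 `&` (ch j).2 = set0].
Proof.
move=> lN; have [cN nN] := lN.
set V := sift N.1 `&` N.2.
have VN : closure (kernel_of P V) `<=` N.2.
  by rewrite (closure_id N.2).1//; apply: closureS => x [[]].
have [||K [gK cK KY Kn Knd]] := goodP (Y := closure (kernel_of P V)).
- exact: closed_closure.
- by move=> h; apply: (kernel_of_large dX cX nN); apply: covered_sub h; exact: subset_closure.
(* Here [Q] stands for the union of the earlier children. It is closed and misses the root, so a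
   point [z] of the prescribed piece has a neighbourhood off [Q]; nowhere density gives a point of
   the closed kernel off the root there, and then a kernel point. *)
have next i (Q : set X) : closed Q -> Q `&` K 0%N 0%N = set0 ->
    exists M, child_spec s N K i M /\ M.2 `&` Q = set0.
  move=> cQ QK.
  have [[z Kz] KK] := Kn i (addr i i) (addr_lt i i).
  pose U := dball dist z (inv i / 2) `\` Q.
  have oU : open U.
    by apply: openI; [exact: open_dball|exact: closed_openC].
  have Uz : U z.
    split; first by rewrite /dball/= (distxx dX) divr_gt0.
    by move=> Qz; suff : (Q `&` K 0%N 0%N) z; [rewrite QK|split=> //; exact: KK].
  have [|y0 [[Uy0 Yy0] nK0]] := Knd U oU; first by exists z; split=> //; exact/KY/KK.
  have oUK : open (U `\` K 0%N 0%N) by apply: openI => //; exact: closed_openC.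
  have [|y [ky [Uy nKy]]] := Yy0 (U `\` K 0%N 0%N).
    exact: open_nbhs_nbhs.
  have [r r0 fr] := fineP (rcons s i) y.
  pose r1 := Num.min r (Num.min (inv i / 2) (inv (size s) / 2)).
  have r10 : 0 < r1 by rewrite !lt_min r0 !divr_gt0.
  have yr1 : dball dist y r1 y by rewrite /dball/= (distxx dX).
  have [j [C [lC CU]]] := @child_exists N ((U `\` K 0%N 0%N) `&` dball dist y r1) y
    lN (openI oUK (open_dball dX _ _)) ky (conj (conj Uy nKy) yr1).
  exists (rcons N.1 j, C); split; last first.
    by apply/seteqP; split=> // x [/CU[[[[_ nQ]]]]].
  split=> //.
  - by exists j.
  - by move=> x /CU[[[_ nK] _] Nx]; split.
  - apply: fr => x /CU[[_ +] _]; rewrite /dball/= => /lt_le_trans; apply.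
    by rewrite ge_min lexx.
  split=> [x x' /CU[[_ yx] _] /CU[[_ yx'] _]|x /CU[[[[zx _] _] _] _]].
    move: yx yx'; rewrite /dball/= !lt_min.
    move=> /andP[_ /andP[_ yx]] /andP[_ /andP[_ yx']].
    have := dist_triangle dX y x x'; rewrite (distC dX x y).
    by move: yx yx'; set r2 := inv _; lra.
  exists z => //; move: zx; rewrite /dball/= (distC dX z).
  by have := inv_gt0 i; lra.
have /choice[f fP] : forall iQ : nat * set X, exists M, closed iQ.2 ->
    iQ.2 `&` K 0%N 0%N = set0 -> child_spec s N K iQ.1 M /\ M.2 `&` iQ.2 = set0.
  move=> [i Q] /=; have [cQ|nQ] := pselect (closed Q); last by exists N.
  have [QK|nQK] := pselect (Q `&` K 0%N 0%N = set0); last by exists N.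
  by have [M MP] := next i Q cQ QK; exists M.
pose Q := fix Q i : set X := if i is j.+1 then Q j `|` (f (j, Q j)).2 else set0.
have QP i : closed (Q i) /\ Q i `&` K 0%N 0%N = set0.
  elim: i => [|i [cQ QK]] /=; first by rewrite set0I; split=> //; exact: closed0.
  have [[[cM _] _ MK _ _] _] := fP (i, Q i) cQ QK.
  split; first exact: closedU.
  by apply/seteqP; split=> // x [[Qx|/MK[]//] Kx]; rewrite -QK.
have fQ i := fP (i, Q i) (QP i).1 (QP i).2.
exists K, (fun i => f (i, Q i)); split=> //.
- by move=> x /KY/VN.
- by move=> i; have [] := fQ i.
move=> i j ij; wlog ltij : i j ij / (i < j)%N => [h|].
  have [lt|gt|//] := ltngtP i j; first exact: h.
  by rewrite setIC; apply: h => //; exact: nesym.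
have QQ : (f (i, Q i)).2 `<=` Q j.
  elim: j ltij {ij} => // j IH; rewrite ltnS leq_eqVlt => /predU1P[<-|/IH h] x fx /=.
    by right.
  by left; exact: h.
apply/seteqP; split=> // x [/QQ Qx fx].
by have [_ <-] := fQ j; split.
Qed.

Hypothesis FB : ~ cc (sift [::]).

Lemma construction : exists (C : seq nat -> set X)
    (K : seq nat -> nat -> nat -> set X) (g : (nat -> nat) -> X),
  [/\ forall s, closed (C s) /\ forall i, C (rcons s i) `<=` C s,
      forall s i j, i <> j -> C (rcons s i) `&` C (rcons s j) = set0,
      forall s, [/\ good (K s), K s 0%N 0%N `<=` C s &
        forall i, C (rcons s i) `&` K s 0%N 0%N = set0],
      forall s i, [/\ fine (rcons s i) (C (rcons s i)),
        forall y y', C (rcons s i) y -> C (rcons s i) y' ->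
          dist y y' <= inv (size s) &
        forall y, C (rcons s i) y ->
          exists2 z, K s i (addr i i) z & dist y z <= inv i] &
      (forall x n, C (mkseq x n) (g x)) /\ forall x, sift [::] (g x)].
Proof.
have /choice[f fP] : forall sN : seq nat * (seq nat * set X),
    exists Kc : (nat -> nat -> set X) * (nat -> seq nat * set X), large sN.2 ->
    [/\ good Kc.1, Kc.1 0%N 0%N `<=` sN.2.2,
        forall i, child_spec sN.1 sN.2 Kc.1 i (Kc.2 i) &
        forall i j, i <> j -> (Kc.2 i).2 `&` (Kc.2 j).2 = set0].
  move=> [s N] /=; have [lN|nN] := pselect (large N).
    by have [K [ch h]] := children_exist s lN; exists (K, ch).
  by exists ((fun _ _ => set0), (fun _ => N)).
pose go (sN : seq nat * (seq nat * set X)) i := (rcons sN.1 i, (f sN).2 i).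
pose node s := foldl go ([::], ([::], setT)) s.
have nodeS s i : node (rcons s i) = go (node s) i by rewrite /node foldl_rcons.
have node1 s : (node s).1 = s.
  by elim/last_ind: s => // s i IH; rewrite nodeS /go /= IH.
have nodeL s : large (node s).2.
  elim/last_ind: s => [|s i /fP[_ _ /(_ i)[h _ _ _ _] _]]; last by rewrite nodeS.
  by split; [exact: closedT|rewrite setIT].
pose C s := (node s).2.2; pose K s := (f (node s)).1.
have CS s i : C (rcons s i) = ((f (node s)).2 i).2 by rewrite /C nodeS.
have sC x n : sift (node (mkseq x n)).2.1 `&` C (mkseq x n) !=set0.
  by apply: (@covered_cond _ P); case: (nodeL (mkseq x n)).
have CC s i : C (rcons s i) `<=` C s.
  by rewrite CS; have [_ _ /(_ i)[_ _ h _ _] _] := fP _ (nodeL s) => y /h[].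
have Cle x m n : (m <= n)%N -> C (mkseq x n) `<=` C (mkseq x m).
  move=> /subnKC <-; elim: (n - m)%N => [|k IH]; first by rewrite addn0.
  by rewrite addnS mkseqS; exact: subset_trans (CC _ _) IH.
have clC s : closed (C s) by case: (nodeL s).
have /choice[g gP] : forall x, exists y, forall n, C (mkseq x n) y.
  move=> x; have [|n|n|y yC] := nested_nonempty cX (F := fun n => C (mkseq x n)).
  - by move=> n; exact: clC.
  - by rewrite mkseqS; exact: CC.
  - by have [y [_ ?]] := sC x n; exists y.
  - by exists y => n; exact: yC.
exists C, K, g; split.
- by move=> s; split.
- by move=> s i j ij; rewrite !CS; have [_ _ _] := fP _ (nodeL s); apply.
- move=> s; have [gK KC ch _] := fP _ (nodeL s); split=> // i; rewrite CS.
  have [_ _ h _ _] := ch i.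
  by apply/seteqP; split=> // y [/h[]].
- move=> s i; rewrite CS; have [_ _ /(_ i)[_ _ _ h [h1 h2]] _] := fP _ (nodeL s).
  by move: h h1; rewrite node1; split.
split=> // x; pose t n := (node (mkseq x n)).2.1.
have tS n : exists j, t n.+1 = rcons (t n) j.
  rewrite /t mkseqS nodeS /=.
  by have [_ _ /(_ (x n))[_ h _ _ _] _] := fP _ (nodeL (mkseq x n)).
have size_t n : size (t n) = n.
  by elim: n => // n IH; have [j ->] := tS n; rewrite size_rcons IH.
have [z zt] : exists z, forall n, mkseq z (size (t n)) = t n.
  apply: (chain_limit 0%N) => n; last by rewrite size_t.
  by have [j ->] := tS n; exact: prefix_rcons.
(* Each [C] along the branch meets the sift of its address, hence contains a point of the [n]-th
   Souslin set arbitrarily near [g x]. The Souslin sets are closed. *)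
exists z => // n; apply/(closed_distP dX _).1 => // e e0.
have [m [nm me]] : exists m, (n <= m)%N /\ inv m < e.
  exists (n + Num.trunc e^-1)%N; split; first exact: leq_addr.
  rewrite /inv -[ltRHS]invrK ltf_pV2 ?posrE ?invr_gt0//.
  by apply: (lt_le_trans (truncnS_gt _)); rewrite ler_nat ltnS leq_addl.
have [y [[z' z't hy] Cy]] := sC x m.+1; exists y.
  have := hy n; congr (F _ y); apply: (@mkseq_eq_le _ _ _ m.+1); first exact: leqW.
  by move: (zt m.+1) z't; rewrite -/(t m.+1) /cyl/= size_t => -> ->.
apply: le_lt_trans me.
move: (Cy) (gP x m.+1); rewrite mkseqS CS.
have [_ _ /(_ (x m))[_ _ _ _ [h _]] _] := fP _ (nodeL (mkseq x m)).
by move=> Cy' Cg; have := h _ _ Cg Cy'; rewrite node1 size_mkseq.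
Qed.

End Construction.

(** * Nonatomic measures and Cantor schemes *)

Section FiniteBorelMeasures.
Context (R : realType) (X : ptopologicalType) (dist : X -> X -> R).
Hypotheses (dX : metrizes dist) (cX : compact [set: X]).
Local Notation mX := (g_sigma_algebraType (@open X)).
Context (mu : {measure set mX -> \bar R}).
Local Open Scope ereal_scope.
Local Notation mble := (measurable : set (set mX)).

Lemma open_mble (U : set X) : open U -> mble U.
Proof. exact: sub_sigma_algebra. Qed.

Lemma closed_mble (F : set X) : closed F -> mble F.
Proof. by move=> /closed_openC/open_mble/measurableC; rewrite setCK. Qed.

Lemma mu_le (A B : set mX) : mble A -> mble B -> A `<=` B -> mu A <= mu B.
Proof. by move=> mA mB AB; apply: le_measure; rewrite ?inE. Qed.

Lemma mu_fin (A : set mX) : mu A < +oo -> mu A = (fine (mu A))%:E.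
Proof. by move=> Aoo; rewrite fineK// ge0_fin_numE. Qed.

Lemma mu_setDI (A B : set mX) : mble A -> mble B -> mu A = mu (A `\` B) + mu (A `&` B).
Proof. exact: measureDI. Qed.

Lemma mu_decreasing_lt (F : nat -> set mX) (c : \bar R) : mu (F 0%N) < +oo ->
  (forall n, mble (F n)) -> (forall n, F n.+1 `<=` F n) ->
  mu (\bigcap_n F n) < c -> exists n, mu (F n) < c.
Proof.
move=> F0 mF Fs Fc.
have niF : nonincreasing_seq F.
  by apply/nonincreasing_seqP => n; apply/subsetPset.
have := nonincreasing_cvg_mu F0 mF (bigcapT_measurable mF) niF.
move=> /(_ [set x | x < c] (open_ereal_lt' Fc))[n _ /(_ n (leqnn n)) Fn].
by exists n.
Qed.

Lemma mu_bigcup_le (F : nat -> set mX) (A : set mX) : (forall n, mble (F n)) ->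
  mble A -> A `<=` \bigcup_n F n -> mu A <= \sum_(0 <= n <oo) mu (F n).
Proof. exact: measure_sigma_subadditive. Qed.

(** The measure may be infinite on every open set, so regularity is localised to a set [E] of finite
    measure, where continuity from above applies. *)
Lemma borel_regular (E : set mX) : mble E -> mu E < +oo -> forall A, mble A ->
  forall e : R, (0 < e)%R -> exists F U : set X,
  [/\ closed F, open U, F `<=` A, A `<=` U & mu (E `&` (U `\` F)) < e%:E].
Proof.
move=> mE Eoo; have Ele (B : set mX) : mble B -> mu (E `&` B) < +oo.
  by move=> mB; apply: le_lt_trans Eoo; apply: mu_le => //; exact: measurableI.
apply: g_sigma_ind => [U oU e e0||A IH e /IH|A IH e e0].
- have [F [cF UF]] := open_Fsigma dX oU.
  have cFn n : closed (\bigcup_(i in `I_n) F i).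
    by apply: closed_bigcup => // i _; exact: cF.
  pose D n : set mX := E `&` (U `\` \bigcup_(i in `I_n) F i).
  have mD n : mble (D n).
    apply: measurableI => //; apply: measurableD; first exact: open_mble.
    exact: closed_mble.
  have [|//|n x [Ex [Ux nF]]||n Dn] := @mu_decreasing_lt D e%:E.
  + by apply: Ele; apply: measurableD; [exact: open_mble|exact: closed_mble].
  + split=> //; split=> // -[i /= i_n Fi]; apply: nF; exists i => //=.
    by rewrite (ltn_trans i_n).
  + rewrite (_ : \bigcap_n D n = set0) ?measure0 ?lte_fin//.
    apply/seteqP; split=> // x xD.
    have [_ [+ _]] := xD 0%N Logic.I; rewrite {1}UF => -[i _ Fi].
    have [_ [_]] := xD i.+1 Logic.I; apply; exists i => //=.
  exists (\bigcup_(i in `I_n) F i), U; split=> //.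
  by rewrite UF => x [i _ Fi]; exists i.
- move=> e e0; exists set0, set0; split=> //; [exact: closed0|exact: open0|].
  by rewrite setD0 setI0 measure0 lte_fin.
- move=> [F [U [cF oU FA AU h]]].
  exists (~` U), (~` F); split; [exact: open_closedC|exact: closed_openC| | |].
  + exact: subsetC.
  + exact: subsetC.
  + by rewrite setDE setCK setIC [~` F `&` _]setIC -setDE setIC.
(* Half of [e] pays for all approximations. The rest is the margin for truncating the union of the
   closed sets, since only finite unions of them are known to be closed. *)
have /choice[F /choice[U FU]] : forall n, exists F U : set X,
    [/\ closed F, open U, F `<=` A n, A n `<=` U &
      mu (E `&` (U `\` F)) < (e / 2 / (2 ^ n.+1)%:R)%:E].
  by move=> n; apply: IH; rewrite !divr_gt0// ltr0n expn_gt0.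
have oU : open (\bigcup_n U n) by apply: bigcup_open => n _; case: (FU n).
have cFn n : closed (\bigcup_(i in `I_n) F i).
  by apply: closed_bigcup => // i _; case: (FU i).
pose D n : set mX := E `&` (\bigcup_i U i `\` \bigcup_(i in `I_n) F i).
have mD n : mble (D n).
  apply: measurableI => //; apply: measurableD; first exact: open_mble.
  exact: closed_mble.
have mUF n : mble (E `&` (U n `\` F n)).
  apply: measurableI => //; have [cF oUn _ _ _] := FU n.
  by apply: measurableD; [exact: open_mble|exact: closed_mble].
have [|//|n x [Ex [Ux nF]]||n Dn] := @mu_decreasing_lt D e%:E.
- by apply: Ele; apply: measurableD; [exact: open_mble|exact: closed_mble].
- split=> //; split=> // -[i /= i_n Fi]; apply: nF; exists i => //=.
  by rewrite (ltn_trans i_n).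
- apply: (@le_lt_trans _ _ (e / 2)%:E); last by rewrite lte_fin; lra.
  apply: (le_trans (@mu_bigcup_le (fun n => E `&` (U n `\` F n)) _ mUF _ _)).
  + exact: bigcapT_measurable.
  + move=> x xD; have [Ex [[i _ Ux] _]] := xD 0%N Logic.I.
    exists i => //; split=> //; split=> // Fx.
    have [_ [_]] := xD i.+1 Logic.I; apply; exists i => //=.
  apply: (le_trans _ (epsilon_trick0 xpredT _)); last by rewrite divr_ge0// ltW.
  apply: lee_nneseries => // n _.
  by have [_ _ _ _ /ltW] := FU n.
exists (\bigcup_(i in `I_n) F i), (\bigcup_i U i); split=> //.
  by move=> x [i _ Fi]; exists i => //; have [_ _ h _ _] := FU i; exact: h.
by move=> x [i _ Ai]; exists i => //; have [_ _ _ h _] := FU i; exact: h.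
Qed.

Lemma inner_closed (A : set mX) (t : R) : mble A -> mu A < +oo -> t%:E < mu A ->
  exists F : set X, [/\ closed F, F `<=` A & t%:E < mu F].
Proof.
move=> mA Aoo tA; rewrite (mu_fin Aoo) lte_fin in tA.
have e0 : (0 < fine (mu A) - t)%R by rewrite subr_gt0.
have [F [U [cF oU FA AU h]]] := borel_regular mA Aoo mA e0.
exists F; split=> //; have mF := closed_mble cF.
have Foo : mu F < +oo by apply: le_lt_trans Aoo; exact: mu_le.
have hA : mu (A `\` F) < (fine (mu A) - t)%:E.
  apply: le_lt_trans h; apply: mu_le.
  - exact: measurableD.
  - by apply: measurableI => //; apply: measurableD => //; exact: open_mble.
  - by move=> x [Ax nF]; split=> //; split=> //; exact: AU.
have := mu_setDI mA mF; rewrite setIidr//.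
have DAoo : mu (A `\` F) < +oo by apply: lt_trans hA _; rewrite ltry.
move: hA; rewrite (mu_fin Aoo) (mu_fin DAoo) (mu_fin Foo).
by rewrite -EFinD lte_fin => h1 [h2]; rewrite lte_fin; lra.
Qed.

End FiniteBorelMeasures.

Section Splitting.
Context (R : realType) (X : ptopologicalType) (dist : X -> X -> R).
Hypotheses (dX : metrizes dist) (cX : compact [set: X]).
Local Notation mX := (g_sigma_algebraType (@open X)).
Context (mu : {measure set mX -> \bar R}).
Hypothesis mu0 : forall x, mu [set x] = 0%E.
Local Open Scope ereal_scope.
Local Notation mble := (measurable : set (set mX)).

Lemma small_ball (E : set mX) (x : X) (e : R) : mble E -> mu E < +oo ->
  (0 < e)%R -> exists2 r : R, (0 < r)%R & mu (dball dist x r `&` E) < e%:E.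
Proof.
move=> mE Eoo e0; pose F n : set mX := dball dist x n.+1%:R^-1 `&` E.
have mF n : mble (F n).
  by apply: measurableI => //; apply: open_mble; exact: open_dball.
have [|//|n y [yx Ey]||n Fn] := @mu_decreasing_lt _ _ mu F e%:E.
- by apply: le_lt_trans Eoo; apply: mu_le => // y [].
- split=> //; move: yx; rewrite /dball/= => /lt_trans; apply.
  by rewrite ltf_pV2 ?posrE// ltr_nat.
- apply: (@le_lt_trans _ _ (mu [set x])); last by rewrite mu0 lte_fin.
  apply: mu_le; [exact: bigcapT_measurable|by apply: closed_mble; exact: (closed_sing dX)|].
  move=> y h; apply/esym/(dist_eq0 dX); rewrite leNgt; apply/negP => xy.
  have [+ _] := h (Num.trunc (dist x y)^-1) Logic.I; rewrite /dball/=.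
  rewrite -[ltLHS]invrK ltf_pV2 ?posrE ?invr_gt0//.
  by rewrite ltNge ltW// truncnS_gt.
- by exists n.+1%:R^-1%R.
Qed.

(** Finitely many balls, each meeting [C] in measure less than [e], cover the space. They are
    removed one by one until the measure drops to at most [t + e]; a single removal from above
    [t + e] cannot fall to [t]. *)
Lemma closed_trim (C : set X) (t e : R) : closed C -> mu C < +oo ->
  (0 <= t)%R -> t%:E < mu C -> (0 < e)%R ->
  exists C' : set X, [/\ closed C', C' `<=` C, t%:E < mu C' & mu C' <= (t + e)%:E].
Proof.
move=> cC Coo t0 tC e0.
have /choice[r rP] : forall x, exists r : R, (0 < r)%R /\ mu (dball dist x r `&` C) < e%:E.
  move=> x; have [r r0 rC] := small_ball x (closed_mble cC) Coo e0.
  by exists r.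
move: (cX); rewrite compact_cover => /(_ X setT (fun x => dball dist x (r x))) [||D _ DX].
- by move=> x _; exact: open_dball.
- by move=> x _; exists x => //; rewrite /dball/= (distxx dX); case: (rP x).
suff H (s : seq X) (C' : set X) : closed C' -> t%:E < mu C' -> C' `<=` C ->
    (forall y, C' y -> exists2 x, x \in s & dball dist x (r x) y) ->
    exists C'' : set X, [/\ closed C'', C'' `<=` C', t%:E < mu C'' &
      mu C'' <= (t + e)%:E].
  apply: (H (finmap.enum_fset D)) => // y _.
  by have [x xD xy] := DX y Logic.I; exists x.
elim: s C' => [|x s IH] C' cC' tC' C'C C's.
  have C'0 : C' = set0 by apply/seteqP; split=> // y C'y; have [x] := C's y C'y; rewrite in_nil.
  by move: tC'; rewrite C'0 measure0 lte_fin; lra.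
have [C't|tC'e] := leP (mu C') (t + e)%:E; first by exists C'; split.
have mB : mble (dball dist x (r x)) by apply: open_mble; exact: open_dball.
have mC' := closed_mble cC'.
have C'oo : mu C' < +oo.
  by apply: le_lt_trans Coo; apply: mu_le => //; exact: closed_mble.
have cD : closed (C' `\` dball dist x (r x)).
  by apply: closedI => //; apply: open_closedC; exact: open_dball.
have [|||C'' [cC'' C''C' h1 h2]] := IH _ cD; last first.
- by exists C''; split=> // y /C''C'[].
- move=> y [/C's[x' + x'y] nxy]; rewrite inE => /predU1P[x'x|x's]; last by exists x'.
  by move: nxy; rewrite -x'x.
- by move=> y [/C'C].
- have h1 : mu (C' `&` dball dist x (r x)) < e%:E.
    apply: le_lt_trans (rP x).2; apply: mu_le.
    + exact: measurableI.
    + by apply: measurableI => //; exact: closed_mble.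
    + by move=> y [/C'C Cy xy]; split.
  have h2 := mu_setDI mu mC' mB.
  have I1 : mu (C' `&` dball dist x (r x)) < +oo by apply: lt_trans h1 _; rewrite ltry.
  have I2 : mu (C' `\` dball dist x (r x)) < +oo.
    by apply: le_lt_trans C'oo; apply: mu_le => //; exact: measurableD.
  move: h1 h2 tC'e; rewrite (mu_fin I1) (mu_fin I2) (mu_fin C'oo) -EFinD !lte_fin.
  by move=> h1 [h2]; lra.
Qed.

(** Trimming with tolerances [1 / (n + 1)] gives a decreasing sequence of closed sets of measure
    above [t]; continuity from above makes the measure of the intersection exactly [t]. *)
Lemma closed_exact (A : set mX) (t : R) : mble A -> mu A < +oo -> (0 <= t)%R ->
  t%:E < mu A -> exists F : set X, [/\ closed F, F `<=` A & mu F = t%:E].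
Proof.
move=> mA Aoo t0 tA; have [F0 [cF0 F0A tF0]] := inner_closed dX mA Aoo tA.
have F0oo : mu F0 < +oo.
  by apply: le_lt_trans Aoo; apply: mu_le => //; exact: closed_mble.
pose ok C := [/\ closed C, C `<=` A & t%:E < mu C].
have /choice[f fP] : forall nC : nat * set X, exists C', ok nC.2 ->
    [/\ ok C', C' `<=` nC.2 & mu C' <= (t + nC.1.+1%:R^-1)%:E].
  move=> [n C] /=; have [[cC CA tC]|nok] := pselect (ok C); last by exists C.
  have Coo : mu C < +oo.
    by apply: le_lt_trans Aoo; apply: mu_le => //; exact: closed_mble.
  have n0 : (0 < n.+1%:R^-1 :> R)%R by [].
  have [C' [cC' C'C tC' C't]] := closed_trim cC Coo t0 tC n0.
  by exists C' => _; split=> //; split=> // x /C'C/CA.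
pose F := fix F n := if n is m.+1 then f (m, F m) else F0.
have okF n : ok (F n) by elim: n => // n IH; have [] := fP (n, F n) IH.
have FS n : F n.+1 `<=` F n by have [] := fP (n, F n) (okF n).
have mF n : mble (F n) by apply: closed_mble; case: (okF n).
have mI : mble (\bigcap_n F n) by exact: bigcapT_measurable.
exists (\bigcap_n F n); split.
- by apply: closed_bigI => n _; case: (okF n).
- by move=> x /(_ 0%N Logic.I); exact: F0A.
apply: le_anti; apply/andP; split; last first.
  rewrite leNgt; apply/negP => It.
  have [n] := mu_decreasing_lt (F0oo : mu (F 0%N) < +oo) mF FS It.
  by have [_ _ /lt_trans h] := okF n => /h; rewrite ltxx.
apply/lee_addgt0Pr => e e0.
have [n ne] : exists n : nat, (n.+1%:R^-1 < e)%R.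
  exists (Num.trunc e^-1); rewrite -[ltRHS]invrK ltf_pV2 ?posrE ?invr_gt0//.
  exact: truncnS_gt.
apply: (@le_trans _ _ (mu (F n.+1))).
  by apply: mu_le => // x; apply.
have [_ _ /le_trans] := fP (n, F n) (okF n); apply.
by rewrite -EFinD lee_fin lerD2l ltW.
Qed.

(** Pigeonhole: as long as more than [m * d] is left, one of the [m] balls of a finite net carries
    more than [d]. What matters is that [m] depends on [e] only, so the waste [m * d] becomes
    negligible when [N] grows with [N * d] fixed. *)
Lemma extract (e : R) : (0 < e)%R -> exists m : nat, forall (E : set mX) N (d : R),
  mble E -> mu E < +oo -> (0 < d)%R -> ((N + m)%:R * d)%:E < mu E ->
  exists f : nat -> set X, [/\ forall i, (i < N)%N ->
      [/\ closed (f i), f i `<=` E, mu (f i) = d%:E &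
        forall x y, f i x -> f i y -> (dist x y <= e)%R] &
    forall i j, (i < N)%N -> (j < N)%N -> i <> j -> f i `&` f j = set0].
Proof.
move=> e0; have e20 : (0 < e / 2)%R by rewrite divr_gt0.
have [s sX] := finite_net dX cX e20; exists (size s).
have piece (E : set mX) (d : R) : mble E -> mu E < +oo -> (0 < d)%R ->
    ((size s)%:R * d)%:E < mu E -> exists C : set X, [/\ closed C, C `<=` E,
      mu C = d%:E & forall x y, C x -> C y -> (dist x y <= e)%R].
  move=> mE Eoo d0 sE.
  have [y dE] : exists y, d%:E < mu (E `&` dball dist y (e / 2)).
    apply: contrapT => h; move: sE; apply/negP; rewrite -leNgt.
    suff H (u : seq X) (E' : set mX) : mble E' -> E' `<=` E ->
        (forall x, E' x -> exists2 y, y \in u & dball dist y (e / 2) x) ->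
        mu E' <= ((size u)%:R * d)%:E.
      by apply: H => // x _; exact: sX.
    elim: u E' => [|y u IH] E' mE' E'E E's.
      rewrite mul0r (_ : E' = set0) ?measure0//.
      by apply/seteqP; split=> // x E'x; have [y] := E's x E'x; rewrite in_nil.
    have mB : mble (dball dist y (e / 2)) by apply: open_mble; exact: open_dball.
    rewrite (mu_setDI mu mE' mB) /= -[(size u).+1%:R]natr1 mulrDl mul1r EFinD leeD//.
      apply: IH; [exact: measurableD|by move=> x [/E'E]|].
      move=> x [/E's[z + zx] nx]; rewrite inE => /predU1P[zy|zs]; last by exists z.
      by move: nx; rewrite -zy.
    apply: (@le_trans _ _ (mu (E `&` dball dist y (e / 2)))).
      apply: mu_le; [exact: measurableI|exact: measurableI|].
      by move=> x [/E'E Ex Bx]; split.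
    by rewrite leNgt; apply/negP => ?; apply: h; exists y.
  have mEB : mble (E `&` dball dist y (e / 2)).
    by apply: measurableI => //; apply: open_mble; exact: open_dball.
  have EBoo : mu (E `&` dball dist y (e / 2)) < +oo.
    by apply: le_lt_trans Eoo; apply: mu_le => // x [].
  have [C [cC CE Cd]] := closed_exact mEB EBoo (ltW d0) dE.
  exists C; split=> // [x /CE[]//|x x' /CE[_ yx] /CE[_ yx']].
  have := dist_triangle dX y x x'; rewrite (distC dX x y).
  by move: yx yx'; rewrite /dball/=; lra.
move=> E N d; elim: N E => [|N IH] E mE Eoo d0 NE; first by exists (fun=> set0).
have sE : ((size s)%:R * d)%:E < mu E.
  by apply: le_lt_trans NE; rewrite lee_fin ler_pM2r// ler_nat leq_addl.
have [C [cC CE Cd Ce]] := piece E d mE Eoo d0 sE.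
have mC := closed_mble cC.
have D1 : mu (E `\` C) < +oo.
  by apply: le_lt_trans Eoo; apply: mu_le => //; exact: measurableD.
have [|f [fP ff]] := IH (E `\` C) (measurableD mE mC) D1 d0.
  have := mu_setDI mu mE mC; rewrite setIidr// Cd.
  move: NE; rewrite (mu_fin D1) (mu_fin Eoo) -EFinD addSn -natr1 !lte_fin.
  by move=> h1 [h2]; move: h1; rewrite h2 mulrDl mul1r ltrD2r.
exists (fun i => if i is j.+1 then f j else C); split.
  case=> [|i] iN; first by split.
  by have [cf fE fd fe] := fP i iN; split=> // x /fE[].
have Cf i : (i < N)%N -> C `&` f i = set0.
  by move=> iN; apply/seteqP; split=> // x [Cx fx]; have [_ /(_ x fx)[]] := fP i iN.
move=> [|i] [|j] // iN jN ij.
- exact: Cf.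
- by rewrite setIC; exact: Cf.
- by apply: ff => // ij'; rewrite ij' in ij.
Qed.

End Splitting.

Section CantorScheme.
Context (R : realType) (X : ptopologicalType) (dist : X -> X -> R).
Local Notation mX := (g_sigma_algebraType (@open X)).
Context (mu : {measure set mX -> \bar R}).

(* Only the indices [e < 2 ^ n] matter; [e %/ 2] is the parent of [e]. *)
Definition cantor_scheme (a : R) (K : nat -> nat -> set X) : Prop :=
  [/\ forall n e, closed (K n e),
      forall n e, K n.+1 e `<=` K n (e %/ 2)%N,
      forall n e e', e <> e' -> K n e `&` K n e' = set0,
      forall r : R, 0 < r ->
        exists n, forall e x y, K n e x -> K n e y -> dist x y <= r &
      forall n e, (e < 2 ^ n)%N ->
        ((a / 2 ^+ n)%:E <= mu (K n e))%E /\
        (mu (K n e) <= (2 * a / 2 ^+ n)%:E)%E].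

Hypotheses (dX : metrizes dist) (cX : compact [set: X]).
Hypothesis mu0 : forall x, mu [set x] = 0%E.
Context (E : set mX) (a : R).
Hypotheses (mE : measurable E) (Eoo : (mu E < +oo)%E) (a0 : 0 < a)
  (aE : ((2 * a)%:E < mu E)%E).

(** The mass budget falls strictly from [2 * a] towards [a]; the drop at each stage absorbs the
    waste of [extract]. *)
Let M (k : nat) : R := a * (1 + 2^-1 ^+ k).

Let M_ge k : a <= M k.
Proof. by rewrite /M mulrDr mulr1 lerDl mulr_ge0// ?exprn_ge0// ltW. Qed.

Let M_le k : M k <= 2 * a.
Proof.
rewrite /M mulrC ler_wpM2r// ?(ltW a0)//.
have : (2^-1 : R) ^+ k <= 1 by rewrite exprn_ile1//; lra.
lra.
Qed.

Let MS k : M k.+1 < M k.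
Proof.
rewrite /M ltr_pM2l// ltrD2l exprS gtr_pMl ?exprn_gt0//; lra.
Qed.

Definition stage (k : nat) (S : nat * (nat -> set X)) : Prop :=
  [/\ forall i, (i < 2 ^ S.1)%N -> closed (S.2 i) /\ S.2 i `<=` E,
      forall i, (i < 2 ^ S.1)%N -> mu (S.2 i) = (M k / 2 ^+ S.1)%:E,
      forall i j, (i < 2 ^ S.1)%N -> (j < 2 ^ S.1)%N -> i <> j ->
        S.2 i `&` S.2 j = set0 &
      forall i x y, (0 < k)%N -> (i < 2 ^ S.1)%N -> S.2 i x -> S.2 i y ->
        dist x y <= k%:R^-1].

Lemma stage0 : exists S, stage 0 S.
Proof.
have [|F [cF FE Fa]] := closed_exact dX cX mu0 mE Eoo _ aE.
  by rewrite mulr_ge0// ltW.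
exists (0%N, fun=> F); split=> //= [i _|[|i] [|j]//].
by rewrite Fa /M expr0 expr0 divr1; congr (_ %:E); lra.
Qed.

Lemma stageS k S : stage k S -> exists S', [/\ stage k.+1 S', (S.1 < S'.1)%N &
  forall i, (i < 2 ^ S'.1)%N -> S'.2 i `<=` S.2 (i %/ 2 ^ (S'.1 - S.1))%N].
Proof.
case: S => n f [/= cf mf ff _].
have k0 : 0 < k.+1%:R^-1 :> R by [].
have [m mP] := extract dX cX mu0 k0.
(* Many dyadic levels are passed at once: the loss of [m] pieces out of [2 ^ j.+1] has to fit into
   the drop of the budget. *)
have [j jm] : exists j, M k.+1 + m%:R * M k.+1 / 2 ^+ j.+1 < M k.
  have d0 : 0 < M k - M k.+1 by rewrite subr_gt0 MS.
  pose q := (M k - M k.+1)^-1 * (m%:R * M k.+1).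
  exists (Num.trunc q); rewrite -ltrBrDl.
  rewrite ltr_pdivrMr ?exprn_gt0// -ltr_pdivrMl//.
  apply: (lt_le_trans (truncnS_gt _)).
  by rewrite -natrX ler_nat ltnW// ltn_expl.
set J := j.+1 in jm; pose d : R := M k.+1 / 2 ^+ (n + J).
have M0 : 0 < M k.+1 by apply: lt_le_trans a0 _.
have d0 : 0 < d by rewrite divr_gt0// exprn_gt0.
have mfi i : (i < 2 ^ n)%N -> measurable (f i : set mX) /\ (mu (f i) < +oo)%E.
  move=> i_n; split; first by have [c _] := cf i i_n; exact: closed_mble.
  by rewrite mf// ltry.
have dE i : (i < 2 ^ n)%N -> (((2 ^ J + m)%:R * d)%:E < mu (f i))%E.
  move=> i_n; rewrite mf// lte_fin /d exprD natrD mulrDl natrX.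
  have p0 : 0 < (2 : R) ^+ n by rewrite exprn_gt0.
  have q0 : 0 < (2 : R) ^+ J by rewrite exprn_gt0.
  rewrite (_ : _ + _ = (M k.+1 + m%:R * M k.+1 / 2 ^+ J) / 2 ^+ n).
    by rewrite ltr_pM2r// invr_gt0.
  by field; rewrite !gt_eqF.
have /choice[p pP] : forall i, exists p : nat -> set X, (i < 2 ^ n)%N ->
  [/\ forall l, (l < 2 ^ J)%N ->
      [/\ closed (p l), p l `<=` f i, mu (p l) = d%:E &
        forall x y, p l x -> p l y -> dist x y <= k.+1%:R^-1] &
      forall l l', (l < 2 ^ J)%N -> (l' < 2 ^ J)%N -> l <> l' ->
        p l `&` p l' = set0].
  move=> i; have [i_n|] := ltnP i (2 ^ n); last by exists (fun=> set0).
  have [mi foo] := mfi i i_n.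
  by have [p pP] := mP _ (2 ^ J)%N d mi foo d0 (dE i i_n); exists p.
have divP x : (x < 2 ^ (n + J))%N -> (x %/ 2 ^ J < 2 ^ n)%N.
  by rewrite ltn_divLR ?expn_gt0// -expnD.
have modP x : (x %% 2 ^ J < 2 ^ J)%N by rewrite ltn_mod expn_gt0.
exists ((n + J)%N, fun x => p (x %/ 2 ^ J)%N (x %% 2 ^ J)%N).
split=> /=; last 2 first.
- by rewrite -{1}[n]addn0 ltn_add2l.
- move=> x xN; rewrite addKn.
  by have [/(_ _ (modP x))[_ + _ _] _] := pP _ (divP _ xN).
split=> /= [x xN|x xN|x y xN yN xy|x u v _ xN].
- have [/(_ _ (modP x))[c h _ _] _] := pP _ (divP _ xN); split=> //.
  by move=> z /h; have [_] := cf _ (divP _ xN); apply.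
- by have [/(_ _ (modP x))[_ _ h _] _] := pP _ (divP _ xN).
- have [qE|qN] := eqVneq (x %/ 2 ^ J)%N (y %/ 2 ^ J)%N.
    have [_] := pP _ (divP _ xN); rewrite -qE; apply=> // rE.
    by apply: xy; rewrite (divn_eq x (2 ^ J)) (divn_eq y (2 ^ J)) qE rE.
  apply/seteqP; split=> // z [zx zy].
  have [/(_ _ (modP x))[_ hx _ _] _] := pP _ (divP _ xN).
  have [/(_ _ (modP y))[_ hy _ _] _] := pP _ (divP _ yN).
  rewrite -(ff _ _ (divP _ xN) (divP _ yN)) /=; last exact/eqP.
  by split; [exact: hx|exact: hy].
- by have [/(_ _ (modP x))[_ _ _ h] _] := pP _ (divP _ xN); exact: h.
Qed.

(** Stage [k] lives at level [N k], which is at least [k] and skips levels. The missing levels are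
    filled in by grouping descendants, and equal measures within a stage make the groups equal
    too. *)
Lemma cantor_scheme_exists : exists K, cantor_scheme a K /\ K 0%N 0%N `<=` E.
Proof.
have [S0 S0P] := stage0.
have /choice[f fP] : forall kS : nat * (nat * (nat -> set X)), exists S',
    stage kS.1 kS.2 -> [/\ stage kS.1.+1 S', (kS.2.1 < S'.1)%N &
    forall i, (i < 2 ^ S'.1)%N ->
      S'.2 i `<=` kS.2.2 (i %/ 2 ^ (S'.1 - kS.2.1))%N].
  move=> [k S] /=; have [kS|nS] := pselect (stage k S); last by exists S.
  by have [S' h] := stageS kS; exists S'.
pose S := fix S k := if k is l.+1 then f (l, S l) else S0.
have SP k : stage k (S k) by elim: k => // k IH; have [] := fP (k, S k) IH.
pose N k := (S k).1; pose F k := (S k).2.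
have NS k : (N k < N k.+1)%N by have [] := fP (k, S k) (SP k).
have Nge k : (k <= N k)%N by elim: k => // k IH; exact: leq_ltn_trans IH (NS k).
have FS k x : (x < 2 ^ N k.+1)%N -> F k.+1 x `<=` F k (x %/ 2 ^ (N k.+1 - N k))%N.
  by have [_ _] := fP (k, S k) (SP k); apply.
have Nle k l : (k <= l)%N -> (N k <= N l)%N.
  move=> /subnKC <-; elim: (l - k)%N => [|i IH]; first by rewrite addn0.
  by rewrite addnS (leq_trans IH)// ltnW.
have div_lt k l x : (k <= l)%N -> (x < 2 ^ N l)%N ->
    (x %/ 2 ^ (N l - N k) < 2 ^ N k)%N.
  by move=> kl xl; rewrite ltn_divLR ?expn_gt0// -expnD subnKC// Nle.
have Fle k l x : (k <= l)%N -> (x < 2 ^ N l)%N ->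
    F l x `<=` F k (x %/ 2 ^ (N l - N k))%N.
  move=> kl; rewrite -(subnKC kl).
  elim: (l - k)%N x => [|i IH] x; first by rewrite addn0 subnn divn1 => _ y.
  rewrite addnS => xl y /(FS _ _ xl) /IH.
  rewrite -divnMA -expnD addnBA; last by rewrite Nle// leq_addr.
  rewrite subnK; last by rewrite ltnW.
  by apply; apply: (div_lt (k + i)%N) => //; rewrite addnS.
(* The union of the sets of stage [n] that descend from index [e] of level [n]; it is empty unless
   [e < 2 ^ n]. *)
pose K n e : set X := [set y | exists x, [/\ (x < 2 ^ N n)%N,
  (x %/ 2 ^ (N n - n) = e)%N & F n x y]].
have KE n e : (e < 2 ^ n)%N -> K n e = \big[setU/set0]_(j < 2 ^ (N n - n))
    F n (e * 2 ^ (N n - n) + j)%N.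
  move=> en; rewrite -(bigcup_mkord _ (fun j => F n (e * 2 ^ (N n - n) + j)%N)).
  apply/seteqP; split=> y.
    move=> [x [xN xe Fy]]; exists (x %% 2 ^ (N n - n))%N => /=.
      by rewrite ltn_mod expn_gt0.
    by rewrite -xe -divn_eq.
  move=> [j /= jN Fy]; exists (e * 2 ^ (N n - n) + j)%N; split=> //.
    rewrite -(subnKC (Nge n)) expnD addKn.
    apply: (@leq_trans (e.+1 * 2 ^ (N n - n))).
      by rewrite mulSn addnC ltn_add2r.
    by rewrite leq_pmul2r ?expn_gt0.
  by rewrite divnMDl ?expn_gt0// divn_small// addn0.
have idx n e j : (e < 2 ^ n)%N -> (j < 2 ^ (N n - n))%N ->
    (e * 2 ^ (N n - n) + j < 2 ^ N n)%N.
  move=> en jN; rewrite -(subnKC (Nge n)) expnD addKn.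
  apply: (@leq_trans (e.+1 * 2 ^ (N n - n))).
    by rewrite mulSn addnC ltn_add2r.
  by rewrite leq_pmul2r ?expn_gt0.
have K0 n e : ~ (e < 2 ^ n)%N -> K n e = set0.
  move=> en; apply/seteqP; split=> // y [x [xN xe _]]; apply: en.
  by rewrite -xe ltn_divLR ?expn_gt0// -expnD subnKC.
exists K; split; last first.
  move=> y [x [xN _ Fy]]; have [/(_ x xN)[_ h] _ _ _] := SP 0%N.
  exact: h.
split.
- move=> n e; have [en|] := ltnP e (2 ^ n); last first.
    by rewrite leqNgt => /negP/K0->; exact: closed0.
  rewrite KE//; apply: closed_bigsetU => j _.
  have [h _ _ _] := SP n.
  by have [] := h _ (idx _ _ _ en (ltn_ord j)).
- move=> n e y [x [xN xe Fy]]; exists (x %/ 2 ^ (N n.+1 - N n))%N; split.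
  + exact: div_lt.
  + rewrite -xe -!divnMA -expnD -expnSr.
    rewrite addnBA// subnK; last by rewrite ltnW.
    by rewrite -subSn// ltnW.
  + exact: Fle Fy.
- move=> n e e' ee'; apply/seteqP; split=> // y [[x [xN xe Fx]] [x' [x'N x'e Fx']]].
  have [_ _ h _] := SP n; rewrite -(h x x')// => xx'.
  by apply: ee'; rewrite -xe -x'e xx'.
(* At level [N k] a piece is contained in the single set [F k e] of stage [k], whose diameter is at
   most [1 / k]. *)
- move=> r r0; pose k := (Num.trunc r^-1).+1; exists (N k) => e y y'.
  move=> [x [xN xe Fx]] [x' [x'N x'e Fx']].
  have kN : (k <= N k)%N := Nge k.
  have Ee z w : (z < 2 ^ N (N k))%N -> (z %/ 2 ^ (N (N k) - N k) = e)%N ->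
      F (N k) z w -> (e < 2 ^ N k)%N /\ F k e w.
    by move=> zN ze Fz; rewrite -ze; split; [exact: div_lt|exact: Fle Fz].
  have [ek Fy] := Ee _ _ xN xe Fx; have [_ Fy'] := Ee _ _ x'N x'e Fx'.
  have [_ _ _ h] := SP k; apply: (le_trans (h e y y' _ ek Fy Fy')) => //.
  by rewrite -[leRHS]invrK lef_pV2 ?posrE ?invr_gt0// ltW// truncnS_gt.
move=> n e en.
have [h1 h2 h3 _] := SP n.
have mF j : (j < 2 ^ (N n - n))%N ->
    measurable (F n (e * 2 ^ (N n - n) + j)%N : set mX).
  by move=> jN; apply: closed_mble; have [] := h1 _ (idx _ _ _ en jN).
have -> : mu (K n e) = (M n / 2 ^+ n)%:E.
  rewrite KE// measure_bigsetU_ord_cond; last 2 first.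
  - by move=> j _; exact: mF.
  - move=> i j _ _ [y yij]; apply: val_inj; apply: contrapT => ij.
    have := h3 _ _ (idx _ _ _ en (ltn_ord i)) (idx _ _ _ en (ltn_ord j)).
    move=> /(_ (fun h => ij (addnI h))) ij0.
    by have : set0 y by rewrite -ij0.
  rewrite (eq_bigr (fun=> (M n / 2 ^+ N n)%:E)); last first.
    by move=> j _; exact: h2 (idx _ _ _ en (ltn_ord j)).
  rewrite sumEFin sumr_const card_ord -[_ *+ (2 ^ _)]mulr_natr natrX; congr (_ %:E).
  rewrite -mulrA; congr (_ * _); rewrite -{1}(subnK (Nge n)) exprD.
  have p0 : (2 : R) ^+ n != 0 by rewrite expf_neq0.
  have q0 : (2 : R) ^+ (N n - n) != 0 by rewrite expf_neq0.
  by field; rewrite p0 q0.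
have p0 : 0 < (2 : R) ^+ n by rewrite exprn_gt0.
by rewrite !lee_fin !ler_pM2r ?invr_gt0// M_ge M_le.
Qed.

End CantorScheme.

(** * The criterion for images of the Baire space *)

Section Trace.
Context (R : realType) (X : ptopologicalType) (dist : X -> X -> R).
Local Notation mX := (g_sigma_algebraType (@open X)).
Context (mu : {measure set mX -> \bar R}).
Context (a : R) (K : nat -> nat -> set X).
Hypotheses (a0 : 0 < a) (KS : cantor_scheme dist mu a K).
Implicit Types I : set nat.

Definition level I k : set X :=
  \big[setU/set0]_(e < 2 ^ k | `[< hits I k e >]) K k e.

(** The points of the scheme at which children with index in [I] can accumulate. *)
Definition trace I : set X := \bigcap_k level I k.

Lemma levelP I k y : level I k y <-> exists2 e, hits I k e & K k e y.
Proof.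
rewrite /level big_mkcond -(bigcup_mkord _
  (fun e => if `[< hits I k e >] then K k e else set0)).
split=> [[e _]|[e he Ky]].
  by case: asboolP => // he Ky; exists e.
exists e; first exact: hits_lt he.
by rewrite asboolT.
Qed.

Lemma closed_level I k : closed (level I k).
Proof.
have [cK _ _ _ _] := KS; rewrite /level big_mkcond.
by apply: closed_bigsetU => e _; case: ifP => // _; exact: closed0.
Qed.

Lemma closed_trace I : closed (trace I).
Proof. by apply: closed_bigI => k _; exact: closed_level. Qed.

Lemma level_decr I k : level I k.+1 `<=` level I k.
Proof.
have [_ nK _ _ _] := KS.
move=> y /levelP[e he Ke]; apply/levelP; exists (e %/ 2)%N; last exact: nK.
by move=> N; have [i [Ni Ii <-]] := he N; exists i; rewrite addrS.
Qed.

Lemma scheme_ancestor n k e : (k <= n)%N -> K n e `<=` K k (e %/ 2 ^ (n - k))%N.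
Proof.
have [_ nK _ _ _] := KS.
move=> /subnKC <-; rewrite addKn; elim: (n - k)%N e => [|j IH] e.
  by rewrite addn0 divn1.
by rewrite addnS => y /nK /IH; rewrite -divnMA -expnS.
Qed.

Lemma scheme_root n e : (e < 2 ^ n)%N -> K n e `<=` K 0%N 0%N.
Proof.
by move=> en; have := @scheme_ancestor n 0 e isT; rewrite subn0 divn_small.
Qed.

Lemma trace_root I : trace I `<=` K 0%N 0%N.
Proof.
move=> y /(_ 0%N Logic.I)/levelP[e he]; apply: scheme_root; exact: hits_lt he.
Qed.

Lemma mu_level I k : mu (level I k) =
  (\sum_(e < 2 ^ k | `[< hits I k e >]) mu (K k e))%E.
Proof.
have [cK _ dK _ _] := KS.
rewrite measure_bigsetU_ord_cond// => [e _|e e' _ _ [y yK]].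
  by apply: closed_mble; exact: cK.
apply: val_inj; apply: contrapT => ee'.
by have : set0 y by rewrite -(dK k _ _ ee').
Qed.

Lemma nhitsE I k (c : R) :
  (\sum_(e < 2 ^ k | `[< hits I k e >]) c%:E)%E = ((nhits I k)%:R * c)%:E.
Proof.
rewrite sumEFin big_mkcond /nhits natr_sum mulr_suml; congr (_%:E).
by apply: eq_bigr => e _; case: ifP => _; rewrite (mul1r, mul0r).
Qed.

(** The level [k] approximation consists of [nhits I k] disjoint pieces of measure between
    [a / 2 ^ k] and [2 * a / 2 ^ k]. The lower bound survives in the limit by continuity from above;
    the upper bound [trace_le] holds at every level. *)
Lemma trace_ge I : (a%:E * weight R I <= mu (trace I))%E.
Proof.
rewrite leNgt; apply/negP => h.
have [|k|k|k] := mu_decreasing_lt (F := level I) (mu := mu) _ _ _ h.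
- rewrite mu_level; apply: lte_sum_pinfty => e _.
  have [_ _ _ _ /(_ 0%N e (ltn_ord e))[_ /le_lt_trans]] := KS; apply.
  by rewrite ltry.
- by apply: closed_mble; exact: closed_level.
- exact: level_decr.
apply/negP; rewrite -leNgt mu_level.
apply: (@le_trans _ _ (a%:E * ((nhits I k)%:R / 2 ^+ k)%:E)%E).
  by rewrite lee_pmul2l// ?lte_fin//; apply: ereal_inf_lbound; exists k.
rewrite -EFinM mulrCA -nhitsE; apply: lee_sum => e _.
by have [_ _ _ _ /(_ k e (ltn_ord e))[]] := KS.
Qed.

Lemma trace_le I : (mu (trace I) <= (2 * a)%:E * weight R I)%E.
Proof.
have a2 : 0 < 2 * a by rewrite mulr_gt0.
rewrite -ereal_inf_pZl//; apply: le_ereal_inf_tmp => _ [_ [k _ <-] <-].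
apply: (@le_trans _ _ (mu (level I k))).
  apply: mu_le; [by apply: closed_mble; exact: closed_trace|
    by apply: closed_mble; exact: closed_level|].
  by move=> y; apply.
rewrite mu_level -EFinM mulrCA -nhitsE; apply: lee_sum => e _.
by have [_ _ _ _ /(_ k e (ltn_ord e))[]] := KS.
Qed.

End Trace.

Lemma nneseries_term_le (R : realType) (f : nat -> \bar R) j :
  (forall i, 0 <= f i)%E -> (f j <= \sum_(0 <= i <oo) f i)%E.
Proof.
move=> f0; apply: (@le_trans _ _ (\sum_(0 <= i < j.+1) f i)%E).
  by rewrite big_nat_recr//= leeDr// sume_ge0.
by apply: nneseries_lim_ge => i _ _.
Qed.

Section ModelOfConstruction.
Context (R : realType) (X : ptopologicalType) (dist : X -> X -> R).
Hypotheses (dX : metrizes dist) (cX : compact [set: X]).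
Local Notation mX := (g_sigma_algebraType (@open X)).
Context (mu : {measure set mX -> \bar R}).
Context (C : seq nat -> set X) (K : seq nat -> nat -> nat -> set X)
  (g : (nat -> nat) -> X) (a : seq nat -> R).
Hypothesis CC : forall s, closed (C s) /\ forall i, C (rcons s i) `<=` C s.
Hypothesis Cdisj : forall s i j, i <> j -> C (rcons s i) `&` C (rcons s j) = set0.
Hypothesis a0 : forall s, 0 < a s.
Hypothesis KS : forall s, cantor_scheme dist mu (a s) (K s).
Hypothesis KC : forall s, K s 0%N 0%N `<=` C s.
Hypothesis KdC : forall s i, C (rcons s i) `&` K s 0%N 0%N = set0.
Hypothesis Cdiam : forall s i y y', C (rcons s i) y -> C (rcons s i) y' ->
  dist y y' <= (size s).+1%:R^-1.
Hypothesis Cnear : forall s i y, C (rcons s i) y ->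
  exists2 z, K s i (addr i i) z & dist y z <= i.+1%:R^-1.
Hypothesis Cg : forall x n, C (mkseq x n) (g x).

Lemma inv_small (r : R) : 0 < r -> exists n : nat, forall m, (n <= m)%N ->
  m.+1%:R^-1 < r.
Proof.
move=> r0; exists (Num.trunc r^-1) => m nm.
rewrite -[ltRHS]invrK ltf_pV2 ?posrE ?invr_gt0//.
by apply: lt_le_trans (truncnS_gt _) _; rewrite ler_nat ltnS.
Qed.

Lemma C_prefix s t : prefix s t -> C t `<=` C s.
Proof.
move=> /prefixP[u ->]; elim/last_ind: u => [|u i IH] y; first by rewrite cats0.
by rewrite -rcons_cat => /(CC _).2/IH.
Qed.

Lemma C_same_size s t y : size s = size t -> C s y -> C t y -> s = t.
Proof.
elim/last_ind: s t => [|s i IH] t; first by move=> /esym/size0nil.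
case/lastP: t => [|t j]; rewrite !size_rcons => // -[st] Cs Ct.
have st' : s = t by apply: IH => //; [exact: (CC s).2 Cs|exact: (CC t).2 Ct].
rewrite -st' in Ct *; congr rcons; apply: contrapT => /(Cdisj s) ij.
by have : set0 y by rewrite -ij.
Qed.

Lemma C_cyl s x : C s (g x) <-> cyl s x.
Proof.
split=> [Cs|<-]; last exact: Cg.
by apply: (C_same_size _ (Cg x (size s)) Cs); rewrite size_mkseq.
Qed.

Lemma C_unique x y : (forall n, C (mkseq x n) y) -> y = g x.
Proof.
move=> Cy; apply: (dist_eq0 dX); rewrite leNgt; apply/negP => /inv_small[n].
move=> /(_ n (leqnn n)); apply/negP; rewrite -leNgt.
have := Cy n.+1; have := Cg x n.+1; rewrite mkseqS => h1 h2.
by have := Cdiam h2 h1; rewrite size_mkseq.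
Qed.

Lemma g_inj : injective g.
Proof.
move=> x y gxy; apply: mkseq_funext => n.
apply: (@C_same_size _ _ (g x)); rewrite ?size_mkseq//.
by rewrite gxy.
Qed.

(** Sets [C s] of equal length are disjoint, so the nodes containing a given point form a single
    branch, and vanishing diameters identify the point with its image. This makes the range
    Borel. *)
Lemma range_gE : range g = \bigcap_n \bigcup_(s in [set s | size s = n]) C s.
Proof.
apply/seteqP; split=> [_ [x _ <-] n _|y h].
  by exists (mkseq x n); [rewrite /= size_mkseq|exact: Cg].
have /choice[s sP] : forall n, exists s, size s = n /\ C s y.
  by move=> n; have [s sn Cs] := h n Logic.I; exists s.
have [x xs] : exists x, forall n, mkseq x (size (s n)) = s n.
  apply: (chain_limit 0%N) => n; last by rewrite (sP n).1.
  case/lastP E : (s n.+1) => [|t i]; first by have := (sP n.+1).1; rewrite E.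
  suff -> : s n = t by exact: prefix_rcons.
  apply: (C_same_size _ (sP n).2 (y := y)).
    by have := (sP n.+1).1; rewrite E size_rcons (sP n).1 => -[].
  by have := (sP n.+1).2; rewrite E => /(CC t).2.
exists x => //; apply/esym/C_unique => n.
by have [sn Cs] := sP n; rewrite -sn xs.
Qed.

Lemma borel_C s : borel (C s).
Proof. exact: (closed_mble (CC s).1). Qed.

Lemma borel_range : borel (range g).
Proof.
rewrite range_gE; apply: (@g_sigma_bigcap _ (@open X)) => n _.
by apply: (@g_sigma_bigcup _ (@open X)) => s _; exact: borel_C.
Qed.

Lemma image_cyl s : g @` cyl s = range g `&` C s.
Proof.
apply/seteqP; split=> [_ [x xs <-]|_ [[x _ <-] /C_cyl xs]]; last by exists x.
by split; [exists x|exact/C_cyl].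
Qed.

(** By injectivity the image of a complement is a difference of images, so the induction over the
    generated sigma-algebra goes through. *)
Lemma borel_image A : sigma_cyl A -> borel (g @` A).
Proof.
move: A; apply: g_sigma_ind => [_ [s _ <-]||A bA|F bF].
- by rewrite image_cyl; apply: (@g_sigmaI _ (@open X)); [exact: borel_range|exact: borel_C].
- by rewrite image_set0; exact: sigma_algebra0.
- rewrite -setTD image_injD; last exact: g_inj.
  exact: borelD borel_range bA.
- rewrite image_bigcup; apply: (@g_sigma_bigcup _ (@open X)) => n _.
  exact: bF.
Qed.

Lemma borel_preimage B : borel B -> sigma_cyl (g @^-1` B).
Proof.
move: B; apply: g_sigma_ind => [U oU||A bA|F bF].
- have -> : g @^-1` U = \bigcup_(s in [set s | C s `<=` U]) cyl s.
    apply/seteqP; split=> [x Ux|x [s sU /C_cyl/sU//]].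
    have [r r0 rU] := (open_distP dX U).1 oU _ Ux.
    have [n /(_ n (leqnn n)) nr] := inv_small r0.
    exists (mkseq x n.+1); last exact: cyl_mkseq.
    have := Cg x n.+1; rewrite mkseqS => Cgx y Cy; apply: rU.
    rewrite /dball/=; apply: le_lt_trans nr.
    by have := Cdiam Cgx Cy; rewrite size_mkseq.
  apply: (@g_sigma_bigcup _ (range (@cyl nat))) => s _; exact: sigma_cyl_cyl.
- by rewrite preimage_set0; exact: sigma_algebra0.
- by rewrite preimage_setC; exact: (@g_sigmaC _ (range (@cyl nat))).
- rewrite preimage_bigcup; apply: (@g_sigma_bigcup _ (range (@cyl nat))) => n _.
  exact: bF.
Qed.

(** A trace point lies in pieces hit by infinitely many used children. Late ones among them contain
    a point [g x] of [F] near the same piece, so the closed set [F] contains the trace point. *)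
Lemma trace_sub F s : closed F -> trace (K s) (branch (g @^-1` F) s) `<=` F.
Proof.
move=> cF y yT; apply/(closed_distP dX F).1 => // r r0.
have r20 : 0 < r / 2 by rewrite divr_gt0.
have [_ _ _ small _] := KS s.
have [k kP] := small _ r20; have [m mP] := inv_small r20.
have [e he Ky] := (levelP (K s) _ k y).1 (yT k Logic.I).
have [i [mki [x Fx xi] ik]] := he (maxn m k).
have Cgx : C (rcons s i) (g x) by exact/C_cyl.
have [z Kz gxz] := Cnear Cgx; exists (g x) => //.
have ki : (k <= i)%N by rewrite (leq_trans _ mki)// leq_maxr.
have Kz' : K s k e z.
  by rewrite -ik -(addr_ge i ki); exact: (scheme_ancestor (KS s) ki Kz).
have := kP _ _ _ Ky Kz'; have := mP i (leq_trans (leq_maxl _ _) mki).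
have := dist_triangle dX z y (g x); rewrite (distC dX z (g x)).
by move: gxz; set q := _^-1; lra.
Qed.

(* A cluster point of [g @` A] that lies in no [C (rcons s i)] is the limit of
   points of [C (rcons s i)] with [i -> oo], which follow [addr]. *)
Lemma closure_step A s y : closure (g @` (A `&` cyl s)) y ->
  (exists i, closure (g @` (A `&` cyl (rcons s i))) y) \/
  trace (K s) (branch A s) y.
Proof.
move=> Ay; have [|no] := pselect (exists i, closure (g @` (A `&` cyl (rcons s i))) y).
  by left.
right=> k _; apply/(closed_distP dX _).1 => [|r r0]; first exact: (closed_level (KS s)).
have r20 : 0 < r / 2 by rewrite divr_gt0.
set I := branch A s.
have [m mP] := inv_small r20.
(* There are [2 ^ k] cells, and each cell not hit infinitely often receives only finitely many
   indices of [I]; past all of these every index falls into a hit cell. *)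
have [n nP] : exists n, forall i, (n <= i)%N -> I i -> hits I k (addr k i).
  suff [n nP] : exists n, forall e, (e < 2 ^ k)%N -> ~ hits I k e ->
      forall i, (n <= i)%N -> I i -> addr k i <> e.
    exists n => i ni Ii; apply: contrapT => nh.
    exact: nP _ (addr_lt k i) nh i ni Ii erefl.
  elim: (2 ^ k)%N => [|N [n nP]]; first by exists 0%N.
  have [n' n'P] : exists n', ~ hits I k N ->
      forall i, (n' <= i)%N -> I i -> addr k i <> N.
    have [hN|] := pselect (hits I k N); first by exists 0%N.
    move=> /existsNP[n' hn']; exists n' => _ i n'i Ii iN.
    by apply: hn'; exists i.
  exists (maxn n n') => e; rewrite ltnS leq_eqVlt => /predU1P[->|eN] nh i;
    rewrite geq_max => /andP[ni n'i].
    exact: n'P.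
  exact: nP.
pose M := maxn (maxn m n) k.
(* The point is in the closure of none of the first [M] children, so it has positive distance from
   all of their image points. *)
have [q q0 qP] : exists2 q : R, 0 < q & forall i x, (i < M)%N -> A x ->
    cyl (rcons s i) x -> q <= dist y (g x).
  elim: M => [|M [q q0 qP]]; first by exists 1.
  have [q' q'0 q'P] : exists2 q' : R, 0 < q' & forall x, A x ->
      cyl (rcons s M) x -> q' <= dist y (g x).
    apply: contrapT => h; apply: no; exists M; apply/(closure_distP dX) => e e0.
    apply: contrapT => h'; apply: h; exists e => // x Ax xM; rewrite leNgt.
    by apply/negP => yx; apply: h'; exists (g x) => //; exists x.
  exists (Num.min q q'); first by rewrite lt_min q0.
  move=> i x; rewrite ltnS leq_eqVlt ge_min => /predU1P[->|iM] Ax xi.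
    by rewrite (q'P x)// orbT.
  by rewrite (qP i x).
have [|_ [x [Ax xs] <-] yx] := (closure_distP dX _ y).1 Ay (Num.min q (r / 2)).
  by rewrite lt_min q0.
move: yx; rewrite lt_min => /andP[yq yr].
pose i := x (size s).
have xi : cyl (rcons s i) x by exact/cyl_rcons.
have Mi : (M <= i)%N.
  by rewrite leqNgt; apply/negP => iM; move: yq; rewrite ltNge (qP i).
have Ii : I i by exists x.
have [z Kz gxz] : exists2 z, K s i (addr i i) z & dist (g x) z <= i.+1%:R^-1.
  by apply: Cnear; exact/C_cyl.
move: (Mi); rewrite !geq_max => /andP[/andP[mi ni] ki].
exists z.
  apply/(levelP (K s)); exists (addr k i); first exact: nP.
  by rewrite -(addr_ge i ki); exact: (scheme_ancestor (KS s) ki Kz).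
have := dist_triangle dX (g x) y z; have := mP i mi.
by move: gxz yr; set p := _^-1; lra.
Qed.

(** [closure_step] is followed down the tree: either it stops in a trace, or it produces a branch
    all of whose closed sets contain [y], and then [y] is the point of that branch. *)
Lemma closure_image A :
  closure (g @` A) `<=` range g `|` \bigcup_s trace (K s) (branch A s).
Proof.
move=> y Ay; apply: contrapT => ny.
have step s : closure (g @` (A `&` cyl s)) y ->
    exists i, closure (g @` (A `&` cyl (rcons s i))) y.
  by move=> /closure_step[//|ty]; exfalso; apply: ny; right; exists s.
have /choice[f fP] : forall s, exists i, closure (g @` (A `&` cyl s)) y ->
    closure (g @` (A `&` cyl (rcons s i))) y.
  move=> s; have [/step[i ?]|n] := pselect (closure (g @` (A `&` cyl s)) y).
    by exists i.
  by exists 0%N.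
pose t := fix t n := if n is m.+1 then rcons (t m) (f (t m)) else [::].
have tP n : closure (g @` (A `&` cyl (t n))) y.
  elim: n => [|n IH] /=; last exact: fP.
  by rewrite cyl_nil setIT.
have size_t n : size (t n) = n by elim: n => //= n IH; rewrite size_rcons IH.
have [x xt] : exists x, forall n, mkseq x (size (t n)) = t n.
  by apply: (chain_limit 0%N) => n; [exact: prefix_rcons|rewrite size_t].
apply: ny; left; exists x => //; apply/esym/C_unique => n.
have -> : mkseq x n = t n by rewrite -xt size_t.
have [cC _] := CC (t n); apply: cC; apply: closureS (tP n) => _ [z [_ zt] <-].
exact/C_cyl.
Qed.

(** Incomparable nodes have disjoint sets [C], and a node below [s] lies in a child of [s], which
    avoids the root of the scheme of [s]. *)
Lemma root_disjoint s t : s <> t -> K s 0%N 0%N `&` K t 0%N 0%N = set0.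
Proof.
move=> st; apply/seteqP; split=> // y.
wlog st_le : s t st / (size s <= size t)%N => [h|] [sy ty].
  have [/h|/ltnW/h] := leqP (size s) (size t); first by apply.
  by apply=> //; exact: nesym.
have Cs : C s y by exact: KC.
have Ct : C (take (size s) t) y.
  by apply: C_prefix (KC ty); exact: prefix_take.
have sE : s = take (size s) t by apply: C_same_size Cs Ct; rewrite size_takel.
case E : (drop (size s) t) => [|i u].
  by apply: st; rewrite -[RHS](cat_take_drop (size s)) E cats0.
have tE : t = rcons s i ++ u by rewrite cat_rcons -E {1}sE cat_take_drop.
rewrite -(KdC s i); split=> //.
by apply: C_prefix (KC ty); rewrite tE; exact: prefix_prefix.
Qed.

Local Open Scope ereal_scope.

Let term (f : seq nat -> \bar R) j := oapp f 0 (pickle_inv j).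
Let family (f : seq nat -> set X) j : set X := oapp f set0 (pickle_inv j).

Lemma weight_le F s : closed F ->
  (a s)%:E * weight R (branch (g @^-1` F) s) <= mu (F `&` K s 0%N 0%N).
Proof.
move=> cF; apply: (le_trans (trace_ge (a0 s) (KS s) _)).
have [cK _ _ _ _] := KS s.
apply: mu_le.
- by apply: closed_mble; exact: (closed_trace (KS s)).
- by apply: measurableI; exact: closed_mble.
- by move=> y ty; split; [exact: trace_sub ty|exact: (trace_root (KS s) ty)].
Qed.

(** Disjointness of the roots lets the node-by-node estimates [weight_le] add up under the single
    measure of [F]. *)
Lemma sum_roots_le F : closed F ->
  \sum_(0 <= j <oo) term (fun s => mu (F `&` K s 0%N 0%N)) j <= mu F.
Proof.
move=> cF; have mF := closed_mble cF.
have mK j : measurable (family (fun s => F `&` K s 0%N 0%N) j : set mX).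
  rewrite /family; case: pickle_inv => [s|] /=; last exact: measurable0.
  by apply: measurableI => //; apply: closed_mble; have [cK _ _ _ _] := KS s.
rewrite (eq_eseriesr (g := fun j => mu (family (fun s => F `&` K s 0%N 0%N) j))).
  rewrite -measure_semi_bigcup//.
  - apply: mu_le => //; first exact: bigcup_measurable.
    by move=> y [j _]; rewrite /family; case: pickle_inv => [s []|].
  - move=> i j _ _ [y []]; rewrite /family.
    case Ei : (pickle_inv i : option (seq nat)) => [s|]//.
    case Ej : (pickle_inv j : option (seq nat)) => [t|]//= [_ sy] [_ ty].
    have st : s = t.
      by apply: contrapT => /root_disjoint st; have : set0 y by rewrite -st.
    rewrite st in Ei.
    by rewrite -[i](pickle_invK (T := seq nat)) -[j](pickle_invK (T := seq nat)) Ei Ej.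
  - exact: bigcup_measurable.
by move=> j _; rewrite /term /family; case: pickle_inv => //=; rewrite measure0.
Qed.

Lemma mu_closure_le A : mu (closure (g @` A)) <=
  mu (range g) + \sum_(0 <= j <oo) term (fun s => (2 * a s)%:E * weight R (branch A s)) j.
Proof.
pose T j : set mX := family (fun s => trace (K s) (branch A s)) j.
have mT j : measurable (T j).
  rewrite /T /family; case: pickle_inv => [s|] /=; last exact: measurable0.
  by apply: closed_mble; exact: (closed_trace (KS s)).
have mUT : measurable (\bigcup_j T j) by exact: bigcup_measurable.
apply: (@le_trans _ _ (mu (range g `|` \bigcup_j T j))).
  apply: mu_le.
  - by apply: closed_mble; exact: closed_closure.
  - by apply: measurableU => //; exact: borel_range.
  - move=> y /closure_image[gy|[s _ ty]]; [by left|right].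
    by exists (pickle s); rewrite // /T /family pickleK_inv.
apply: (le_trans (measureU2 _ _ _)) => //; first exact: borel_range.
rewrite leeD2l//; apply: (le_trans (mu_bigcup_le mu mT mUT _)) => //.
apply: lee_nneseries => // j _; rewrite /T /family /term.
case: pickle_inv => [s|] /=; last by rewrite measure0.
exact: trace_le.
Qed.

Lemma closed_preimage_cover (P : set (set X)) A : P set0 -> P `<=` closed ->
  countably_covered P (g @` A) -> exists F : nat -> set X,
  [/\ forall n, P (F n), forall n, closed (F n) & A `<=` \bigcup_n g @^-1` F n].
Proof.
move=> P0 Pc /(coveredP _ P0)[F FP AF]; exists F; split=> // [n|x Ax].
  exact: Pc.
by have [|n _ Fx] := AF (g x); [exists x|exists n].
Qed.

Lemma closure_cover (P : set (set X)) A (A_ : nat -> set (nat -> nat)) :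
  P set0 -> A `<=` \bigcup_n A_ n -> (forall n, P (closure (g @` A_ n))) ->
  countably_covered P (g @` A).
Proof.
move=> P0 AA AP; apply/(coveredP _ P0); exists (fun n => closure (g @` A_ n)) => //.
move=> _ [x /AA[n _ Ax] <-]; exists n => //.
by apply: subset_closure; exists x.
Qed.

(** With [a s = 1] the estimates have constants independent of the node: a closed [F] dominates the
    total weight of its preimage, and the closure of an image exceeds [mu (range g)] by at most
    twice the total weight. *)
Lemma models_fin : (forall s, a s = 1%R) -> mu (range g) < +oo ->
  models (compact_fin mu) (fun v : \bar R => v < +oo) g.
Proof.
move=> a1 goo; have P0 : compact_fin mu set0.
  by split; [exact: compact0|rewrite measure0].
split; [exact: g_inj|exact: borel_image|exact: borel_preimage|move=> A _; split].
  move=> /(closed_preimage_cover P0)[F [cF _]|F [FP cF AF]].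
    exact: (compact_closedX dX cF).
  exists (fun n => g @^-1` F n); split=> // n.
  have [_ Foo] := FP n; apply: le_lt_trans Foo.
  apply: le_trans (sum_roots_le (cF n)).
  apply: lee_nneseries => [j _ _|j _]; first exact: term_ge0.
  rewrite /term; case: pickle_inv => [s|] //=.
  by have := weight_le s (cF n); rewrite a1 mul1e.
move=> [A_ [AA As]]; apply: (closure_cover P0 AA) => n; split.
  by apply: (closed_compactX cX); exact: closed_closure.
apply: (le_lt_trans (mu_closure_le (A_ n))); rewrite lte_add_pinfty//.
rewrite (eq_eseriesr (g := fun j => 2%:E * term (fun s => weight R (branch (A_ n) s)) j)).
  rewrite nneseriesZl//; last by move=> j _; exact: term_ge0.
  by rewrite lte_mul_pinfty// ?lee_fin//; exact: As.
by move=> j _; rewrite /term; case: pickle_inv => [s|] /=; rewrite ?a1 ?mulr1 ?mule0.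
Qed.

(** A sum of nonnegative terms vanishes term by term, so the factors [a s] may depend on the
    node. *)
Lemma models_null : mu (range g) = 0 ->
  models (compact_null mu) (fun v : \bar R => v = 0) g.
Proof.
move=> g0; have P0 : compact_null mu set0.
  by split; [exact: compact0|rewrite measure0].
split; [exact: g_inj|exact: borel_image|exact: borel_preimage|move=> A _; split].
  move=> /(closed_preimage_cover P0)[F [cF _]|F [FP cF AF]].
    exact: (compact_closedX dX cF).
  exists (fun n => g @^-1` F n); split=> // n.
  apply: eseries0 => j _ _; case: pickle_inv => [s|] //=.
  have [_ F0] := FP n.
  have : (a s)%:E * weight R (branch (g @^-1` F n) s) <= 0.
    apply: (le_trans (weight_le s (cF n))); rewrite -F0.
    apply: mu_le; [|exact: closed_mble|by move=> y []].
    by apply: measurableI; apply: closed_mble => //; have [cK _ _ _ _] := KS s.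
  rewrite pmule_rle0 ?lte_fin// => w0.
  by apply: le_anti; rewrite w0 weight_ge0.
move=> [A_ [AA As]]; apply: (closure_cover P0 AA) => n; split.
  by apply: (closed_compactX cX); exact: closed_closure.
apply/eqP; rewrite eq_le measure_ge0 andbT.
apply: (le_trans (mu_closure_le (A_ n))); rewrite g0 add0e.
rewrite eseries0// => j _ _; rewrite /term.
have := nneseries_term_le j (fun i => term_ge0 R (A_ n) i).
rewrite -/(total_weight R (A_ n)) (As n).
case: pickle_inv => [s|] //= w0.
by rewrite (_ : weight _ _ = 0) ?mule0//; apply: le_anti; rewrite w0 weight_ge0.
Qed.

End ModelOfConstruction.

(** * Density of the models *)

Section Density.
Context (R : realType) (X : ptopologicalType) (dist : X -> X -> R).
Hypotheses (dX : metrizes dist) (cX : compact [set: X]).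
Local Notation mX := (g_sigma_algebraType (@open X)).
Context (mu : {measure set mX -> \bar R}).
Hypothesis mu0 : forall x, mu [set x] = 0%E.
Local Open Scope ereal_scope.

Definition pieces (C : seq nat -> set X) : set X :=
  \bigcap_n \bigcup_(s in [set s | size s = n]) C s.

(** A closed set is coded by the basic open sets that miss it, and a range [pieces C] by countably
    many such codes, that is, by one binary sequence. *)
Lemma pieces_code : exists code : (nat -> bool) -> set X,
  forall C, (forall s, closed (C s)) -> exists c, pieces C = code c.
Proof.
have [U [oU UV]] := countable_basis dX cX.
exists (fun c => pieces (fun s => ~` \bigcup_(k in [set k | c (pickle (s, k))]) U k)).
move=> C cC.
exists (fun n => if unpickle n is Some (s, k) then `[< U k `&` C s = set0 >] else false).
congr pieces; apply/funext => s; apply/seteqP; split=> [x Cx [k /=]|x nx].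
  by rewrite pickleK => /asboolP UC Ux; have : set0 x by rewrite -UC.
apply: contrapT => nC.
have [k Ux UC] := UV (~` C s) x (closed_openC (cC s)) nC.
apply: nx; exists k => //=; rewrite pickleK; apply/asboolP/seteqP; split=> // y [Uy Cy].
exact: UC Uy Cy.
Qed.

Lemma null_range (d : nat -> X) : mu (range d) = 0.
Proof.
apply/eqP; rewrite eq_le measure_ge0 andbT.
have md n : measurable ([set d n] : set mX).
  by apply: closed_mble; exact: (closed_sing dX).
have dE : range d = \bigcup_n [set d n].
  by apply/seteqP; split=> [_ [n _ <-]|_ [n _ ->]]; exists n.
have mD : measurable (range d : set mX) by rewrite dE; exact: bigcup_measurable.
apply: (le_trans (mu_bigcup_le mu md mD _)); first by rewrite dE.
by rewrite eseries0.
Qed.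

Lemma null_setD (E N : set mX) : measurable E -> measurable N -> mu N = 0 ->
  mu (E `\` N) = mu E.
Proof.
move=> mE mN N0; rewrite (mu_setDI mu mE mN).
suff -> : mu (E `&` N) = 0 by rewrite adde0.
apply/eqP; rewrite eq_le measure_ge0 andbT -N0.
by apply: mu_le => //; exact: measurableI.
Qed.

Context (P : set (set X)) (aok : R -> Prop).
Hypothesis PE : forall Y : set X, closed Y -> ~ countably_covered P Y ->
  exists (E : set mX) a, [/\ measurable E, E `<=` Y, mu E < +oo, (0 < a)%R &
    aok a /\ (2 * a)%:E < mu E].
Context (fine : seq nat -> set X -> Prop).
Hypothesis fineP : forall s x, exists2 r : R, (0 < r)%R &
  forall U, U `<=` dball dist x r -> fine s U.

(** [aok] will be equality with 1 for [Jf], where the nodes must be comparable, and always true for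
    [J0]. *)
Definition good_scheme (K : nat -> nat -> set X) : Prop :=
  exists a, [/\ (0 < a)%R, aok a & cantor_scheme dist mu a K].

(** A countable dense subset of [Y] is null because points are null. It is deleted from [E] before
    the scheme is built, so the root misses it and is nowhere dense in [Y]. *)
Lemma good_scheme_exists (Y : set X) : closed Y -> ~ countably_covered P Y ->
  exists K : nat -> nat -> set X,
  [/\ good_scheme K, closed (K 0 0)%N, K 0%N 0%N `<=` Y,
      forall n e, (e < 2 ^ n)%N -> K n e !=set0 /\ K n e `<=` K 0%N 0%N &
      forall U, open U -> U `&` Y !=set0 -> (U `&` Y) `\` K 0%N 0%N !=set0].
Proof.
move=> cY nY; have [E [a [mE EY Eoo a0 [oka aE]]]] := PE cY nY.
have [U [oU UV]] := countable_basis dX cX.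
have /choice[d dP] : forall n, exists x, U n `&` Y !=set0 -> (U n `&` Y) x.
  move=> n; have [[x Ux]|h] := pselect (U n `&` Y !=set0); first by exists x.
  by exists point.
have mD : measurable (range d : set mX).
  have -> : range d = \bigcup_n [set d n].
    by apply/seteqP; split=> [_ [n _ <-]|_ [n _ ->]]; exists n.
  by apply: bigcup_measurable => n _; apply: closed_mble; exact: (closed_sing dX).
have ED := null_setD mE mD (null_range d).
have [||||K [KS KE]] := @cantor_scheme_exists _ X dist mu dX cX mu0 (E `\` range d) a.
- exact: measurableD.
- by rewrite ED.
- exact: a0.
- by rewrite ED.
have [cK _ _ _ Kmu] := KS.
exists K; split.
- by exists a.
- exact: cK.
- by move=> y /KE[/EY].
- move=> n e en; split; last exact: (scheme_root KS en).
  apply/set0P/eqP => Kn0; have [+ _] := Kmu n e en.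
  by rewrite Kn0 measure0 lee_fin leNgt divr_gt0// exprn_gt0.
- move=> V oV [y [Vy Yy]].
  have [n Uy UV'] := UV V y oV Vy.
  have [Ud Yd] : (U n `&` Y) (d n) by apply: dP; exists y.
  exists (d n); split; first by split=> //; exact: UV'.
  by move=> /KE[_]; apply; exists n.
Qed.

(** One construction serves both ideals. The measure of the range is left open: it is controlled
    afterwards, through the choice of [B] and of [fine]. *)
Lemma model_exists (B : set X) : borel B -> ~ countably_covered P B ->
  exists (C : seq nat -> set X) g,
  [/\ range g `<=` B, (forall s, closed (C s)) /\ range g = pieces C,
      forall s i, fine (rcons s i) (C (rcons s i)),
      (forall a, aok a -> a = 1%R) -> mu (range g) < +oo ->
        models (compact_fin mu) (fun v : \bar R => v < +oo) g &
      mu (range g) = 0 ->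
        models (compact_null mu) (fun v : \bar R => v = 0) g].
Proof.
move=> bB nB; have [F [cF BF]] := borel_souslin dX bB.
have BE : B = sift F [::].
  by apply/seteqP; split=> x; [move=> /BF[z h]; exists z|move=> [z _ h]; apply/BF; exists z].
have [|C [K [g [CC Cdisj KP Cs [Cg gB]]]]] :=
    @construction _ X dist dX cX P fine fineP good_scheme good_scheme_exists F cF.
  by rewrite -BE.
have /choice[a aP] : forall s, exists a, [/\ (0 < a)%R, aok a & cantor_scheme dist mu a (K s)].
  by move=> s; have [[a h] _ _] := KP s; exists a.
have a0 s : (0 < a s)%R by case: (aP s).
have KS s : cantor_scheme dist mu (a s) (K s) by case: (aP s).
have KC s : K s 0%N 0%N `<=` C s by case: (KP s).
have KdC s i : C (rcons s i) `&` K s 0%N 0%N = set0 by have [_ _] := KP s; apply.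
have Cdiam s i y y' : C (rcons s i) y -> C (rcons s i) y' ->
    (dist y y' <= (size s).+1%:R^-1)%R.
  by have [_ h _] := Cs s i; exact: h.
have Cnear s i y : C (rcons s i) y ->
    exists2 z, K s i (addr i i) z & (dist y z <= i.+1%:R^-1)%R.
  by have [_ _ h] := Cs s i; exact: h.
exists C, g; split.
- by move=> _ [x _ <-]; rewrite BE; exact: gB.
- split; first by move=> s; case: (CC s).
  exact: (range_gE dX CC Cdisj Cdiam Cg).
- by move=> s i; case: (Cs s i).
- move=> a1 goo; apply: (@models_fin _ X dist dX cX mu C K g a) => // s.
  by apply: a1; case: (aP s).
- by move=> g0; apply: (@models_null _ X dist dX cX mu C K g a).
Qed.

End Density.

Section DensityOfMeasures.
Context (R : realType) (X : ptopologicalType) (dist : X -> X -> R).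
Hypotheses (dX : metrizes dist) (cX : compact [set: X]).
Local Notation mX := (g_sigma_algebraType (@open X)).
Context (mu : {measure set mX -> \bar R}).
Local Open Scope ereal_scope.

Lemma nonatomic_point : nonatomic mu -> forall x, mu [set x] = 0.
Proof.
move=> na x; apply/eqP; rewrite eq_le measure_ge0 andbT leNgt; apply/negP => x0.
have mx : measurable ([set x] : set mX) by apply: closed_mble; exact: (closed_sing dX).
have [A [mA Ax A0 Alt]] := na _ mx x0.
have [Axx|nAx] := pselect (A x).
  suff AE : A = [set x] by rewrite AE ltxx in Alt.
  by apply/seteqP; split=> // _ ->.
suff AE : A = set0 by rewrite AE measure0 ltxx in A0.
by apply/seteqP; split=> // y Ay; apply: nAx; rewrite -(Ax y Ay).
Qed.

(** The strict inequality between the measures already makes the smaller one finite. *)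
Lemma nonatomic_semifinite : nonatomic mu -> semifinite mu.
Proof.
move=> na A mA A0; have [A' [mA' A'A A'0 A'lt]] := na A mA A0.
by exists A'; split=> //; apply: lt_le_trans A'lt (leey _).
Qed.

(* A set of maximal finite measure inside [Y] would have a complement of
   infinite measure, hence could be enlarged. *)
Lemma semifinite_large : semifinite mu -> forall (Y : set mX) (c : R),
  measurable Y -> mu Y = +oo ->
  exists E : set mX, [/\ measurable E, E `<=` Y, mu E < +oo & c%:E < mu E].
Proof.
move=> sf Y c mY Yoo; apply: contrapT => h.
pose S := [set mu E | E in [set E : set mX | [/\ measurable E, E `<=` Y & mu E < +oo]]].
have Sle E : measurable E -> E `<=` Y -> mu E < +oo -> mu E <= c%:E.
  by move=> mE EY Eoo; rewrite leNgt; apply/negP => cE; apply: h; exists E.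
have S0 : S (mu set0) by exists set0 => //; split=> //; rewrite measure0.
have supc : ereal_sup S <= c%:E.
  by apply: ge_ereal_sup => _ [E [mE EY Eoo] <-]; exact: Sle.
have sup0 : 0 <= ereal_sup S.
  by apply: le_ereal_sup_tmp; exists (mu set0) => //; rewrite measure0.
have supfin : ereal_sup S \is a fin_num.
  by rewrite ge0_fin_numE// (le_lt_trans supc)// ltry.
have /choice[E EP] : forall n : nat, exists E : set mX, [/\ measurable E, E `<=` Y,
    mu E < +oo & ereal_sup S - (n.+1%:R^-1)%:E < mu E].
  move=> n; have n0 : (0 < n.+1%:R^-1 :> R)%R by [].
  have [_ [E [mE EY Eoo] <-] hE] := ub_ereal_sup_adherent n0 supfin.
  by exists E.
pose F n := \big[setU/set0]_(i < n) E i.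
have mF n : measurable (F n) by apply: bigsetU_measurable => i _; case: (EP i).
have FP n : F n `<=` Y /\ mu (F n) < +oo.
  rewrite /F; elim: n => [|n [IY Ioo]].
    by rewrite big_ord0 measure0; split.
  rewrite big_ord_recr /=; have [mE EY Eoo _] := EP n; split.
    by move=> x [/IY|/EY].
  apply: (le_lt_trans (measureU2 _ (mF n) mE)).
  by rewrite lte_add_pinfty.
have ndF : nondecreasing_seq F.
  apply/nondecreasing_seqP => n; apply/subsetPset.
  by rewrite /F big_ord_recr /=; left.
have mUF : measurable (\bigcup_n F n) by exact: bigcup_measurable.
have UF : mu (\bigcup_n F n) <= ereal_sup S.
  have Fcvg : mu \o F @ \oo --> mu (\bigcup_n F n) by exact: nondecreasing_cvg_mu.
  rewrite -(cvg_lim _ Fcvg)//; apply: lime_le.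
    by apply/cvg_ex; exists (mu (\bigcup_n F n)).
  apply: nearW => n; apply: ereal_sup_ubound; exists (F n) => //.
  by have [FY Foo] := FP n; split.
have UFoo : mu (\bigcup_n F n) < +oo.
  by rewrite (le_lt_trans UF)// (le_lt_trans supc)// ltry.
have UFY : \bigcup_n F n `<=` Y by move=> x [n _]; exact: (FP n).1.
have mD : measurable (Y `\` \bigcup_n F n) by exact: measurableD.
have D0 : 0 < mu (Y `\` \bigcup_n F n).
  rewrite lt_neqAle measure_ge0 andbT eq_sym; apply/eqP => D0.
  have := mu_setDI mu mY mUF; rewrite D0 add0e setIidr// Yoo => Yeq.
  by rewrite -Yeq ltxx in UFoo.
have [G [mG GD G0 Goo]] := sf _ mD D0.
have GF : (\bigcup_n F n) `&` G = set0.
  by apply/seteqP; split=> // x [Fx /GD[]].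
have : mu (\bigcup_n F n `|` G) <= ereal_sup S.
  apply: ereal_sup_ubound; exists (\bigcup_n F n `|` G) => //; split.
  - exact: measurableU.
  - by move=> x [/UFY|/GD[]].
  - by apply: (le_lt_trans (measureU2 _ mUF mG)); rewrite lte_add_pinfty.
rewrite measureU// leNgt; apply/negP; rewrite negbK.
have supUF : ereal_sup S <= mu (\bigcup_n F n).
  apply/lee_addgt0Pr => e e0.
  have [n ne] : exists n : nat, (n.+1%:R^-1 < e)%R.
    by have [n /(_ n (leqnn n))] := inv_small e0; exists n.
  have [mE _ _ /ltW hE] := EP n; rewrite leeBlDr// in hE.
  apply: (le_trans hE); apply: leeD; last by rewrite lee_fin ltW.
  apply: mu_le => // x Ex; exists n.+1 => //.
  by rewrite /F big_ord_recr /=; right.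
apply: (le_lt_trans supUF); rewrite lteDl// ?ge0_fin_numE//.
Qed.

(** A closed set outside the ideal has infinite measure, being compact, and so contains a set of
    finite measure above 2: this allows [a = 1] everywhere. Passing from [B] to a subset of finite
    measure bounds the range. *)
Lemma densely_modelled_fin : (forall x, mu [set x] = 0) -> semifinite mu ->
  (forall B : set X, borel B -> ~ countably_covered (compact_fin mu) B ->
     exists C : set X, [/\ borel C, C `<=` B,
       ~ countably_covered (compact_fin mu) C & mu C < +oo]) ->
  densely_modelled (compact_fin mu) (fun v : \bar R => v < +oo).
Proof.
move=> mu0 sf small; have [code codeP] := pieces_code dX cX.
exists code => B bB nB; have [D [bD DB nD Doo]] := small B bB nB.
have [|s x|C [g [gD [cC gE] _ gm _]]] :=
    @model_exists _ X dist dX cX mu mu0 (compact_fin mu) (fun a => a = 1%R) _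
      (fun _ _ => True) _ D bD nD.
- move=> Y cY nY; have mY := closed_mble cY.
  have Yoo : mu Y = +oo.
    apply/eqP; rewrite -leye_eq leNgt; apply/negP => Yoo; apply: nY.
    by apply: covered_in; split=> //; exact: (closed_compactX cX).
  have [E [mE EY Eoo E2]] := semifinite_large sf 2 mY Yoo.
  by exists E, 1%R; split=> //; split=> //; rewrite mulr1.
- by exists 1%R.
exists g; split.
- apply: gm => //; apply: le_lt_trans Doo; apply: mu_le => //.
  by rewrite gE; apply: bigcapT_measurable => n; apply: (@g_sigma_bigcup _ (@open X)) => s _; exact: closed_mble.
- by move=> x /gD/DB.
- by have [c cE] := codeP C cC; exists c; rewrite gE.
Qed.

(** The code of the node in the bound makes one level summable: the pieces of length [n + 1] meet
    [D] in total measure at most [2 ^- n]. *)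
Lemma small_pieces_null (C : seq nat -> set X) (D : set mX) :
  measurable D -> (forall s, closed (C s)) -> pieces C `<=` D ->
  (forall s i, mu (C (rcons s i) `&` D) <=
    ((2 ^+ size s)^-1 / (2 ^ (pickle (rcons s i)).+1)%:R)%:E) ->
  mu (pieces C) = 0.
Proof.
move=> mD cC CD Cs; apply/eqP; rewrite eq_le measure_ge0 andbT.
apply/lee_addgt0Pr => e e0; rewrite add0e.
have [n ne] : exists n, ((2 ^+ n)^-1 < e :> R)%R.
  have [n /(_ n (leqnn n)) ne] := inv_small e0; exists n.
  apply: le_lt_trans ne; rewrite lef_pV2 ?posrE ?exprn_gt0// -natrX ler_nat.
  exact: ltn_expl.
apply: (@le_trans _ _ (2 ^+ n)^-1%:E); last by rewrite lee_fin ltW.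
have n0 : (0 <= (2 ^+ n)^-1 :> R)%R by rewrite invr_ge0 exprn_ge0.
pose G j : set mX := if pickle_inv j is Some s then
  if size s == n.+1 then C s `&` D else set0 else set0.
have mG j : measurable (G j).
  rewrite /G; case: pickle_inv => [s|]; last exact: measurable0.
  by case: ifP => _; [apply: measurableI => //; exact: closed_mble|exact: measurable0].
have mP : measurable (pieces C : set mX).
  apply: bigcapT_measurable => k.
  by apply: (@g_sigma_bigcup _ (@open X)) => s _; exact: closed_mble.
apply: (le_trans _ (epsilon_trick0 xpredT n0)).
apply: (le_trans (mu_bigcup_le mu mG mP _)).
  move=> x xC; have [s sn Cx] := xC n.+1 Logic.I.
  exists (pickle s) => //; rewrite /G pickleK_inv (eqP (introT eqP sn)) eqxx.
  by split=> //; exact: CD.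
apply: lee_nneseries => // j _; rewrite /G.
case E : (pickle_inv j : option (seq nat)) => [s|]; last first.
  by rewrite measure0 lee_fin divr_ge0.
case: eqP => [sn|_]; last by rewrite measure0 lee_fin divr_ge0.
have jE : j = pickle s by rewrite -[j](pickle_invK (T := seq nat)) E.
case/lastP: s => [|t i] in E sn jE *; first by [].
by move: sn; rewrite size_rcons jE => -[<-]; exact: Cs.
Qed.

Lemma fine_ball (D : set mX) (e : R) (x : X) : (forall x, mu [set x] = 0) ->
  measurable D -> mu D < +oo -> (0 < e)%R ->
  exists2 r : R, (0 < r)%R & forall U : set X, U `<=` dball dist x r ->
    borel U -> mu (U `&` D) <= e%:E.
Proof.
move=> mu0 mD Doo e0; have [r r0 rD] := small_ball dX mu0 x mD Doo e0.
exists r => // U Ur bU; apply: ltW; apply: le_lt_trans rD; apply: mu_le.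
- exact: measurableI.
- by apply: measurableI => //; apply: open_mble; exact: (open_dball dX).
- by move=> y [/Ur yr Dy]; split.
Qed.

Lemma covered_null (D : set mX) : measurable D ->
  countably_covered (compact_null mu) D -> mu D = 0.
Proof.
move=> mD /coveredP[|F FP DF]; first by split; [exact: compact0|rewrite measure0].
have mF n : measurable (F n : set mX).
  by apply: closed_mble; apply: (compact_closedX dX); case: (FP n).
apply/eqP; rewrite eq_le measure_ge0 andbT.
apply: (le_trans (mu_bigcup_le mu mF mD DF)).
by rewrite eseries0// => n _ _; case: (FP n).
Qed.

(** If [mu B] vanishes, so does the measure of the range. Otherwise [B] is replaced by a subset [D]
    of finite positive measure, still outside the ideal since covered sets are null, and the pieces
    are kept so small relative to [D] that the range is null. *)
Lemma densely_modelled_null : (forall x, mu [set x] = 0) -> semifinite mu ->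
  densely_modelled (compact_null mu) (fun v : \bar R => v = 0).
Proof.
move=> mu0 sf; have [code codeP] := pieces_code dX cX.
exists code => B bB nB.
have PE (Y : set X) : closed Y -> ~ countably_covered (compact_null mu) Y ->
    exists (E : set mX) a, [/\ measurable E, E `<=` Y, mu E < +oo, (0 < a)%R &
      True /\ (2 * a)%:E < mu E].
  move=> cY nY; have mY := closed_mble cY.
  have Y0 : 0 < mu Y.
    rewrite lt_neqAle measure_ge0 andbT eq_sym; apply/eqP => Y0; apply: nY.
    by apply: covered_in; split=> //; exact: (closed_compactX cX).
  (* A quarter of the measure, so that [2 * a] is half of it and strictly smaller. *)
  have [E [mE EY E0 Eoo]] := sf _ mY Y0; exists E, (fine (mu E) / 4)%R.
  move: E0; rewrite (mu_fin Eoo) lte_fin => E0.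
  by split=> //; [rewrite ltry|lra|split=> //; rewrite lte_fin; lra].
have mpieces (C : seq nat -> set X) : (forall s, closed (C s)) ->
    measurable (pieces C : set mX).
  move=> cC; apply: bigcapT_measurable => n.
  by apply: (@g_sigma_bigcup _ (@open X)) => s _; exact: closed_mble.
have [B0|B0] := pselect (mu B = 0).
  have [s x|C [g [gB [cC gE] _ _ gm]]] :=
      @model_exists _ X dist dX cX mu mu0 (compact_null mu) (fun=> True) PE
        (fun _ _ => True) _ B bB nB.
    by exists 1%R.
  exists g; split=> //; last by have [c cE] := codeP C cC; exists c; rewrite gE.
  apply: gm; apply/eqP; rewrite eq_le measure_ge0 andbT -B0.
  by apply: mu_le => //; rewrite gE; exact: mpieces.
have {}B0 : 0 < mu B by rewrite lt_neqAle measure_ge0 andbT eq_sym; exact/eqP.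
have [D [mD DB D0 Doo]] := sf B bB B0.
have nD : ~ countably_covered (compact_null mu) D.
  by move=> /(covered_null mD) D00; rewrite D00 ltxx in D0.
(* The bound in [small_pieces_null] is indexed by the length of the parent, hence the predecessor of
   the size. *)
pose e (s : seq nat) : R := ((2 ^+ (size s).-1)^-1 / (2 ^ (pickle s).+1)%:R)%R.
have e0 s : (0 < e s)%R.
  by rewrite divr_gt0 ?invr_gt0 ?exprn_gt0// ltr0n expn_gt0.
have [s x|C [g [gD [cC gE] Cf _ gm]]] :=
    @model_exists _ X dist dX cX mu mu0 (compact_null mu) (fun=> True) PE
      (fun s U => borel U -> mu (U `&` D) <= (e s)%:E) _ D mD nD.
  exact: fine_ball.
exists g; split; [|by move=> x /gD/DB|by have [c cE] := codeP C cC; exists c; rewrite gE].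
apply: gm; rewrite gE; apply: (small_pieces_null mD cC); first by rewrite -gE.
by move=> s i; have := Cf s i (closed_mble (cC _)); rewrite /e size_rcons.
Qed.

End DensityOfMeasures.

(** * Subspaces and Lebesgue measure on the unit interval *)

Section SubspaceTopology.
Context (X : topologicalType) (A : set X).

Lemma nbhs_set_typeP (x : A) (N : set A) : nbhs x N <->
  exists2 M, nbhs (val x) M & val @^-1` M `<=` N.
Proof.
split=> [|[M Mx MN]].
  move=> xN; rewrite nbhsE in xN; case: xN => V [[M oM <-] Mx] MN; exists M => //.
  by apply: open_nbhs_nbhs; split.
have xM : nbhs x (set_val @^-1` M).
  exact: (@initial_continuous A X set_val x M Mx).
exact: filterS xM.
Qed.

Lemma compact_set_type : compact A -> compact [set: A].
Proof.
move=> cA F FF FT.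
have GA : fmap (val : A -> X) F A.
  rewrite fmapE; suff -> : (val : A -> X) @^-1` A = setT by [].
  by apply/seteqP; split=> // x _; exact: (set_mem (valP x)).
have [x [Ax clx]] := cA (fmap (val : A -> X) F) _ GA.
exists (SigSub (mem_set Ax)); split=> // B N FB /nbhs_set_typeP[M Mx MN].
have [|_ [[y By <-] My]] := clx (val @` B) M _ Mx.
  rewrite fmapE; apply: filterS FB => y By; exact: imageP.
by exists y; split=> //; exact: MN.
Qed.

End SubspaceTopology.

Section UnitInterval.
Context (R : realType).
Local Open Scope ereal_scope.

(** A copy of the subspace type, to which a base point is attached because the general construction
    works in pointed spaces. *)
Definition interval_space : Type := set_type (@unit_interval R).

HB.instance Definition _ := Topological.copy interval_space
  (set_type (@unit_interval R)).

Fact unit_interval0 : (0%R : R) \in @unit_interval R.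
Proof. by rewrite inE /unit_interval /= in_itv /= lexx ler01. Qed.

HB.instance Definition _ := isPointed.Build interval_space
  (exist _ 0%R unit_interval0 : interval_space).

Definition interval_dist (x y : interval_space) : R := `|val x - val y|%R.

Lemma interval_metrizes : metrizes interval_dist.
Proof.
split; first split=> [x y|x y|x y z].
- split=> [/normr0_eq0/subr0_eq/val_inj//|->].
  by rewrite /interval_dist subrr normr0.
- exact: distrC.
- exact: ler_distD.
move=> x; apply/seteqP; split=> N.
  move=> /nbhs_set_typeP[M /nbhs_ballP[e /= e0 eM] MN]; exists e => // y /= xy.
  by apply: MN; exact: eM.
move=> [e /= e0 eN]; apply/nbhs_set_typeP; exists (ball (val x) e).
  exact: nbhsx_ballx.
by move=> y; exact: eN.
Qed.

Lemma interval_compact : compact [set: interval_space].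
Proof. by apply: compact_set_type; exact: segment_compact. Qed.

Let mI := g_sigma_algebraType (@open interval_space).

Lemma measurable_val (B : set mI) : measurable B ->
  measurable ([set val x | x in B] : set (measurableTypeR R)).
Proof.
have mU : measurable (@unit_interval R : set (measurableTypeR R)).
  exact: measurable_itv.
move: B; apply: g_sigma_ind => [_ [M oM <-]||B mB|F mF].
- have -> : [set val x | x in (val : interval_space -> R) @^-1` M] =
      M `&` @unit_interval R.
    apply/seteqP; split=> [_ [x Mx <-]|x [Mx Ux]].
      by split=> //; exact: (set_mem (valP _)).
    by exists (SigSub (mem_set Ux)).
  by apply: measurableI => //; exact: measurable_realfun.open_measurable.
- by rewrite image_set0; exact: measurable0.
- have -> : [set val x | x in ~` B] = @unit_interval R `\` [set val x | x in B].
    apply/seteqP; split=> [_ [x nB <-]|x [Ux nB]].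
      by split=> [|[y By /val_inj yx]]; [exact: (set_mem (valP _))|apply: nB; rewrite -yx].
    exists (SigSub (mem_set Ux)) => // Bx; apply: nB; eexists; first exact: Bx.
    by [].
  exact: measurableD.
- by rewrite image_bigcup; apply: bigcup_measurable.
Qed.

Definition interval_measure (B : set mI) : \bar R := @lambda R B.

Let interval_measure0 : interval_measure set0 = 0.
Proof. by rewrite /interval_measure /lambda image_set0 measure0. Qed.

Let interval_measure_ge0 B : 0 <= interval_measure B.
Proof. exact: measure_ge0. Qed.

Let interval_measure_semi_sigma_additive : semi_sigma_additive interval_measure.
Proof.
move=> F mF tF mUF; rewrite /interval_measure /lambda image_bigcup.
apply: measure_semi_sigma_additive => //.
- by move=> n; exact: measurable_val.
- move=> i j _ _ [_ [[x Fx <-] [y Fy /val_inj yx]]].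
  by apply: tF => //; exists x; split=> //; rewrite -yx.
- by rewrite -image_bigcup; exact: measurable_val.
Qed.

HB.instance Definition _ := isMeasure.Build _ _ _ interval_measure
  interval_measure0 interval_measure_ge0 interval_measure_semi_sigma_additive.

Lemma interval_measure_pt (x : interval_space) : interval_measure [set x] = 0.
Proof.
by rewrite /interval_measure /lambda image_set1 lebesgue_measure_set1.
Qed.

Lemma interval_measureT : interval_measure setT = 1.
Proof.
rewrite /interval_measure /lambda.
have -> : [set val x | x in [set: mI]] = @unit_interval R.
  apply/seteqP; split=> [_ [x _ <-]|x Ux]; first exact: (set_mem (valP _)).
  by exists (SigSub (mem_set Ux)).
by rewrite /unit_interval lebesgue_measure_itv /= lte01 oppr0 adde0.
Qed.

Lemma lambda_densely_modelled :
  densely_modelled (compact_null (@lambda R)) (fun v : \bar R => v = 0).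
Proof.
apply: (densely_modelled_null interval_metrizes interval_compact
  (mu := interval_measure)).
- exact: interval_measure_pt.
- move=> A mA A0; exists A; split=> //.
  apply: (@le_lt_trans _ _ (interval_measure setT)).
    by apply: mu_le => //; exact: measurableT.
  by rewrite interval_measureT ltry.
Qed.

Lemma lambda_not_covered : ~ countably_covered (compact_null (@lambda R)) setT.
Proof.
move=> cT; have : interval_measure setT = 0.
  exact: (covered_null interval_metrizes (mu := interval_measure) measurableT cT).
by rewrite interval_measureT => /eqP; rewrite onee_eq0.
Qed.

End UnitInterval.

(** * A net measure on the Cantor space *)

Section CantorSpace.
Local Notation T := cantor_space.
Implicit Types (s : seq bool) (x : T).

Lemma open_coord k (b : bool) : open [set x : T | x k = b].
Proof.
have -> : [set x : T | x k = b] = (fun x : T => x k) @^-1` [set b].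
  by apply/seteqP; split.
apply: open_comp; last exact: discrete_open.
by move=> x _; exact: (@proj_continuous nat (fun=> bool) k x).
Qed.

Lemma open_cyl s : open (cyl s : set T).
Proof.
elim/last_ind: s => [|s b IH]; first by rewrite cyl_nil; exact: openT.
have -> : cyl (rcons s b) = cyl s `&` [set x : T | x (size s) = b].
  by apply/seteqP; split=> x /cyl_rcons.
by apply: openI => //; exact: open_coord.
Qed.

Lemma cyl_subset (U : eqType) (s t : seq U) (x : nat -> U) : (size s <= size t)%N ->
  cyl s x -> cyl t x -> cyl t `<=` cyl s.
Proof.
move=> st xs xt y yt; rewrite /cyl/= -[RHS]xs.
by apply: (mkseq_eq_le st); rewrite yt xt.
Qed.

Lemma closed_cyl s : closed (cyl s : set T).
Proof.
rewrite -openC.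
have -> : ~` (cyl s : set T) = \bigcup_(t in [set t | size t = size s /\ t <> s]) cyl t.
  apply/seteqP; split=> [x xs|x [t [ts tns] xt] xs].
    by exists (mkseq x (size s)); [split; rewrite ?size_mkseq|exact: cyl_mkseq].
  by apply: tns; rewrite -xt ts xs.
by apply: bigcup_open => t _; exact: open_cyl.
Qed.

(** By compactness: the complement of [U] is covered by the complements of the shrinking cylinders
    around [x], so finitely many of these, hence one, suffice. *)
Lemma open_cylP (U : set T) : open U <->
  forall x, U x -> exists n, cyl (mkseq x n) `<=` U.
Proof.
split=> [oU x Ux|h]; last first.
  rewrite openE => x /h[n nU]; apply: filterS nU _.
  by apply: open_nbhs_nbhs; split; [exact: open_cyl|exact: cyl_mkseq].
have cU : compact (~` U).
  by apply: (subclosed_compact _ cantor_space_compact) => //; exact: open_closedC.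
move: cU; rewrite compact_cover.
move=> /(_ nat setT (fun n => ~` (cyl (mkseq x n) : set T))) [||D _ DU].
- by move=> n _; apply: closed_openC; exact: closed_cyl.
- move=> y nUy; have [n xy] : exists n, mkseq y n <> mkseq x n.
    by apply: contrapT => h; apply: nUy; rewrite (mkseq_funext (x := y) (y := x))// => n;
      apply: contrapT => yx; apply: h; exists n.
  by exists n => //=; rewrite /cyl/= size_mkseq.
exists (\max_(i <- finmap.enum_fset D) i)%N => y xy; apply: contrapT => /DU[n nD].
rewrite /cyl/= size_mkseq; apply.
have nm : (n <= \max_(i <- finmap.enum_fset D) i)%N by exact: leq_bigmax_seq.
by apply: (mkseq_eq_le nm); move: xy; rewrite /cyl/= size_mkseq.
Qed.

Lemma borel_cyl_ind (P : set T -> Prop) : (forall s, P (cyl s)) -> P set0 ->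
  (forall A, P A -> P (~` A)) ->
  (forall F : (set T)^nat, (forall n, P (F n)) -> P (\bigcup_n F n)) ->
  forall A, borel A -> P A.
Proof.
move=> Pcyl P0 PC PU; apply: g_sigma_ind => // [V oV].
have -> : V = \bigcup_n (if pickle_inv n is Some s then
    if `[< cyl s `<=` V >] then cyl s else set0 else set0).
  apply/seteqP; split=> [x Vx|x [n _]].
    have [n nV] := (open_cylP V).1 oV x Vx.
    exists (pickle (mkseq x n)) => //; rewrite pickleK_inv asboolT//.
    exact: cyl_mkseq.
  by case: pickle_inv => // s; case: asboolP => // sV; exact: sV.
apply: PU => n; case: pickle_inv => // s.
by case: asboolP.
Qed.

Lemma decreasing_closed_cover (F : nat -> set T) (W : nat -> set T) :
  (forall n, closed (F n)) -> (forall n, F n.+1 `<=` F n) -> (forall i, open (W i)) ->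
  \bigcap_n F n `<=` \bigcup_i W i ->
  exists N, F N `<=` \bigcup_(i in `I_N) W i.
Proof.
move=> cF Fs oW FW; move: cantor_space_compact; rewrite compact_cover.
move=> /(_ nat setT (fun n => ~` F n `|` \bigcup_(i in `I_n) W i)) [||D _ DU].
- move=> n _; apply: openU; first exact: closed_openC.
  by apply: bigcup_open => i _; exact: oW.
- move=> x _; have [Fx|] := pselect ((\bigcap_n F n) x).
    have [i _ Wx] := FW _ Fx; exists i.+1 => //; right; exists i => //=.
  by move=> /existsNP[n /not_implyP[_ nF]]; exists n => //; left.
have Fle m n : (m <= n)%N -> F n `<=` F m.
  move=> /subnKC <-; elim: (n - m)%N => [|k IH]; first by rewrite addn0.
  by rewrite addnS; exact: subset_trans (Fs _) IH.
exists (\max_(i <- finmap.enum_fset D) i)%N => x Fx.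
have [n /= nD nx] := DU x Logic.I.
have nm : (n <= \max_(i <- finmap.enum_fset D) i)%N by exact: leq_bigmax_seq.
case: nx => [nF|[i /= i_n Wx]]; first by exfalso; apply: nF; exact: Fle Fx.
by exists i => //=; exact: leq_trans i_n nm.
Qed.

Section Metric.
Context (R : realType).

(** The usual ultrametric, with the value 0 on the diagonal given by the case distinction. *)
Definition cantor_dist (x y : T) : R :=
  if pselect (exists n, mkseq x n <> mkseq y n) is left _
  then inf [set (2 ^+ n)^-1 | n in [set n | mkseq x n = mkseq y n]] else 0.

Lemma cantor_dist_le x y n : mkseq x n = mkseq y n -> cantor_dist x y <= (2 ^+ n)^-1.
Proof.
move=> xy; rewrite /cantor_dist; case: pselect => [_|_].
  apply: ge_inf; last by exists n.
  by exists 0 => _ [m _ <-]; rewrite invr_ge0 exprn_ge0.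
by rewrite invr_ge0 exprn_ge0.
Qed.

Lemma cantor_dist_ge x y n : mkseq x n.+1 <> mkseq y n.+1 ->
  (2 ^+ n)^-1 <= cantor_dist x y.
Proof.
move=> xy; rewrite /cantor_dist; case: pselect => [_|[]]; last by exists n.+1.
apply: lb_le_inf; first by exists 1; exists 0%N => //=; rewrite expr0 invr1.
move=> _ [m xym <-]; rewrite lef_pV2 ?posrE ?exprn_gt0// ler_weXn2l//.
  by rewrite ler1n.
by rewrite leqNgt; apply/negP => /mkseq_eq_le/(_ xym).
Qed.

Lemma cantor_distP x y n : (cantor_dist x y < (2 ^+ n)^-1) <-> mkseq x n.+1 = mkseq y n.+1.
Proof.
split=> [xy|/cantor_dist_le/le_lt_trans]; last first.
  apply; rewrite ltf_pV2 ?posrE ?exprn_gt0// exprS ltr_pMl ?exprn_gt0//.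
  by rewrite ltr1n.
by apply: contrapT => /cantor_dist_ge; rewrite leNgt xy.
Qed.

Lemma cantor_distxx x : cantor_dist x x = 0.
Proof. by rewrite /cantor_dist; case: pselect => // -[n []]. Qed.

Lemma cantor_dist_ge0 x y : 0 <= cantor_dist x y.
Proof.
have [->|/eqP xy] := eqVneq x y; first by rewrite cantor_distxx.
have [n xyn] : exists n, mkseq x n <> mkseq y n.
  apply: contrapT => h; apply: xy; apply: mkseq_funext => n.
  by apply: contrapT => xyn; apply: h; exists n.
case: n xyn => // n /cantor_dist_ge; apply: le_trans.
by rewrite invr_ge0 exprn_ge0.
Qed.

Lemma cantor_metrizes : metrizes (cantor_dist : T -> T -> R).
Proof.
have small (e : R) : 0 < e -> exists n, (2 ^+ n)^-1 < e.
  move=> e0; have [n /(_ n (leqnn n)) ne] := inv_small e0; exists n.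
  apply: le_lt_trans ne; rewrite lef_pV2 ?posrE ?exprn_gt0// -natrX ler_nat.
  exact: ltn_expl.
split; first split=> [x y|x y|x y z].
- split=> [xy|->]; last exact: cantor_distxx.
  apply: mkseq_funext => -[//|n]; apply/cantor_distP.
  by rewrite xy invr_gt0 exprn_gt0.
- rewrite /cantor_dist; case: pselect => [[n xy]|h]; case: pselect => [[m yx]|h'] //.
  + by congr inf; apply/seteqP; split=> _ [k /= h <-]; exists k.
  + by exfalso; apply: h'; exists n; exact: nesym.
  + by exfalso; apply: h; exists m; exact: nesym.
- suff : cantor_dist x z <= Num.max (cantor_dist x y) (cantor_dist y z).
    move=> /le_trans; apply; rewrite ge_max lerDl lerDr.
    by rewrite !cantor_dist_ge0.
  have [->|/eqP xz] := eqVneq x z; first by rewrite cantor_distxx le_max cantor_dist_ge0.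
  pose P n := mkseq x n.+1 != mkseq z n.+1.
  have [n Pn] : exists n, P n.
    apply: contrapT => h; apply: xz; apply: mkseq_funext => -[//|n].
    by apply: contrapT => /eqP xyn; apply: h; exists n.
  case: (ex_minnP (ex_intro _ n Pn)) => m /eqP Pm mmin.
  have agree : mkseq x m = mkseq z m.
    case: m Pm mmin => // m _ mmin; apply: contrapT => /eqP xzm.
    by have := mmin m xzm; rewrite ltnn.
  apply: (le_trans (cantor_dist_le agree)); rewrite leNgt gt_max.
  apply/negP => /andP[/cantor_distP xy /cantor_distP yz].
  by apply: Pm; rewrite xy.
move=> x; apply/seteqP; split=> N.
  rewrite nbhsE => -[V [/open_cylP oV Vx] VN]; have [n nV] := oV x Vx.
  exists (2 ^+ n)^-1; first by rewrite /= invr_gt0 exprn_gt0.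
  move=> y /= /cantor_distP xy; apply/VN/nV; rewrite /cyl/= size_mkseq.
  by rewrite (mkseq_eq_le (leqnSn n) xy).
move=> [e /= /small[n ne] eN].
have nx : nbhs x (cyl (mkseq x n) : set T).
  by apply: open_nbhs_nbhs; split; [exact: open_cyl|exact: cyl_mkseq].
apply: filterS nx => y; rewrite /cyl/= size_mkseq => yx; apply: eN => /=.
by apply: le_lt_trans ne; exact: cantor_dist_le.
Qed.

End Metric.

End CantorSpace.

(* The net measure of the binary tree in which a cylinder of length [k] has
   diameter [2 ^- (k./2)]; interleaving binary digits turns it into a measure
   equivalent to [H1] on the square. *)
Section NetMeasure.
Context (R : realType).
Local Notation T := cantor_space.
Local Notation rho k := ((2 ^+ k./2)^-1 : R).
Local Open Scope ereal_scope.
Implicit Types (A B : set T) (w : seq bool).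

Lemma rho_gt0 k : (0 < rho k)%R.
Proof. by rewrite invr_gt0 exprn_gt0. Qed.

Lemma rho_le k l : (k <= l)%N -> (rho l <= rho k)%R.
Proof.
move=> kl; rewrite lef_pV2 ?posrE ?exprn_gt0// ler_weXn2l ?half_leq//.
by rewrite ler1n.
Qed.

Lemma rho_small (e : R) : (0 < e)%R -> exists k, (rho k < e)%R.
Proof.
move=> e0; have [n /(_ n (leqnn n)) ne] := inv_small e0; exists n.*2.
rewrite doubleK; apply: le_lt_trans ne; rewrite lef_pV2 ?posrE ?exprn_gt0//.
by rewrite -natrX ler_nat ltn_expl.
Qed.

Definition cost n B : \bar R :=
  ereal_inf ([set y | y = 0 /\ B = set0] `|`
    [set (rho (size w))%:E | w in [set w | (n <= size w)%N /\ B `<=` cyl w]]).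

Lemma cost_ge0 n B : 0 <= cost n B.
Proof.
by apply: le_ereal_inf_tmp => _ [[-> _]|[w _ <-]].
Qed.

Lemma cost0 n : cost n set0 = 0.
Proof.
by apply: le_anti; rewrite cost_ge0 andbT; apply: ereal_inf_lbound; left.
Qed.

Lemma cost_cyl n B w : (n <= size w)%N -> B `<=` cyl w -> cost n B <= (rho (size w))%:E.
Proof. by move=> nw Bw; apply: ereal_inf_lbound; right; exists w. Qed.

Lemma cost_le n A B : A `<=` B -> cost n A <= cost n B.
Proof.
move=> AB; apply: le_ereal_inf_tmp => _ [[-> B0]|[w [nw Bw] <-]].
  by rewrite (_ : A = set0) ?cost0//; apply/seteqP; split=> // x /AB; rewrite B0.
by apply: cost_cyl => // x /AB/Bw.
Qed.

Lemma costS n B : cost n B <= cost n.+1 B.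
Proof.
apply: le_ereal_inf_tmp => _ [[-> B0]|[w [nw Bw] <-]]; first by rewrite B0 cost0.
by apply: cost_cyl => //; exact: ltnW.
Qed.

Lemma cost_lty n B : cost n B < +oo -> B = set0 \/
  exists2 w, (n <= size w)%N & B `<=` cyl w.
Proof.
move=> /ereal_inf_lt[_ [[_ B0]|[w [nw Bw] _]] _]; first by left.
by right; exists w.
Qed.

Lemma cost_rho k B : cost k B < (rho k)%:E -> cost k.+1 B <= cost k B.
Proof.
move=> Bk; have [_ [[-> B0]|[w [kw Bw] <-]] wk] := ereal_inf_lt Bk.
  by rewrite B0 !cost0.
have kw' : (k < size w)%N.
  by rewrite ltn_neqAle kw andbT; apply/eqP => kE; rewrite -kE ltxx in wk.
apply: le_ereal_inf_tmp => _ [[-> B0]|[v [kv Bv] <-]]; first by rewrite B0 cost0.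
have [kv'|kv'] := ltnP k (size v); first exact: cost_cyl.
have -> : size v = k by apply/eqP; rewrite eqn_leq kv' kv.
by apply: (le_trans (cost_cyl kw' Bw)); exact: ltW.
Qed.

Local Notation U := (g_sigma_algebraType (@setT (set T))).

(** The restriction to cylinders of length at least [n] sits in [cost], which is defined on
    arbitrary sets and infinite where no such cylinder fits. All sets are measurable in [U], so
    [mu_ext] ranges over arbitrary countable covers. *)
Definition content n (A : set T) : \bar R := mu_ext (cost n : set U -> \bar R) A.

Lemma measurable_all (A : set U) : measurable A.
Proof. exact: sub_sigma_algebra. Qed.

Lemma content_ge0 n A : 0 <= content n A.
Proof. by apply: mu_ext_ge0; exact: cost_ge0. Qed.

Lemma content0 n : content n set0 = 0.
Proof. by apply: mu_ext0; [exact: cost0|exact: cost_ge0]. Qed.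

Lemma content_sub n : sigma_subadditive (content n).
Proof. exact: (@mu_ext_sigma_subadditive _ U R (cost n) (cost_ge0 n)). Qed.

HB.instance Definition _ n := isOuterMeasure.Build R T (content n)
  (content0 n) (content_ge0 n) (fun A B => @le_mu_ext _ U R (cost n) A B)
  (content_sub n).

Lemma content_le n A B : A `<=` B -> content n A <= content n B.
Proof. exact: le_outer_measure. Qed.

Lemma content_cover n A (W : nat -> set T) : A `<=` \bigcup_i W i ->
  content n A <= \sum_(0 <= i <oo) cost n (W i).
Proof.
move=> AW; apply: ereal_inf_lbound; exists W => //; split=> // i.
exact: measurable_all.
Qed.

Lemma content_le_cost n A : content n A <= cost n A.
Proof.
have := @content_cover n A (fun i => if i is 0 then A else set0).
rewrite nneseries_recl//; last by move=> i _; exact: cost_ge0.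
rewrite eseries0 ?adde0; last by case=> // i _ _; exact: cost0.
by apply=> x Ax; exists 0%N.
Qed.

Lemma content_cyl n w : (n <= size w)%N -> content n (cyl w) <= (rho (size w))%:E.
Proof. by move=> nw; apply: (le_trans (content_le_cost _ _)); exact: cost_cyl. Qed.

Lemma content_lb n A c : (forall W : nat -> set T, A `<=` \bigcup_i W i ->
    c <= \sum_(0 <= i <oo) cost n (W i)) -> c <= content n A.
Proof. by move=> h; apply: le_ereal_inf_tmp => _ [W [_ AW] <-]; exact: h. Qed.

Lemma contentS n A : content n A <= content n.+1 A.
Proof.
apply: content_lb => W AW; apply: (le_trans (content_cover n AW)).
by apply: lee_nneseries => [i _ _|i _]; [exact: cost_ge0|exact: costS].
Qed.

Lemma content_mono m n A : (m <= n)%N -> content m A <= content n A.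
Proof.
move=> /subnKC <-; elim: (n - m)%N => [|k IH]; first by rewrite addn0.
by rewrite addnS (le_trans IH)// contentS.
Qed.

Lemma content_rho k A : content k A >= Order.min (rho k)%:E (content k.+1 A).
Proof.
apply: content_lb => W AW; rewrite ge_min.
have [[i Wi]|h] := pselect (exists i, (rho k)%:E <= cost k (W i)).
  rewrite (le_trans Wi)//.
  by apply: (@nneseries_term_le _ (fun i => cost k (W i)) i) => j; exact: cost_ge0.
apply/orP; right; apply: (le_trans (content_cover k.+1 AW)).
apply: lee_nneseries => [i _ _|i _]; first exact: cost_ge0.
apply: cost_rho; rewrite ltNge; apply/negP => Wi.
by apply: h; exists i.
Qed.

(** A cylinder of length at least [n] is either inside [cyl w] or disjoint from it. Hence the [n]-th
    content is exactly additive over cylinders of length at most [n]. *)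
Lemma cost_split n B w : (size w <= n)%N ->
  cost n (B `&` cyl w) + cost n (B `\` cyl w) <= cost n B.
Proof.
move=> wn; have [->|] := eqVneq (cost n B) +oo; first by rewrite leey.
rewrite -ltey => /cost_lty[->|[v nv Bv]].
  by rewrite set0I set0D cost0 adde0.
have [[x [Bx wx]]|h] := pselect (B `&` cyl w !=set0).
  rewrite (_ : B `\` cyl w = set0).
    by rewrite cost0 adde0; apply: cost_le => y [].
  apply/seteqP; split=> // y [By nwy]; apply: nwy.
  by apply: (cyl_subset (leq_trans wn nv) wx (Bv _ Bx)); exact: Bv.
rewrite (_ : B `&` cyl w = set0).
  by rewrite cost0 add0e; apply: cost_le => y [].
by apply/seteqP; split=> // y yB; apply: h; exists y.
Qed.

Lemma content_split n A w : (size w <= n)%N ->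
  content n A = content n (A `&` cyl w) + content n (A `\` cyl w).
Proof.
move=> wn; apply: le_anti; apply/andP; split.
  apply: (le_trans _ (outer_measureU2 _ _ _)); apply: content_le => x Ax.
  by have [wx|nwx] := pselect (cyl w x); [left|right].
apply: content_lb => W AW.
apply: (@le_trans _ _ (\sum_(0 <= i <oo) (cost n (W i `&` cyl w) + cost n (W i `\` cyl w)))).
  rewrite nneseriesD; last 2 first.
  - by move=> i _ _; exact: cost_ge0.
  - by move=> i _ _; exact: cost_ge0.
  apply: leeD; apply: content_cover.
  - by move=> x [/AW[i _ Wx] wx]; exists i.
  - by move=> x [/AW[i _ Wx] wx]; exists i.
apply: lee_nneseries => [i _ _|i _]; last exact: cost_split.
by apply: adde_ge0; exact: cost_ge0.
Qed.

Lemma cyl_rconsE w : cyl w = cyl (rcons w true) `|` cyl (rcons w false) :> set T.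
Proof.
apply/seteqP; split=> [x wx|x [/cyl_rcons[]//|/cyl_rcons[]//]].
by case E : (x (size w)); [left|right]; apply/cyl_rcons.
Qed.

Lemma content_node n A w : (size w < n)%N -> content n (A `&` cyl w) =
  content n (A `&` cyl (rcons w true)) + content n (A `&` cyl (rcons w false)).
Proof.
move=> wn; rewrite (@content_split n (A `&` cyl w) (rcons w true)) ?size_rcons//.
congr (content n _ + content n _); apply/seteqP; split=> x.
- by move=> [[Ax _] wx].
- by move=> [Ax wx]; split=> //; split=> //; case/cyl_rcons: wx.
- by move=> [[Ax wx] nx]; split=> //; move: wx; rewrite cyl_rconsE => -[].
- move=> [Ax /cyl_rcons[wx xf]]; split=> // /cyl_rcons[_].
  by rewrite xf.
Qed.

Lemma content_fin n A : content n A < +oo.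
Proof.
suff h m w : (size w + m = n)%N -> content n (cyl w) < +oo.
  apply: (@le_lt_trans _ _ (content n (cyl [::]))); last exact: (h n).
  by apply: content_le => x _; rewrite cyl_nil.
elim: m w => [|m IH] w wm.
  by rewrite (le_lt_trans (content_cyl _))// ?ltry// -wm addn0.
rewrite cyl_rconsE; apply: (le_lt_trans (outer_measureU2 _ _ _)).
by rewrite lte_add_pinfty// IH// size_rcons addSnnS.
Qed.

Lemma content_cylinders n A (e : R) : (0 < e)%R -> exists v : nat -> seq bool,
  [/\ forall i, (n <= size (v i))%N, A `<=` \bigcup_i cyl (v i) &
      \sum_(0 <= i <oo) (rho (size (v i)))%:E <= content n A + e%:E].
Proof.
move=> e0; have e20 : (0 < e / 2)%R by rewrite divr_gt0.
have cA : content n A \is a fin_num by rewrite ge0_fin_numE ?content_ge0 ?content_fin.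
have [_ [W [_ AW] <-] Wlt] := lb_ereal_inf_adherent e20 cA.
have c1 i : cost n (W i) < +oo.
  apply: (@le_lt_trans _ _ (\sum_(0 <= i <oo) cost n (W i))).
    by apply: (@nneseries_term_le _ (fun i => cost n (W i)) i) => j; exact: cost_ge0.
  by apply: (lt_le_trans Wlt); exact: leey.
pose d (i : nat) : R := (e / 2 / (2 ^ i.+1)%:R)%R.
have d0 i : (0 < d i)%R by rewrite divr_gt0// ltr0n expn_gt0.
have /choice[v vP] : forall i, exists w, [/\ (n <= size w)%N, W i `<=` cyl w &
    (rho (size w))%:E <= cost n (W i) + (d i)%:E].
  move=> i.
  have cf : cost n (W i) \is a fin_num by rewrite ge0_fin_numE ?cost_ge0.
  have [_ [[-> W0]|[w [nw Ww] <-]] hw] := lb_ereal_inf_adherent (d0 i) cf; last first.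
    by exists w; split=> //; exact: ltW.
  (* An empty member of the cover costs nothing but still needs a cylinder; a sufficiently long one
     costs less than its share [d i]. *)
  have [k kd] := rho_small (d0 i).
  exists (nseq (n + k) true); rewrite size_nseq leq_addr W0; split=> //.
  rewrite cost0 add0e lee_fin; apply: le_trans (ltW kd).
  exact/rho_le/leq_addl.
exists v; split.
- by move=> i; have [] := vP i.
- by move=> x /AW[i _ Wx]; exists i => //; have [_ + _] := vP i; exact.
apply: (@le_trans _ _ (\sum_(0 <= i <oo) (cost n (W i) + (d i)%:E))).
  apply: lee_nneseries => [i _ _|i _]; first by rewrite lee_fin ltW ?rho_gt0.
  by have [] := vP i.
rewrite nneseriesD; last 2 first.
- by move=> i _ _; exact: cost_ge0.
- by move=> i _ _; rewrite lee_fin ltW.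
rewrite [in leRHS](splitr e) EFinD addeA; apply: leeD; first exact: ltW.
exact: (epsilon_trick0 xpredT (ltW e20)).
Qed.

Definition net (A : set T) : \bar R := ereal_sup [set content n A | n in setT].

Lemma content_le_net n A : content n A <= net A.
Proof. by apply: ereal_sup_ubound; exists n. Qed.

Lemma net_le A c : (forall n, content n A <= c) -> net A <= c.
Proof. by move=> h; apply: ge_ereal_sup => _ [n _ <-]. Qed.

Lemma net_ge0 A : 0 <= net A.
Proof. exact: le_trans (content_ge0 0 A) (content_le_net 0 A). Qed.

Lemma net0 : net set0 = 0.
Proof.
by apply: le_anti; rewrite net_ge0 andbT; apply: net_le => n; rewrite content0.
Qed.

Lemma net_mono A B : A `<=` B -> net A <= net B.
Proof.
move=> AB; apply: net_le => n; apply: le_trans (content_le_net n B).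
exact: content_le.
Qed.

Lemma net_sub : sigma_subadditive net.
Proof.
move=> F; apply: net_le => n; apply: (le_trans (content_sub n F)).
by apply: lee_nneseries => [i _ _|i _]; [exact: content_ge0|exact: content_le_net].
Qed.

HB.instance Definition _ := isOuterMeasure.Build R T net net0 net_ge0 net_mono net_sub.

Lemma net_caratheodory_cyl w : caratheodory_measurable net (cyl w).
Proof.
apply: le_caratheodory_measurable => A; rewrite -setDE.
have [Aoo|] := ltP (net A) +oo; last first.
  by rewrite leye_eq => Aoo; apply: le_trans (leey _) _; rewrite leye_eq.
have fin B : B `<=` A -> net B \is a fin_num.
  by move=> BA; rewrite ge0_fin_numE ?net_ge0// (le_lt_trans (net_mono BA)).
have cfin n B : content n B \is a fin_num.
  by rewrite ge0_fin_numE ?content_ge0// content_fin.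
(* Additivity holds at a common large index, and both contents increase with the index. Keeping [m]
   and [n] independent allows the two suprema to be taken separately. *)
have mn m n : content m (A `&` cyl w) + content n (A `\` cyl w) <= net A.
  pose N := (maxn (maxn m n) (size w)).
  apply: (le_trans _ (content_le_net N A)).
  rewrite (@content_split N A w) ?leq_maxr//.
  apply: leeD; apply: content_mono; apply: (leq_trans _ (leq_maxl _ _)).
    exact: leq_maxl.
  exact: leq_maxr.
have IA : A `&` cyl w `<=` A by move=> x [].
rewrite addeC -leeBrDr ?fin//; apply: net_le => n.
rewrite leeBrDr ?fin// addeC -leeBrDr//; apply: net_le => m.
by rewrite leeBrDr.
Qed.

Lemma borel_caratheodory A : borel A -> caratheodory_measurable net A.
Proof.
move: A; apply: borel_cyl_ind => [w||A|F hF].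
- exact: net_caratheodory_cyl.
- exact: caratheodory_measurable_set0.
- exact: caratheodory_measurable_setC.
- exact: caratheodory_measurable_bigcup.
Qed.

Definition net_measure (A : set (g_sigma_algebraType (@open T))) : \bar R := net A.

Let net_measure0 : net_measure set0 = 0. Proof. exact: net0. Qed.

Let net_measure_ge0 A : 0 <= net_measure A. Proof. exact: net_ge0. Qed.

Let net_measure_semi_sigma_additive : semi_sigma_additive net_measure.
Proof.
move=> F mF tF mUF.
apply: (@caratheodory_measure_sigma_additive R T net F _ tF).
  by move=> n; apply: borel_caratheodory; exact: mF.
by apply: borel_caratheodory; exact: mUF.
Qed.

HB.instance Definition _ := isMeasure.Build _ _ _ net_measure
  net_measure0 net_measure_ge0 net_measure_semi_sigma_additive.

Lemma net_point (x : T) : net [set x] = 0.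
Proof.
apply: le_anti; rewrite net_ge0 andbT; apply: net_le => n.
apply/lee_addgt0Pr => e e0; rewrite add0e.
have [k ke] := rho_small e0.
apply: (@le_trans _ _ (content n (cyl (mkseq x (n + k))))).
  by apply: content_le => _ ->; exact: cyl_mkseq.
apply: (le_trans (content_cyl _)); rewrite size_mkseq ?leq_addr//.
by rewrite lee_fin ltW// (le_lt_trans _ ke)// rho_le// leq_addl.
Qed.

End NetMeasure.

(* Besicovitch's theorem for net measures: a closed set of infinite measure is
   pruned level by level, keeping the [k]-th content of its [k]-th stage nearly
   constant. *)
Section Besicovitch.
Context (R : realType).
Local Notation T := cantor_space.
Local Notation rho k := ((2 ^+ k./2)^-1 : R).
Implicit Types (A E : set T) (w u : seq bool).

Let r k A : R := fine (content R k A).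

Let contentE k A : content R k A = (r k A)%:E.
Proof. by rewrite fineK// ge0_fin_numE ?content_ge0// content_fin. Qed.

Let r_node k A w : (size w < k)%N ->
  r k (A `&` cyl w) = r k (A `&` cyl (rcons w true)) + r k (A `&` cyl (rcons w false)).
Proof. by move=> wk; apply: EFin_inj; rewrite EFinD -!contentE; exact: content_node. Qed.

Let r_cyl k A w : (k <= size w)%N -> r k (A `&` cyl w) <= rho (size w).
Proof.
move=> kw; rewrite -lee_fin -contentE; apply: le_trans (content_cyl _ kw).
by apply: content_le => x [].
Qed.

Let r_sub k A w : r k A <= r k (A `\` cyl w) + r k (A `&` cyl w).
Proof.
rewrite -lee_fin EFinD -!contentE.
apply: (le_trans _ (outer_measureU2 _ _ _)); apply: content_le => x Ax.
by have [wx|nwx] := pselect (cyl w x); [right|left].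
Qed.

Lemma words n : exists2 ws : seq (seq bool),
  (forall w, w \in ws -> size w = n) & forall w, size w = n -> w \in ws.
Proof.
exists [seq tval t | t <- enum {: n.-tuple bool}].
  by move=> _ /mapP[t _ ->]; rewrite size_tuple.
by move=> w /eqP wn; apply/mapP; exists (Tuple wn); rewrite ?mem_enum.
Qed.

Lemma closedDcyl A w : closed A -> closed (A `\` cyl w).
Proof. by move=> cA; rewrite setDE; apply: closedI => //; apply/open_closedC/open_cyl. Qed.

(** Cylinders of content at most [z] are removed one at a time until the content first drops to [v]
    or below; that last step overshoots by at most [z]. *)
Let trim k (v z : R) (ws : seq (seq bool)) A : 0 <= v ->
  (forall w, w \in ws -> (k <= size w)%N /\ rho (size w) <= z) ->
  closed A -> (forall x, A x -> exists2 w, w \in ws & cyl w x) -> v < r k A ->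
  exists A', [/\ closed A', A' `<=` A, r k A' <= v & v <= r k A' + z].
Proof.
move=> v0; elim: ws A => [|w ws IH] A wsz cA Aws vA.
  have A0 : A = set0 by apply/seteqP; split=> // x /Aws[].
  by move: vA; rewrite ltNge /r A0 content0 /= v0.
have [kw wz] := wsz w (mem_head _ _).
have := r_sub k A w; have := r_cyl A kw => hw hs.
have [Av|vA'] := leP (r k (A `\` cyl w)) v.
  exists (A `\` cyl w); split=> //; first exact: closedDcyl.
  apply: (le_trans (ltW vA)); apply: (le_trans hs); rewrite lerD2l.
  exact: le_trans hw wz.
have [|||A' [cA' A'A A'1 A'2]] := IH (A `\` cyl w) _ _ _ vA'.
- by move=> u uws; apply: wsz; rewrite inE uws orbT.
- exact: closedDcyl.
- move=> x [/Aws[u]]; rewrite inE => /orP[/eqP ->//|uws ux] _.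
  by exists u.
by exists A'; split=> //; move=> x /A'A[].
Qed.

(** By [content_rho] the contents of index [k] and [k.+1] agree unless the latter exceeds [rho k].
    In that case the former equals [rho k], and the set is trimmed down to it. *)
Let shrink k w A (z : R) : size w = k -> closed A -> A `<=` cyl w -> 0 < z ->
  exists A', [/\ closed A', A' `<=` A, r k.+1 A' <= r k A & r k A <= r k.+1 A' + z].
Proof.
move=> wk cA Aw z0.
have : rho k <= r k A \/ r k.+1 A <= r k A.
  have := content_rho R k A.
  by rewrite !contentE -EFin_min lee_fin ge_min => /orP.
have : r k A <= r k.+1 A by have := contentS R k A; rewrite !contentE lee_fin.
move=> kS kmin; have [h|h] := leP (r k.+1 A) (rho k).
  exists A; split=> //; first by case: kmin => // /(le_trans h).
  by rewrite (le_trans kS)// lerDl ltW.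
have rA : r k A = rho k.
  have := @r_cyl k A w; rewrite (setIidl Aw) wk => /(_ (leqnn k)) ?.
  by apply: le_anti; apply/andP; split=> //; case: kmin => // /(lt_le_trans h)/ltW.
have [l lz] := rho_small z0; have [ws ws1 ws2] := words (k.+1 + l).
have [|||A' [? ? ? ?]] := @trim k.+1 (rho k) z ws A _ _ cA _ h.
- by rewrite invr_ge0 exprn_ge0.
- move=> u /ws1 ->; rewrite leq_addr; split=> //.
  by apply: le_trans (ltW lz); exact/rho_le/leq_addl.
- by move=> x _; exists (mkseq x (k.+1 + l)); [exact/ws2/size_mkseq|exact: cyl_mkseq].
by exists A'; rewrite rA.
Qed.

(** [shrink] is applied inside every cylinder of length [k]. For shorter words additivity sums the
    estimates over descendants, whence the factor [2 ^+ (k - size w)] on the error. *)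
Let stage k E (z : R) : closed E -> 0 < z -> exists E', [/\ closed E', E' `<=` E &
  forall w, (size w <= k)%N -> r k.+1 (E' `&` cyl w) <= r k (E `&` cyl w) /\
    r k (E `&` cyl w) <= r k.+1 (E' `&` cyl w) + 2 ^+ (k - size w) * z].
Proof.
move=> cE z0.
have /choice[A' A'P] : forall w, exists A', size w = k ->
    [/\ closed A', A' `<=` E `&` cyl w, r k.+1 A' <= r k (E `&` cyl w) &
      r k (E `&` cyl w) <= r k.+1 A' + z].
  move=> w; have [wk|nwk] := eqVneq (size w) k; last first.
    by exists set0 => wk; rewrite wk eqxx in nwk.
  have [||A' A'P] := @shrink k w (E `&` cyl w) z wk _ _ z0; last by exists A'.
    by apply: closedI => //; exact: closed_cyl.
  by move=> x [].
(* Written as an intersection over the words of length [k], so that it is visibly closed; inside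
   each cylinder of that length it is the chosen [A' w]. *)
pose E' := \bigcap_(w in [set w | size w = k]) (~` cyl w `|` A' w).
have EA x : E' x -> A' (mkseq x k) x.
  move=> /(_ (mkseq x k)) []; [exact: size_mkseq|by case; exact: cyl_mkseq|by []].
have E'w w : size w = k -> E' `&` cyl w = A' w.
  move=> wk; have [_ A'w _ _] := A'P w wk.
  apply/seteqP; split=> [x [/EA xA wx]|x wx].
    by move: wx xA; rewrite /cyl/= wk => ->.
  have [Ex wx'] := A'w _ wx; split=> // u uk.
  have [ux|] := pselect (cyl u x); last by left.
  by right; move: ux wx'; rewrite /cyl/= uk wk => <- ->.
exists E'; split.
- apply: closed_bigI => w wk; apply: closedU.
    by apply: open_closedC; exact: open_cyl.
  by case: (A'P w wk).
- move=> x /EA xA.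
  by have [_ /(_ x xA)[Ex _] _ _] := A'P _ (size_mkseq x k).
move=> w wk; have := subnKC wk; move: (k - size w)%N => m.
elim: m w {wk} => [|m IH] w wm.
  rewrite addn0 in wm; rewrite E'w// expr0 mul1r.
  by case: (A'P w wm).
have wk : (size w < k)%N by rewrite -wm addnS ltnS leq_addr.
have /IH[IH1 IH2] : (size (rcons w true) + m = k)%N by rewrite size_rcons addSnnS.
have /IH[IH3 IH4] : (size (rcons w false) + m = k)%N by rewrite size_rcons addSnnS.
rewrite (r_node E' (ltnW wk : (size w < k.+1)%N)) (r_node E wk).
split; first exact: lerD.
apply: (le_trans (lerD IH2 IH4)).
by rewrite addrACA lerD2l exprS -mulr2n -[leRHS]mulrA mulr_natl.
Qed.

Theorem besicovitch E (c : R) : closed E -> net R E = +oo%E ->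
  exists E', [/\ closed E', E' `<=` E, (c%:E < net R E')%E & (net R E' < +oo)%E].
Proof.
move=> cE Eoo.
(* Of the margin 3, one unit is lost in the pruning, one in the cover by cylinders, and one remains
   for the strict inequality. *)
have [_ [n0 _ <-]] : exists2 y, [set content R n E | n in setT] y & ((c + 3)%:E < y)%E.
  by apply: ereal_sup_gt; rewrite -/(net R E) Eoo ltry.
rewrite contentE lte_fin => cr.
(* Stage [i] multiplies the error by [2 ^ (n0 + i)], so its loss is [2 ^- (i + 1)] and all losses
   together stay below 1. *)
pose z i : R := (2 ^+ (n0 + i))^-1 * (2 ^+ i.+1)^-1.
have z0 i : 0 < z i by rewrite mulr_gt0// invr_gt0 exprn_gt0.
have /choice[f fP] : forall iB : nat * set T, exists E', closed iB.2 ->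
    [/\ closed E', E' `<=` iB.2 & forall w, (size w <= n0 + iB.1)%N ->
      r (n0 + iB.1).+1 (E' `&` cyl w) <= r (n0 + iB.1) (iB.2 `&` cyl w) /\
      r (n0 + iB.1) (iB.2 `&` cyl w) <= r (n0 + iB.1).+1 (E' `&` cyl w) +
         2 ^+ (n0 + iB.1 - size w) * z iB.1].
  move=> [i B]; have [cB|ncB] := pselect (closed B); last by exists set0.
  by have [E' E'P] := stage (n0 + i) cB (z0 i); exists E'.
pose S := fix S i := if i is j.+1 then f (j, S j) else E.
have cS i : closed (S i) by elim: i => //= i /(fP (i, S i))[].
have SP i := fP (i, S i) (cS i).
have Ss i : S i.+1 `<=` S i by case: (SP i).
have Sle i j : (i <= j)%N -> S j `<=` S i.
  move=> /subnKC <-; elim: (j - i)%N => [|k IH]; first by rewrite addn0.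
  by rewrite addnS; exact: subset_trans (Ss _) IH.
have IT k A : r k A = r k (A `&` cyl [::]).
  by congr (r k _); apply/seteqP; split=> [x Ax|x []//]; split=> //; rewrite cyl_nil.
have up i : r (n0 + i) (S i) <= r n0 E.
  elim: i => [|i IH]; first by rewrite addn0.
  have [_ _ /(_ [::]) []// h _] := SP i.
  by apply: le_trans IH; rewrite addnS IT [leRHS]IT.
have low i : r n0 E <= r (n0 + i) (S i) + (1 - (2 ^+ i)^-1).
  elim: i => [|i IH]; first by rewrite addn0 expr0 invr1 subrr addr0.
  have [_ _ /(_ [::]) []// _] := SP i; rewrite /= -!IT subn0 -addnS /z mulrA mulfV; last first.
    by rewrite expf_neq0.
  have i2 : (2 ^+ i)^-1 = 2 * (2 ^+ i.+1)^-1 :> R.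
    by rewrite exprS invfM mulrA mulfV ?mul1r.
  move: IH; rewrite i2 mul1r; move: (2 ^+ i.+1)^-1 => q.
  by move: (r n0 E) (r (n0 + i)%N _) (r (n0 + i.+1)%N _) => x y t; lra.
(* The bound holds trivially when the stage reaches the length of [w] and is never spoiled later, as
   contents inside [cyl w] do not increase from then on. It plays the role of the mass distribution
   principle below. *)
have upw i w : (n0 <= size w <= n0 + i)%N -> r (n0 + i) (S i `&` cyl w) <= rho (size w).
  move=> /andP[nw]; elim: i => [|i IH] wi; first by apply: r_cyl; rewrite addn0.
  move: wi; rewrite leq_eqVlt => /orP[/eqP wi|wi].
    by apply: r_cyl; rewrite wi.
  rewrite addnS ltnS in wi.
  have [_ _ /(_ w wi) [h _]] := SP i; apply: le_trans (IH wi).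
  by rewrite addnS.
exists (\bigcap_i S i); split.
- by apply: closed_bigI.
- by move=> x /(_ 0%N Logic.I).
- apply: (@lt_le_trans _ _ (c + 1)%:E); first by rewrite lte_fin; lra.
  apply: le_trans (content_le_net R n0 _).
  have [v [vn Sv vs]] := content_cylinders n0 (\bigcap_i S i) (@ltr01 R).
  (* Compactness moves the cover from the intersection to one stage [S N], with finitely many
     cylinders; a later stage [S j] then has all their lengths within the range of [upw]. *)
  have [|N SN] := @decreasing_closed_cover S (fun i => cyl (v i)) cS Ss (fun i => open_cyl _).
    exact: Sv.
  pose j := (N + \max_(i < N) size (v i))%N.
  have vj i : (i < N)%N -> (size (v i) <= n0 + j)%N.
    move=> iN; rewrite /j addnCA; apply: leq_trans (leq_addl _ _).
    apply: leq_trans (leq_addl _ _).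
    exact: (@leq_bigmax _ (fun i : 'I_N => size (v i)) (Ordinal iN)).
  have rj : r (n0 + j) (S j) <= \sum_(0 <= i < N) rho (size (v i)).
    have h M A : (A `<=` \bigcup_(i in `I_M) cyl (v i)) ->
        r (n0 + j) A <= \sum_(0 <= i < M) r (n0 + j) (A `&` cyl (v i)).
      elim: M A => [|M IH] A AM.
        rewrite big_geq// (_ : A = set0) /r ?content0//.
        by apply/seteqP; split=> // x /AM[].
      rewrite big_nat_recr//=; apply: (le_trans (r_sub _ _ (v M))).
      rewrite lerD2r; apply: (le_trans (IH _ _)) => [x [/AM[i /= + ix] nx]|].
        rewrite ltnS leq_eqVlt => /orP[/eqP iM|iM]; last by exists i.
        by rewrite iM in ix.
      apply: ler_sum => i _; rewrite -lee_fin -!contentE; apply: content_le.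
      by move=> x [[]].
    apply: (le_trans (h N (S j) _)).
      by apply: subset_trans SN; apply: Sle; exact: leq_addr.
    rewrite !big_mkord; apply: ler_sum => i _; apply: upw.
    by rewrite vj// andbT vn.
  have s1 : ((\sum_(0 <= i < N) rho (size (v i)))%:E <= \sum_(0 <= i <oo) (rho (size (v i)))%:E)%E.
    rewrite -sumEFin; apply: nneseries_lim_ge => i _ _.
    by rewrite lee_fin ltW ?rho_gt0.
  rewrite -(leeD2rE (x := 1%:E))// -EFinD; apply: le_trans vs; apply: le_trans s1.
  have q0 : 0 < (2 ^+ j)^-1 :> R by rewrite invr_gt0 exprn_gt0.
  move: rj (low j) cr q0; rewrite lee_fin.
  move: (\sum_(_ <= i < _) _) (2 ^+ j)^-1 (r n0 E) (r (n0 + j)%N _).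
  by move=> *; lra.
- apply: (@le_lt_trans _ _ (r n0 E)%:E); last by rewrite ltry.
  apply: net_le => k; apply: (le_trans (content_mono R _ (leq_addl n0 k))).
  rewrite contentE lee_fin; apply: le_trans (up k).
  rewrite -lee_fin -!contentE; apply: content_le => x; exact.
Qed.

End Besicovitch.

(** * Models for the net measure *)

Section NetModels.
Context (R : realType).
Local Notation T := cantor_space.
Local Notation rho k := ((2 ^+ k./2)^-1 : R).
Local Open Scope ereal_scope.

Let piece_size (s : seq nat) : R := ((2 ^+ (size s).-1)^-1 / (2 ^ (pickle s).+1)%:R)%R.

Let small_piece (s : seq nat) (V : set T) := exists w,
  [/\ (size s <= size w)%N, (rho (size w) <= piece_size s)%R & V `<=` cyl w].

Let pieces_null (C : seq nat -> set T) :
  (forall s i, small_piece (rcons s i) (C (rcons s i))) -> net R (pieces C) = 0.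
Proof.
move=> Cs; apply: le_anti; rewrite net_ge0 andbT; apply: net_le => m.
apply/lee_addgt0Pr => e e0; rewrite add0e.
have [k ke] := rho_small e0; pose n := (m + k)%N.
have ne : ((2 ^+ n)^-1 <= e)%R.
  apply: le_trans (ltW ke); rewrite lef_pV2 ?posrE ?exprn_gt0// ler_weXn2l//.
    by rewrite ler1n.
  by rewrite /n; lia.
apply: (@le_trans _ _ (2 ^+ n)^-1%:E); last by rewrite lee_fin.
have n0 : (0 <= (2 ^+ n)^-1 :> R)%R by rewrite invr_ge0 exprn_ge0.
pose G j : set T := if pickle_inv j is Some s then
  if size s == n.+1 then C s else set0 else set0.
apply: (le_trans _ (epsilon_trick0 xpredT n0)).
apply: (le_trans (@content_cover R m _ G _)).
  move=> x xC; have [s sn Cx] := xC n.+1 Logic.I.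
  by exists (pickle s) => //; rewrite /G pickleK_inv (eqP (introT eqP sn)) eqxx.
apply: lee_nneseries => [j _ _|j _]; first exact: cost_ge0.
rewrite /G; case E : (pickle_inv j : option (seq nat)) => [s|]; last first.
  by rewrite cost0 lee_fin divr_ge0.
case: eqP => [sn|_]; last by rewrite cost0 lee_fin divr_ge0.
have jE : j = pickle s by rewrite -[j](pickle_invK (T := seq nat)) E.
case/lastP: s => [|t i] in E sn jE *; first by [].
have [w [sw wr Cw]] := Cs t i; rewrite sn in sw.
apply: (le_trans (@cost_cyl R m _ w _ Cw)).
  by apply: leq_trans sw; rewrite ltnW// ltnS leq_addr.
by rewrite lee_fin (le_trans wr)// /piece_size sn jE.
Qed.

(** [besicovitch] plays the part that [semifinite_large] has for nonatomic measures. The range comes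
    out null because the piece of each node is confined to a cylinder of tiny cost. *)
Lemma net_densely_modelled :
  densely_modelled (compact_fin (net R)) (fun v : \bar R => v < +oo).
Proof.
have cT : compact [set: T] by exact: cantor_space_compact.
have dT := cantor_metrizes R.
have [code codeP] := pieces_code dT cT.
exists code => B bB nB.
have [Y cY nY|s x|C [g [gB [cC gE] Cf gm _]]] :=
    @model_exists _ T _ dT cT (net_measure R) (net_point R)
      (compact_fin (net R)) (fun a => a = 1%R) _ small_piece _ B bB nB.
- have Yoo : net R Y = +oo.
    apply/eqP; rewrite -leye_eq leNgt; apply/negP => Yoo; apply: nY.
    by apply: covered_in; split=> //; exact: (closed_compactX cT).
  have [E [cE EY E2 Eoo]] := besicovitch 2 cY Yoo.
  by exists E, 1%R; split=> //; [exact: closed_mble|split=> //; rewrite mulr1].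
- have e0 : (0 < piece_size s)%R.
    by rewrite divr_gt0 ?invr_gt0 ?exprn_gt0// ltr0n expn_gt0.
  have [k ke] := rho_small e0; pose n := (size s + k)%N.
  exists (2 ^+ n)^-1%R; first by rewrite invr_gt0 exprn_gt0.
  move=> V Vx; exists (mkseq x n); rewrite size_mkseq leq_addr; split=> //.
    by apply: le_trans (ltW ke); exact/rho_le/leq_addl.
  move=> y /Vx /= /cantor_distP xy.
  by rewrite /cyl/= size_mkseq (mkseq_eq_le (leqnSn n) xy).
exists g; split=> //; last by have [c cE] := codeP C cC; exists c; rewrite gE.
by apply: gm => //=; rewrite /net_measure gE pieces_null// ltry.
Qed.

End NetModels.

(** * Hausdorff measure on the square *)

Section BinaryExpansion.
Context (R : realType).
Implicit Types (b : nat -> bool) (x : R).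

Fixpoint numerator b n : nat :=
  if n is n'.+1 then (b n' + (numerator b n').*2)%N else 0.

Lemma numerator_mkseq b b' n :
  mkseq b n = mkseq b' n <-> numerator b n = numerator b' n.
Proof.
elim: n => [|n IH] //; rewrite !mkseqS_rcons; split=> /=.
  by move=> /rcons_inj[/IH -> ->].
by move=> h; rewrite (_ : b n = b' n) ?(IH.2 _)//; move: h; case: (b n) (b' n) => -[] /=; lia.
Qed.

Definition bval b : R := sup [set (numerator b n)%:R / 2 ^+ n | n in setT].

Let numS b n : (numerator b n).+1%:R = (numerator b n)%:R + 1 :> R.
Proof. by rewrite natr1. Qed.

Let num_step b n :
  (numerator b n.+1)%:R = (b n)%:R + 2 * (numerator b n)%:R :> R.
Proof. by rewrite /= natrD -muln2 natrM mulrC. Qed.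

Let pow0 n : 0 < 2 ^+ n :> R. Proof. by rewrite exprn_gt0. Qed.

Let numerator_up b m n : (numerator b m)%:R / 2 ^+ m <= (numerator b (m + n)).+1%:R / 2 ^+ (m + n) - (2 ^+ (m + n))^-1 :> R.
Proof.
elim: n => [|n IH]; first by rewrite addn0 numS mulrDl mul1r addrK.
apply: (le_trans IH); rewrite addnS !numS num_step exprS invfM.
have : 0 <= (b (m + n)%N)%:R / 2 ^+ (m + n) :> R by rewrite divr_ge0 // ltW.
by move: (2 ^+ _)^-1 (b _)%:R (numerator b _)%:R => q v u; lra.
Qed.

Let numerator_down b m n : (numerator b (m + n)).+1%:R / 2 ^+ (m + n) <= (numerator b m).+1%:R / 2 ^+ m :> R.
Proof.
elim: n => [|n IH]; first by rewrite addn0.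
apply: le_trans IH; rewrite addnS !numS num_step exprS invfM.
have : (b (m + n)%N)%:R / 2 ^+ (m + n) <= 1 / 2 ^+ (m + n) :> R.
  by rewrite ler_pM2r ?invr_gt0//; case: (b _).
by move: (2 ^+ _)^-1 (b _)%:R (numerator b _)%:R => q v u; lra.
Qed.

Let numerator_le b m n : (numerator b m)%:R / 2 ^+ m <= (numerator b n).+1%:R / 2 ^+ n :> R.
Proof.
have [/subnKC <-|/ltnW/subnKC <-] := leqP m n; last first.
  apply: le_trans (numerator_down b n (m - n)).
  by rewrite ler_pM2r ?invr_gt0// ler_nat.
apply: (le_trans (numerator_up b m (n - m))); rewrite gerBl invr_ge0 ltW//.
Qed.

Lemma bval_ge b n : (numerator b n)%:R / 2 ^+ n <= bval b.
Proof.
apply: ub_le_sup; last by exists n.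
by exists ((numerator b 0).+1%:R / 2 ^+ 0) => _ [m _ <-].
Qed.

Lemma bval_le b n : bval b <= (numerator b n).+1%:R / 2 ^+ n.
Proof.
apply: ge_sup; first by exists ((numerator b 0)%:R / 2 ^+ 0), 0%N.
by move=> _ [m _ <-].
Qed.

Lemma bval_unit b : @unit_interval R (bval b).
Proof.
rewrite /unit_interval/= in_itv/=.
have := bval_ge b 0; have := bval_le b 0.
by rewrite /= expr0 !divr1 => -> ->.
Qed.

Lemma bval_near b b' n : mkseq b n = mkseq b' n -> `|bval b - bval b'| <= (2 ^+ n)^-1.
Proof.
move=> /numerator_mkseq bb'.
have := bval_ge b n; have := bval_le b n; have := bval_ge b' n; have := bval_le b' n.
rewrite bb' !numS !mulrDl mul1r ler_norml; move: (bval b) (bval b') => x y.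
by move: (2 ^+ n)^-1 ((numerator b' n)%:R / 2 ^+ n) => q u *; apply/andP; split; lra.
Qed.

(** One unit accounts for the distance of the two values, the other for the width of the dyadic
    interval containing [bval b']. *)
Lemma numerator_near b b' n : `|bval b - bval b'| <= (2 ^+ n)^-1 ->
  (numerator b n <= (numerator b' n).+2)%N.
Proof.
move=> h; have := le_trans (ler_norm _) h; move=> {}h.
rewrite -(ler_nat R) -(ler_pM2r (_ : 0 < (2 ^+ n)^-1)) ?invr_gt0//.
have := bval_ge b n; have := bval_le b' n.
rewrite -[(_.+1).+1%:R]natr1 mulrDl mul1r; move: h.
move: (bval b) (bval b') => x y.
by move: (2 ^+ n)^-1 ((numerator b n)%:R / 2 ^+ n) ((numerator b' n).+1%:R / 2 ^+ n) => q u v *; lra.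
Qed.

(** The orbit under the doubling map with greedy digits. The point 1 is fixed, so the closed
    interval is invariant and 1 has the expansion with all digits 1. *)
Fixpoint remainder x n : R :=
  if n is n'.+1 then 2 * remainder x n' - (2^-1 <= remainder x n')%R%:R else x.

Definition digits x n : bool := 2^-1 <= remainder x n.

Lemma remainder_unit x n : @unit_interval R x -> @unit_interval R (remainder x n).
Proof.
rewrite /unit_interval/= => x01; elim: n => //= n; rewrite !in_itv/= => /andP[r0 r1].
by case: (leP 2^-1) => h /=; apply/andP; split; lra.
Qed.

Lemma digitsK x : @unit_interval R x -> bval (digits x) = x.
Proof.
move=> x01.
have xE n : x = ((numerator (digits x) n)%:R + remainder x n) / 2 ^+ n.
  elim: n => [|n IH]; first by rewrite /= add0r expr0 divr1.
  rewrite {1}IH num_step /= -/(digits x n) exprS invfM.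
  by move: (2 ^+ n)^-1 (remainder x n) => q r; field.
have near n : `|bval (digits x) - x| <= (2 ^+ n)^-1.
  have := remainder_unit n x01; rewrite /unit_interval/= in_itv/= => /andP[r0 r1].
  have := bval_ge (digits x) n; have := bval_le (digits x) n.
  have q0 : 0 <= (2 ^+ n)^-1 :> R by rewrite invr_ge0 ltW.
  rewrite ler_norml numS [X in _ - X](xE n) !mulrDl mul1r.
  have : 0 <= remainder x n / 2 ^+ n by rewrite mulr_ge0.
  have : remainder x n / 2 ^+ n <= (2 ^+ n)^-1 by rewrite ler_piMl.
  move: (bval _) (2 ^+ n)^-1 (remainder x n / 2 ^+ n) ((numerator _ n)%:R / 2 ^+ n) => p q u v.
  by move=> *; apply/andP; split; lra.
apply/eqP; rewrite -subr_eq0 -normr_le0 leNgt; apply/negP => h.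
have [n /(_ n (leqnn n)) ne] := inv_small h.
have := near n; rewrite leNgt => /negP; apply; apply: le_lt_trans ne.
by rewrite lef_pV2 ?posrE// -natrX ler_nat ltn_expl.
Qed.

Lemma borel_remainder (Y : topologicalType) (f : Y -> R) :
  (forall c, borel [set y | c <= f y]) ->
  forall n c, borel [set y | c <= remainder (f y) n].
Proof.
move=> hf; elim=> [|n IH] c; first exact: hf.
have -> : [set y | c <= remainder (f y) n.+1] =
    ([set y | 2^-1 <= remainder (f y) n] `&` [set y | (c + 1) / 2 <= remainder (f y) n])
    `|` (~` [set y | 2^-1 <= remainder (f y) n] `&` [set y | c / 2 <= remainder (f y) n]).
  apply/seteqP; split=> y /=; case: (leP 2^-1) => h /=.
  - by move=> ?; left; split=> //; lra.
  - by move=> ?; right; split; [exact/negP|lra].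
  - by move=> [[_ ?]|[]//]; lra.
  - by move=> [[]//|[_ ?]]; lra.
apply: borelU; apply: borelI; try exact: IH.
by apply: borelC; exact: IH.
Qed.

End BinaryExpansion.

Lemma continuous_borel (X Y : topologicalType) (f : X -> Y) (B : set Y) :
  continuous f -> borel B -> borel (f @^-1` B).
Proof.
move=> cf; move: B; apply: g_sigma_ind => [V oV||A|F].
- by apply: sub_sigma_algebra; exact: open_comp.
- exact: sigma_algebra0.
- exact: borelC.
- by move=> mF; rewrite preimage_bigcup; exact: sigma_algebra_bigcup.
Qed.

(** * Interleaving the binary digits of the two coordinates *)

Section Interleave.
Context (R : realType).
Local Notation T := cantor_space.
Local Notation rho k := ((2 ^+ k./2)^-1 : R).
Local Notation square := (set_type (@unit_square R)).
Implicit Types (t : T) (p q : square).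

Definition evens t : nat -> bool := fun n => t n.*2.
Definition odds t : nat -> bool := fun n => t n.*2.+1.
Definition interleave (x y : nat -> bool) : T :=
  fun n => if odd n then y n./2 else x n./2.

Lemma evensK x y : evens (interleave x y) = x.
Proof. by apply/funext => n; rewrite /evens /interleave odd_double doubleK. Qed.

Lemma oddsK x y : odds (interleave x y) = y.
Proof. by apply/funext => n; rewrite /odds /interleave /= odd_double /= uphalf_double. Qed.

Lemma mkseq_interleave t t' m : mkseq t m.*2 = mkseq t' m.*2 <->
  mkseq (evens t) m = mkseq (evens t') m /\ mkseq (odds t) m = mkseq (odds t') m.
Proof.
elim: m => [|m IH] //; rewrite doubleS !mkseqS_rcons; split.
  by move=> /rcons_inj[/rcons_inj[/IH[-> ->] h1] h2]; split; congr rcons.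
move=> [/rcons_inj[h1 h2] /rcons_inj[h3 h4]].
by congr (rcons (rcons _ _) _) => //; apply/IH.
Qed.

Fact square_point_subproof t : @unit_square R (bval R (evens t), bval R (odds t)).
Proof. by split; exact: bval_unit. Qed.

Definition square_point t : square := SigSub (mem_set (square_point_subproof t)).

Lemma square_point_near t t' m : mkseq t m.*2 = mkseq t' m.*2 ->
  `|(val (square_point t)).1 - (val (square_point t')).1| <= (2 ^+ m)^-1 /\
  `|(val (square_point t)).2 - (val (square_point t')).2| <= (2 ^+ m)^-1.
Proof. by move=> /mkseq_interleave[h1 h2]; split; exact: bval_near. Qed.

Lemma square_point_continuous : continuous square_point.
Proof.
move=> t N /nbhs_set_typeP[M /nbhs_ballP[e /= e0 eM] MN].
have [n /(_ n (leqnn n)) ne] := inv_small e0.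
have nt : nbhs t (cyl (mkseq t n.*2) : set T).
  by apply: open_nbhs_nbhs; split; [exact: open_cyl|exact: cyl_mkseq].
have en : (2 ^+ n)^-1 < e.
  apply: le_lt_trans ne; rewrite lef_pV2 ?posrE ?exprn_gt0// -natrX ler_nat.
  exact: ltn_expl.
apply: filterS nt => t'; rewrite /cyl/= size_mkseq => tt'; apply/MN/eM.
have [h1 h2] := square_point_near (esym tt').
by split; [apply: le_lt_trans h1 en|apply: le_lt_trans h2 en].
Qed.

Lemma square_compact_closed (K : set square) : compact K -> closed K.
Proof.
move=> cK.
have cvK : compact [set val p | p in K].
  apply: continuous_compact => //; apply: continuous_subspaceT.
  exact: initial_continuous.
have -> : K = val @^-1` [set val p | p in K].
  by apply/seteqP; split=> [p Kp|p [q Kq /val_inj <-]//]; exists p.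
apply: closed_comp; last by apply: compact_closed => //; exact: norm_hausdorff.
by move=> p _; exact: initial_continuous.
Qed.

Definition square_code p : T :=
  interleave (digits (val p).1) (digits (val p).2).

Lemma square_codeK : cancel square_code square_point.
Proof.
move=> p; apply: val_inj; have [h1 h2] : @unit_square R (val p) := set_mem (valP p).
by rewrite /= evensK oddsK (digitsK h1) (digitsK h2) -surjective_pairing.
Qed.

Lemma borel_coord (f : R * R -> R) (c : R) : continuous f ->
  borel [set p : square | c <= f (val p)].
Proof.
move=> cf; rewrite -[X in borel X]setCK; apply: borelC; apply: sub_sigma_algebra.
apply: closed_openC; have -> : [set p : square | c <= f (val p)] =
  (f \o val) @^-1` [set x | c <= x] by [].
apply: closed_comp; last exact: closed_ge.
move=> p _; apply: continuous_comp; last exact: cf.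
exact: initial_continuous.
Qed.

Lemma borel_square_code A : borel A -> borel (square_code @^-1` A).
Proof.
have bit n (a : bool) : borel [set p | square_code p n = a].
  have true_case : borel [set p | square_code p n].
    have -> : [set p | square_code p n] = [set p : square |
        2^-1 <= remainder (if odd n then (val p).2 else (val p).1) n./2].
      by rewrite /square_code/interleave/digits; case: (odd n).
    apply: (@borel_remainder R _ (fun p : square => if odd n then (val p).2 else (val p).1)).
    by move=> c; case: (odd n); apply: borel_coord => x; [exact: cvg_snd|exact: cvg_fst].
  case: a => //; rewrite (_ : mkset _ = ~` [set p | square_code p n]).
    exact: borelC.
  by apply/seteqP; split=> p /=; [move=> ->|move=> /negP/negbTE].
move: A; apply: borel_cyl_ind => [w||A|F].
- elim/last_ind: w => [|w a IH].
    by rewrite cyl_nil preimage_setT; exact: g_sigmaT.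
  have -> : square_code @^-1` cyl (rcons w a) =
      square_code @^-1` cyl w `&` [set p | square_code p (size w) = a].
    by apply/seteqP; split=> p /cyl_rcons.
  exact: borelI.
- exact: sigma_algebra0.
- exact: borelC.
- by move=> mF; rewrite preimage_bigcup; exact: sigma_algebra_bigcup.
Qed.

(** A point with a dyadic coordinate can have several codes. This set keeps the greedy one, so that
    [square_point] restricted to it is a bijection onto the square with Borel inverse. *)
Definition coded : set T := [set t | square_code (square_point t) = t].

Lemma borel_coded : borel coded.
Proof.
have -> : coded = \bigcap_n [set t | square_code (square_point t) n = t n].
  apply/seteqP; split=> [t ct n _|t ct]; first by rewrite /= ct.
  by apply/funext => n; exact: ct.
apply: g_sigma_bigcap => n _.
have bt (a : bool) : borel [set t : T | t n = a].
  by apply: sub_sigma_algebra; exact: open_coord.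
have bc (a : bool) : borel [set t | square_code (square_point t) n = a].
  apply: (@continuous_borel _ _ _ (square_code @^-1` [set t | t n = a])).
    exact: square_point_continuous.
  by apply: borel_square_code.
have -> : [set t | square_code (square_point t) n = t n] =
    ([set t | square_code (square_point t) n = true] `&` [set t | t n = true]) `|`
    ([set t | square_code (square_point t) n = false] `&` [set t | t n = false]).
  apply/seteqP; split=> t /=; last by case=> -[-> ->].
  by case: (t n) => ->; [left|right].
by apply: borelU; apply: borelI.
Qed.

(** Direct images of sets of greedy codes are preimages under [square_code], hence Borel by
    [borel_square_code]. *)
Lemma coded_image A : A `<=` coded -> square_point @` A = square_code @^-1` A.
Proof.
move=> Ac; apply/seteqP; split=> [_ [t At <-]|p Ap]; first by rewrite /= (Ac _ At).
by exists (square_code p) => //; exact: square_codeK.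
Qed.

End Interleave.

(** * Comparison of [H1] with the net measure *)

Section HausdorffSquare.
Context (R : realType).
Local Notation T := cantor_space.
Local Notation rho k := ((2 ^+ k./2)^-1 : R).
Local Notation square := (set_type (@unit_square R)).
Local Notation dist := (@euclidean_dist R).
Local Notation sqp := (square_point R).
Local Open Scope ereal_scope.
Implicit Types (t : T) (p q : square).

Let dist_le p q (d : R) : (`|(val p).1 - (val q).1| <= d -> `|(val p).2 - (val q).2| <= d ->
  dist p q <= 2 * d)%R.
Proof.
move=> h1 h2; have d0 : (0 <= d)%R by exact: le_trans h1.
rewrite -[leRHS]ger0_norm ?mulr_ge0// -sqrtr_sqr /euclidean_dist ler_wsqrtr//.
have sq (x : R) : (`|x| <= d)%R -> (x ^+ 2 <= d ^+ 2)%R.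
  by move=> xd; rewrite -[(x ^+ 2)%R]real_normK ?num_real// lerXn2r ?nnegrE.
have := sq _ h1; have := sq _ h2; have : (0 <= d ^+ 2)%R by rewrite sqr_ge0.
by rewrite exprMn; move: (_ ^+ 2)%R (_ ^+ 2)%R (d ^+ 2)%R => *; lra.
Qed.

Let dist_ge p q : (`|(val p).1 - (val q).1| <= dist p q)%R /\
  (`|(val p).2 - (val q).2| <= dist p q)%R.
Proof.
by rewrite -!sqrtr_sqr /euclidean_dist; split; apply: ler_wsqrtr;
  rewrite ?lerDl ?lerDr sqr_ge0.
Qed.

Let dist_diam (U : set square) p q : U p -> U q -> (dist p q)%:E <= diam dist U.
Proof. by move=> Up Uq; apply: ereal_sup_ubound; right; exists p => //; exists q. Qed.

Let diam_ge0 (U : set square) : 0 <= diam dist U.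
Proof. by apply: ereal_sup_ubound; left. Qed.

Let diam_cyl w : diam dist (sqp @` cyl w) <= (2 * rho (size w))%:E.
Proof.
apply: ge_ereal_sup => _ [->|[_ [t tw <-] [_ [t' tw' <-] <-]]].
  by rewrite lee_fin mulr_ge0// invr_ge0 exprn_ge0.
have kw : ((size w)./2.*2 <= size w)%N by lia.
have [h1 h2] := square_point_near R (mkseq_eq_le kw (cyl_eqP tw tw')).
by rewrite lee_fin dist_le.
Qed.

(** The image of a cylinder of length [k] has both coordinates determined up to [rho k], hence
    diameter at most [2 * rho k], so cylinder covers map to covers at twice the cost. *)
Lemma H1_square_point (F : set T) : net R F < +oo -> H1 (sqp @` F) < +oo.
Proof.
move=> Foo; apply: (@le_lt_trans _ _ (2%:E * (net R F + 1%:E))); last first.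
  have : net R F + 1%:E < +oo by rewrite lte_add_pinfty// ltry.
  move: (net_ge0 R F); case: (net R F) => // x _ _; exact: ltry.
apply: ge_ereal_sup => _ [e /= e0 <-].
have [n ne] := rho_small (divr_gt0 e0 (ltr0n R 2)).
have [v [nv Fv vs]] := content_cylinders n F (@ltr01 R).
apply: (@le_trans _ _ (\sum_(0 <= i <oo) diam dist (sqp @` cyl (v i)))).
  apply: ereal_inf_lbound; exists (fun i => sqp @` cyl (v i)) => //; split.
    by move=> _ [t /Fv[i _ it] <-]; exists i => //; exists t.
  move=> i; apply: (le_trans (diam_cyl _)); rewrite lee_fin.
  have := rho_le R (nv i); move: ne; rewrite ltr_pdivlMr//.
  by move: (rho n) (rho (size (v i))) => *; lra.
apply: (@le_trans _ _ (\sum_(0 <= i <oo) (2%:E * (rho (size (v i)))%:E))).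
  by apply: lee_nneseries => [i _ _|i _]; [exact: diam_ge0|rewrite -EFinM; exact: diam_cyl].
rewrite nneseriesZl//.
rewrite lee_pmul2l//; apply: (le_trans vs); apply: leeD2r.
exact: content_le_net.
Qed.

Let content_fin_bigcup n (N : nat) (A : nat -> set T) (c : R) : (0 <= c)%R ->
  (forall i, content R n (A i) <= c%:E) ->
  content R n (\bigcup_(i in `I_N) A i) <= (c *+ N)%:E.
Proof.
move=> c0 h; elim: N => [|N IH].
  rewrite (_ : \bigcup_(_ in _) _ = set0) ?content0//.
  by apply/seteqP; split=> // x [].
rewrite mulrS addrC EFinD; apply: le_trans (leeD IH (h N)).
apply: (le_trans _ (outer_measureU2 _ _ _)); apply: content_le => x [i /= + ix].
by rewrite ltnS leq_eqVlt => /orP[/eqP <-|iN]; [right|left; exists i].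
Qed.

Let content_level n m i j : (n <= m.*2)%N -> content R n
  [set t : T | (numerator (evens t) m).+2 = i /\ (numerator (odds t) m).+2 = j] <=
  (2 ^+ m)^-1%:E.
Proof.
move=> nm; set A := mkset _; have [[t [ti tj]]|A0] := pselect (A !=set0).
  have nt : (n <= size (mkseq t m.*2))%N by rewrite size_mkseq.
  have := content_cyl R nt; rewrite size_mkseq doubleK; apply: le_trans.
  apply: content_le => t' [ti' tj']; rewrite /cyl/= size_mkseq.
  apply/mkseq_interleave; split; apply/numerator_mkseq; apply: succn_inj; apply: succn_inj.
    by rewrite ti' ti.
  by rewrite tj' tj.
rewrite (_ : A = set0) ?content0 ?lee_fin ?invr_ge0 ?exprn_ge0//.
by apply/seteqP; split=> // t At; apply: A0; exists t.
Qed.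

(* Two points of [U] differ by at most two units in each [m]-digit numerator,
   so [U] meets at most 5 * 5 dyadic squares of side [2 ^- m]. *)
Let content_preimage n m (U : set square) : (n <= m.*2)%N ->
  diam dist U <= (2 ^+ m)^-1%:E -> content R n (sqp @^-1` U) <= (25 * (2 ^+ m)^-1)%:E.
Proof.
move=> nm Um; have [[t Ut]|U0] := pselect (sqp @^-1` U !=set0); last first.
  rewrite (_ : sqp @^-1` U = set0).
    by rewrite content0 lee_fin mulr_ge0// invr_ge0 exprn_ge0.
  by apply/seteqP; split=> // t Ut; apply: U0; exists t.
have p0 : (0 <= (2 ^+ m)^-1 :> R)%R by rewrite invr_ge0 exprn_ge0.
have -> : (25 * (2 ^+ m)^-1 = (2 ^+ m)^-1 *+ 5 *+ 5 :> R)%R.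
  by rewrite -mulrnA -[RHS]mulr_natl.
(* The shift by 2 turns differences from -2 to 2 into natural numbers below 5. *)
pose A i j := [set t' : T |
  (numerator (evens t') m).+2 = (numerator (evens t) m + i)%N /\
  (numerator (odds t') m).+2 = (numerator (odds t) m + j)%N].
apply: (@le_trans _ _ (content R n
    (\bigcup_(i in `I_5) \bigcup_(j in `I_5) A i j))); last first.
  apply: content_fin_bigcup => [|i]; first by rewrite mulrn_wge0.
  apply: content_fin_bigcup => // j; exact: content_level.
apply: content_le => t' Ut'.
have d1 : (dist (sqp t) (sqp t') <= (2 ^+ m)^-1)%R.
  by rewrite -lee_fin; apply: le_trans Um; exact: dist_diam.
have [h1 h2] := dist_ge (sqp t) (sqp t').
have {h1}d1' := le_trans h1 d1; have {h2}d2' := le_trans h2 d1.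
have x1 := numerator_near d1'; have x2 := numerator_near d2'.
rewrite distrC in d1'; rewrite distrC in d2'.
have x3 := numerator_near d1'; have x4 := numerator_near d2'.
exists (numerator (evens t') m + 2 - numerator (evens t) m)%N => /=; first by lia.
exists (numerator (odds t') m + 2 - numerator (odds t) m)%N => /=; first by lia.
by split; lia.
Qed.

(** For a positive diameter [d] the scale [m] is chosen with [d] between [2 ^- (m + 1)] and
    [2 ^- m], so that 25 squares of that scale cost at most [50 * d]. For diameter 0 arbitrarily
    fine scales are available. *)
Let content_diam n (U : set square) : diam dist U <= (2 ^+ n)^-1%:E ->
  content R n (sqp @^-1` U) <= 50%:E * diam dist U.
Proof.
move=> Un.
have dfin : diam dist U \is a fin_num.
  by rewrite ge0_fin_numE ?diam_ge0// (le_lt_trans Un)// ltry.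
have := @content_preimage n ^~ U; have := diam_ge0 U.
move: Un; rewrite -(fineK dfin); move: (fine _) => d; rewrite !lee_fin => dn d0 h.
have p0 m : (0 < (2 ^+ m)^-1 :> R)%R by rewrite invr_gt0 exprn_gt0.
have pS m : ((2 ^+ m)^-1 = 2 * (2 ^+ m.+1)^-1 :> R)%R.
  by rewrite exprS invfM mulrA mulfV ?mul1r.
have [d_eq0|d_neq0] := eqVneq d 0%R.
  rewrite d_eq0 mule0; apply/lee_addgt0Pr => e e0; rewrite add0e.
  have [k ke] := rho_small (divr_gt0 e0 (ltr0n R 25)).
  have nk : (n <= (n + k).*2)%N by lia.
  apply: (le_trans (h _ nk _)).
    by rewrite d_eq0 lee_fin ltW.
  rewrite lee_fin; move: ke; rewrite ltr_pdivlMr// mulrC => /ltW; apply: le_trans.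
  rewrite ler_pM2l// lef_pV2 ?posrE ?exprn_gt0// ler_weXn2l ?ler1n//.
  by lia.
have {d_neq0}d_gt0 : (0 < d)%R by rewrite lt_neqAle eq_sym d_neq0.
pose P m := ((2 ^+ m.+1)^-1 < d)%R.
have [m Pm] : exists m, P m.
  have [m /(_ m (leqnn m)) md] := inv_small d_gt0; exists m.
  apply: le_lt_trans md; rewrite lef_pV2 ?posrE ?exprn_gt0// -natrX ler_nat.
  by rewrite ltnW// ltn_expl.
case: (ex_minnP (ex_intro _ m Pm)) => {Pm}m Pm mmin.
have dm : (d <= (2 ^+ m)^-1)%R.
  case: m Pm mmin => [|m] Pm mmin; last by rewrite leNgt; apply/negP => /mmin; rewrite ltnn.
  apply: (le_trans dn); rewrite lef_pV2 ?posrE ?exprn_gt0// ler_weXn2l ?ler1n//.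
have nm : (n <= m)%N.
  rewrite leqNgt; apply/negP => mn; move: (lt_le_trans Pm dn).
  by rewrite ltf_pV2 ?posrE ?exprn_gt0// ltr_eXn2l ?ltr1n// ltnNge mn.
have nm2 : (n <= m.*2)%N by lia.
apply: (le_trans (h _ nm2 _)); first by rewrite lee_fin.
rewrite -EFinM lee_fin pS; move: Pm; rewrite /P.
by move: (2 ^+ m.+1)^-1%R => q; lra.
Qed.

Lemma net_preimage (K : set square) : H1 K < +oo -> net R (sqp @^-1` K) < +oo.
Proof.
move=> Koo; have K0 : 0 <= H1 K.
  apply: (@le_trans _ _ (hausdorff_pre1 dist 1 K)); last first.
    by apply: ereal_sup_ubound; exists 1%R => //=.
  apply: le_ereal_inf_tmp => _ [U _ <-].
  by apply: nneseries_ge0 => i _ _; exact: diam_ge0.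
have Kfin : H1 K \is a fin_num by rewrite ge0_fin_numE.
apply: (@le_lt_trans _ _ (50%:E * (H1 K + 1%:E))); last first.
  by rewrite -(fineK Kfin) -EFinD -EFinM ltry.
apply: net_le => n.
have : hausdorff_pre1 dist (2 ^+ n)^-1 K < H1 K + 1%:E.
  apply: (@le_lt_trans _ _ (H1 K)); last by rewrite lteDl.
  by apply: ereal_sup_ubound; exists (2 ^+ n)^-1%R => //=; rewrite invr_gt0 exprn_gt0.
move=> /ereal_inf_lt[_ [U [KU Un] <-] /ltW Ule].
apply: (@le_trans _ _ (content R n (\bigcup_i (sqp @^-1` U i)))).
  by apply: content_le => t /KU[i _ Ui]; exists i.
apply: (le_trans (content_sub _ _ _)).
apply: (@le_trans _ _ (\sum_(0 <= i <oo) (50%:E * diam dist (U i)))).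
  by apply: lee_nneseries => [i _ _|i _]; [exact: content_ge0|exact: content_diam].
by rewrite nneseriesZl// lee_pmul2l.
Qed.

Let interval (w : seq bool) : set (measurableTypeR R) :=
  let c := numerator (nth false w) (size w) in
  `[(c%:R / 2 ^+ size w)%R, (c.+1%:R / 2 ^+ size w)%R].

Let lebesgue_interval w : lebesgue_measure (interval w) = (2 ^+ size w)^-1%:E.
Proof.
rewrite /interval lebesgue_measure_itv /= lte_fin ltr_pM2r ?invr_gt0 ?exprn_gt0//.
by rewrite ltr_nat ltnSn -EFinD -mulrBl -natrB// subSnn mul1r.
Qed.

Let bval_interval w t : cyl w t -> interval w (bval R t).
Proof.
move=> tw; rewrite /interval /= in_itv /=.
have -> : numerator (nth false w) (size w) = numerator t (size w).
  by apply/numerator_mkseq; rewrite tw mkseq_nth.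
by rewrite bval_ge bval_le.
Qed.

Let bval_continuous : continuous (bval R : T -> R).
Proof.
move=> t N /nbhs_ballP[e /= e0 eN].
have [n /(_ n (leqnn n)) ne] := inv_small e0.
have nt : nbhs t (cyl (mkseq t n) : set T).
  by apply: open_nbhs_nbhs; split; [exact: open_cyl|exact: cyl_mkseq].
apply: filterS nt => t'; rewrite /cyl/= size_mkseq => tt'; apply: eN.
apply: le_lt_trans (bval_near _ (esym tt')) _; apply: le_lt_trans ne.
rewrite lef_pV2 ?posrE ?exprn_gt0// -natrX ler_nat; exact: ltn_expl.
Qed.

Let measurable_bval (K : set T) : compact K ->
  measurable ([set bval R t | t in K] : set (measurableTypeR R)).
Proof.
move=> cK; apply: measurable_realfun.compact_measurable.
apply: continuous_compact => //; apply: continuous_subspaceT.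
exact: bval_continuous.
Qed.

(* Since [2 ^- k <= rho n * rho k] for [n <= k], a set of finite net measure is
   null for the uniform measure, which [bval] maps to Lebesgue measure. *)
Let bval_null (K : set T) : compact K -> net R K < +oo ->
  lebesgue_measure ([set bval R t | t in K] : set (measurableTypeR R)) = 0.
Proof.
move=> cK Koo; apply: le_anti; rewrite measure_ge0 andbT.
have Kfin : net R K \is a fin_num by rewrite ge0_fin_numE ?net_ge0.
pose c := (fine (net R K) + 1)%R.
have c0 : (0 < c)%R by rewrite ltr_wpDl// fine_ge0// net_ge0.
apply/lee_addgt0Pr => e e0; rewrite add0e.
have [n ne] := rho_small (divr_gt0 e0 c0).
have [v [nv Kv vs]] := content_cylinders n K (@ltr01 R).
apply: (@le_trans _ _ (\sum_(0 <= i <oo) lebesgue_measure (interval (v i)))).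
  apply: (measure_sigma_subadditive lebesgue_measure) => [i||].
  - exact: measurable_itv.
  - exact: measurable_bval.
  - by move=> _ [t /Kv[i _ it] <-]; exists i => //; exact: bval_interval.
apply: (@le_trans _ _ (\sum_(0 <= i <oo) ((rho n)%:E * (rho (size (v i)))%:E))).
  apply: lee_nneseries => // i _; rewrite lebesgue_interval -EFinM lee_fin.
  rewrite -invfM -exprD lef_pV2 ?posrE ?exprn_gt0// ler_weXn2l ?ler1n//.
  by have := nv i; lia.
rewrite nneseriesZl//.
apply: (@le_trans _ _ ((rho n)%:E * c%:E)); last first.
  by rewrite -EFinM lee_fin -ler_pdivlMr// ltW.
apply: lee_wpmul2l; first by rewrite lee_fin ltW ?rho_gt0.
apply: (le_trans vs); rewrite /c EFinD fineK//; apply: leeD2r.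
exact: content_le_net.
Qed.

Lemma compact_preimage (K : set square) : compact K -> compact (sqp @^-1` K).
Proof.
move=> cK; apply: (subclosed_compact _ cantor_space_compact) => //.
apply: closed_comp; last exact: square_compact_closed.
by move=> t _; exact: square_point_continuous.
Qed.

(** Every binary sequence is the code of some point of the square, and [bval] maps the sequences
    onto the unit interval. By [bval_null] a countable cover would therefore cover the interval by
    Lebesgue null sets. *)
Lemma square_not_covered : ~ countably_covered (compact_fin (@H1 R)) [set: square].
Proof.
move=> /coveredP[|K KP KT].
  split; first exact: compact0.
  rewrite (_ : set0 = sqp @` set0) ?image_set0//.
  by rewrite -(image_set0 sqp) H1_square_point// net0 ltry.
pose B n : set (measurableTypeR R) := [set bval R t | t in sqp @^-1` K n].
have mB n : measurable (B n).
  by apply: measurable_bval; apply: compact_preimage; case: (KP n).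
have : lebesgue_measure (`[0%R, 1%R] : set (measurableTypeR R)) <=
    \sum_(0 <= n <oo) lebesgue_measure (B n).
  apply: (measure_sigma_subadditive lebesgue_measure) => //.
  move=> x /digitsK xE; have [n _ Kn] := KT (sqp (digits x)) Logic.I.
  by exists n => //; exists (digits x).
rewrite eseries0 => [|n _ _]; last first.
  have [cK Koo] := KP n; apply: bval_null; first exact: compact_preimage.
  exact: net_preimage.
by rewrite lebesgue_measure_itv /= lte01 oppr0 adde0 leNgt lte01.
Qed.

(** Images and preimages under [square_point] preserve compact sets of finite measure, so the two
    covering ideals correspond. A model inside the greedy codes of [B] stays injective with Borel
    images after composition with [square_point]. *)
Lemma H1_densely_modelled :
  densely_modelled (compact_fin (@H1 R)) (fun v : \bar R => v < +oo).
Proof.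
have [code codeP] := net_densely_modelled R.
exists (fun c => sqp @` code c) => B bB nB.
have cF F : compact_fin (net R) F -> compact_fin (@H1 R) (sqp @` F).
  move=> [cF Foo]; split; last exact: H1_square_point.
  apply: continuous_compact => //; apply: continuous_subspaceT.
  exact: square_point_continuous.
have cK K : compact_fin (@H1 R) K -> compact_fin (net R) (sqp @^-1` K).
  by move=> [cK Koo]; split; [exact: compact_preimage|exact: net_preimage].
have covered_image A : countably_covered (compact_fin (net R)) A ->
    countably_covered (compact_fin (@H1 R)) (sqp @` A).
  move=> [F [F_countable FP AF]]; exists [set sqp @` K | K in F]; split.
  - exact: (card_le_trans (card_image_le _ _)).
  - by move=> _ [K FK <-]; apply: cF; exact: FP.
  - by move=> _ [t /AF[K FK Kt] <-]; exists (sqp @` K); [exists K|exists t].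
have covered_preimage A : countably_covered (compact_fin (@H1 R)) (sqp @` A) ->
    countably_covered (compact_fin (net R)) A.
  move=> [F [F_countable FP AF]]; exists [set sqp @^-1` K | K in F]; split.
  - exact: (card_le_trans (card_image_le _ _)).
  - by move=> _ [K FK <-]; apply: cK; exact: FP.
  - move=> t At; have [K FK Kt] := AF _ (imageP sqp At).
    by exists (sqp @^-1` K) => //; exists K.
pose A := (sqp @^-1` B) `&` @coded R.
have bA : borel A.
  apply: borelI; last exact: borel_coded.
  exact: continuous_borel (@square_point_continuous R) bB.
have AB : sqp @` A = B.
  rewrite coded_image; last by move=> t [].
  apply/seteqP; split=> p; rewrite /A /coded /= square_codeK.
    by move=> [].
  by move=> Bp; split=> //; rewrite square_codeK.
have nA : ~ countably_covered (compact_fin (net R)) A.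
  by move=> /covered_image; rewrite AB.
have [g [[gI gi gp gs] gA [c cE]]] := codeP A bA nA.
have gc t : range g t -> coded R t by move=> /gA[].
exists (sqp \o g); split; first split.
- move=> x y /= /(congr1 (@square_code R)) xy; apply: gI.
  by rewrite -(gc (g x)) ?xy; [rewrite (gc (g y))//; exists y|exists x].
- move=> D /gi bD; rewrite -image_comp coded_image.
    exact: borel_square_code.
  by move=> _ [x _ <-]; apply: gc; exists x.
- move=> D bD; apply: (gp (sqp @^-1` D)).
  exact: continuous_borel (@square_point_continuous R) bD.
- move=> D sD; rewrite -gs// -image_comp.
  by split=> [/covered_preimage|/covered_image].
- by move=> _ [x _ <-]; rewrite -AB; exists (g x) => //; apply: gA; exists x.
- by exists c; rewrite -cE image_comp.
Qed.

End HausdorffSquare.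

Theorem theorem1p2 (R : realType) (X : ptopologicalType)
    (X_compact : compact [set: X]) (X_metrizable : metrizable R X)
    (mu : {measure set (g_sigma_algebraType (@open X)) -> \bar R})
    (mu_nonatomic : nonatomic mu) :
  (~ Jf mu [set: X] ->
   (forall B : set X, borel B -> ~ Jf mu B ->
      exists C : set X, [/\ borel C, C `<=` B, ~ Jf mu C & (mu C < +oo)%E]) ->
   homogeneous (completion (Bor_mod_Jf mu)) /\
   ba_isomorphic (completion (Bor_mod_Jf mu))
                 (completion (Bor_mod_Jf (@H1 R))))
  /\
  (semifinite mu -> (0 < mu [set: X])%E ->
   homogeneous (completion (Bor_mod_J0 mu)) /\
   ba_isomorphic (completion (Bor_mod_J0 mu))
                 (completion (Bor_mod_J0 (@lambda R)))).
Proof.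
have [dist dm dn] := X_metrizable; have dX : metrizes dist by split.
have mu0 := nonatomic_point dX mu_nonatomic.
have sf := nonatomic_semifinite mu_nonatomic.
split.
  have oo : ~ (+oo < +oo :> \bar R)%E by rewrite ltxx.
  move=> nX small.
  have PX : densely_modelled (compact_fin mu) (fun v : \bar R => (v < +oo)%E).
    apply: (densely_modelled_fin dX X_compact mu0 sf) => B bB nB.
    have [|C [bC CB nC Coo]] := small B bB; first by move=> [].
    by exists C; split=> // cC; apply: nC.
  split; first exact: (densely_modelled_homogeneous oo PX).
  apply: (densely_modelled_isomorphic oo PX (H1_densely_modelled R)).
    by move=> cX; apply: nX; split=> //; exact: g_sigmaT.
  exact: square_not_covered.
move=> _ muX; have n0 : ~ (+oo = 0 :> \bar R)%E by [].
have PX := densely_modelled_null dX X_compact mu0 sf.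
split; first exact: (densely_modelled_homogeneous n0 PX).
apply: (densely_modelled_isomorphic n0 PX (lambda_densely_modelled R)).
  move=> /(covered_null dX (mu := mu) measurableT) muX0.
  by rewrite muX0 ltxx in muX.
exact: lambda_not_covered.
Qed.
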